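(* Let $X$ be an analytic vector field in a neighborhood $U$ of the origin $O\in\mathbb{R}^2$. Assume that $X(O)=0$ and that $DX(O)$ generates a rotation. Then the following conditions are equivalent: (i) The origin is a center singularity for $X$. (ii) There is a sequence of periodic orbits $\gamma_\nu\subset U\setminus\{O\}$, $\nu\in\mathbb{N}$, of $X$ such that $\gamma_\nu\to O$ as $\nu\to\infty$ (in the sense of the Hausdorff topology). In case any of the conditions above is verified, $X$ admits an analytic first integral in the strong sense in a neighborhood of the origin.
   Context: Analytic means real analytic. A real $2\times 2$ matrix $A$ generates a rotation if all the orbits of the one-parameter group $\exp(tA)$, $t\in\mathbb{R}$, outside the origin of $\mathbb{R}^2$ are periodic and nontrivial; this corresponds to the eigenvalues of $A$ being purely imaginary of the form $\pm i\omega$ with $\omega\in\mathbb{R}\setminus\{0\}$. An isolated singularity of a smooth planar vector field is a center if it has a neighborhood consisting only of the singularity and periodic orbits (diffeomorphic to the circle $S^1$). Periodic orbits are nontrivial (not singular points). Convergence $\gamma_\nu\to O$ in the Hausdorff topology means that for every neighborhood $W$ of $O$ one has $\gamma_\nu\subset W$ for all large $\nu$. An analytic first integral of $X$ near $O$ is a non-constant real analytic function $f$, defined in a neighborhood of $O$, with $X(f)=0$, i.e. constant on each orbit of $X$. ''In the strong sense'' is understood here to mean that $f$ may be taken of Morse type at $O$: in suitable coordinates $(x_1,x_2)$ centered at $O$, $f(x_1,x_2)=x_1^2+x_2^2+{}$higher order terms. Equivalently, writing $X=P\,\partial/\partial x+Q\,\partial/\partial y$, the 1-form $P\,dy-Q\,dx$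 equals $g\,df$ with $g$ real analytic and $g(O)\neq 0$. *)

(* Defs.v *)
From mathcomp Require Export all_boot all_order all_algebra.
From mathcomp Require Export all_classical all_reals all_analysis.
Export Order.TTheory GRing.Theory Num.Theory.
Export numFieldNormedType.Exports.

Set Implicit Arguments.
Unset Strict Implicit.
Unset Printing Implicit Defensive.

Local Open Scope classical_set_scope.
Local Open Scope ring_scope.

(** Points and vectors of the plane are row vectors
    ['rV[R]_2], with coordinates [x 0 0] and [x 0 1]; the library norm on them
    is the sup norm, and matrices act on the right. Functions and vector fields
    are total; only their values on the stated open set are constrained. *)

Definition monomial2 (R : realType) (c : nat -> nat -> R) (i j : nat)
    (h : 'rV[R]_2) : R :=
  c i j * h 0 0 ^+ i * h 0 1 ^+ j.

(** On the polydisc of radius [r] about [p], the double series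
    [\sum_(i, j) c i j * h1 ^ i * h2 ^ j] converges absolutely to [f (p + h)].
    The series is summed along the diagonals [i + j = n]; by absolute
    convergence the order of summation is immaterial. *)
Definition has_power_series (R : realType) (f : 'rV[R]_2 -> R) (p : 'rV[R]_2)
    (c : nat -> nat -> R) (r : R) : Prop :=
  forall h : 'rV[R]_2, `|h| < r ->
    cvgn (series (fun n => \sum_(i < n.+1) `|monomial2 c i (n - i) h|)) /\
    series (fun n => \sum_(i < n.+1) monomial2 c i (n - i) h) @ \oo
      --> f (p + h).

Definition analytic_at (R : realType) (f : 'rV[R]_2 -> R) (p : 'rV[R]_2) :
    Prop :=
  exists c r, 0 < r /\ has_power_series f p c r.

Definition analytic_on (R : realType) (U : set 'rV[R]_2)
    (f : 'rV[R]_2 -> R) : Prop :=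
  forall p, U p -> analytic_at f p.

Definition analytic_map_on (R : realType) (U : set 'rV[R]_2)
    (F : 'rV[R]_2 -> 'rV[R]_2) : Prop :=
  forall i : 'I_2, analytic_on U (fun p => F p 0 i).

Definition order_at0_ge (R : realType) (k : nat) (h : 'rV[R]_2 -> R) : Prop :=
  exists c r, [/\ 0 < r, has_power_series h 0 c r &
    forall i j, (i + j < k)%N -> c i j = 0].

Definition expmx (R : realType) (n : nat) (A : 'M[R]_n.+1) : 'M[R]_n.+1 :=
  lim (series (fun k => (k`!%:R)^-1 *: A ^+ k) @ \oo).

(** [A] acts on row vectors, as does the Jacobian ['J X p], for which
    ['d X p v = v *m 'J X p]. *)
Definition generates_rotation (R : realType) (A : 'M[R]_2) : Prop :=
  forall v : 'rV[R]_2, v != 0 ->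
    (exists2 T : R, 0 < T &
      forall t : R, v *m expmx ((t + T) *: A) = v *m expmx (t *: A)) /\
    (exists t : R, v *m expmx (t *: A) != v).

Definition periodic_orbit (R : realType) (U : set 'rV[R]_2)
    (X : 'rV[R]_2 -> 'rV[R]_2) (C : set 'rV[R]_2) : Prop :=
  exists g : R -> 'rV[R]_2,
    [/\ forall t, U (g t),
        forall t : R, is_derive t 1 g (X (g t)),
        exists2 T : R, 0 < T & forall t, g (t + T) = g t,
        exists t, g t != g 0 &
        C = range g].

Definition isolated_singularity (R : realType) (X : 'rV[R]_2 -> 'rV[R]_2)
    (p : 'rV[R]_2) : Prop :=
  X p = 0 /\ \forall q \near p, q != p -> X q != 0.

Definition center (R : realType) (U : set 'rV[R]_2)
    (X : 'rV[R]_2 -> 'rV[R]_2) (p : 'rV[R]_2) : Prop :=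
  isolated_singularity X p /\
  exists V : set 'rV[R]_2,
    [/\ nbhs p V, V `<=` U &
      forall q, V q -> q != p ->
        exists C, [/\ periodic_orbit U X C, C q & C `<=` V]].

Definition shrinks_to (R : realType) (C : nat -> set 'rV[R]_2)
    (p : 'rV[R]_2) : Prop :=
  forall W : set 'rV[R]_2, nbhs p W -> \forall n \near \oo, C n `<=` W.

(** [phi : V -> W] is an analytic coordinate system centered at the origin,
    with analytic inverse [psi : W -> V]. *)
Definition analytic_coordinates (R : realType) (V W : set 'rV[R]_2)
    (phi psi : 'rV[R]_2 -> 'rV[R]_2) : Prop :=
  [/\ [/\ open V, open W, V 0, W 0 & phi 0 = 0],
      analytic_map_on V phi /\ analytic_map_on W psi,
      (forall p, V p -> W (phi p) /\ psi (phi p) = p) &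
      (forall x, W x -> V (psi x) /\ phi (psi x) = x)].

Definition morse_type_at0 (R : realType) (f : 'rV[R]_2 -> R) : Prop :=
  exists (V W : set 'rV[R]_2) (phi psi : 'rV[R]_2 -> 'rV[R]_2)
    (h : 'rV[R]_2 -> R),
    [/\ analytic_coordinates V W phi psi,
        order_at0_ge 3 h &
        forall x, W x -> f (psi x) = x 0 0 ^+ 2 + x 0 1 ^+ 2 + h x].

(** ['D_(X p) f p] is [X(f)] at [p]. *)
Definition analytic_first_integral (R : realType) (V : set 'rV[R]_2)
    (X : 'rV[R]_2 -> 'rV[R]_2) (f : 'rV[R]_2 -> R) : Prop :=
  [/\ analytic_on V f,
      exists p q, [/\ V p, V q & f p != f q] &
      forall p, V p -> 'D_(X p) f p = 0].

Definition strong_first_integral_at0 (R : realType) (U : set 'rV[R]_2)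
    (X : 'rV[R]_2 -> 'rV[R]_2) : Prop :=
  exists (V : set 'rV[R]_2) (f : 'rV[R]_2 -> R),
    [/\ [/\ open V, V 0 & V `<=` U],
        analytic_first_integral V X f & morse_type_at0 f].

(* Main.v *)
(* In a complex coordinate z where the linear part reads z' = i omega z, one
   solves X o Phi = DPhi.(i omega (1 + a) zeta) + b zeta for a change of
   variables Phi(zeta) = zeta + phi(zeta, conj zeta) and real power series a, b
   in |zeta|^2. Nonresonant coefficients of phi come with the divisors
   i omega (k - l - 1), which control the derivative of phi along rotations, so
   that the recursion preserves a ball of a weighted l^1 norm and always
   converges. With Psi the inverse of Phi, the derivative of |Psi|^2 along X has
   the sign of b. If b <> 0, then |Psi|^2 is strictly monotone along orbits near
   the origin and no periodic orbit meets a small neighbourhood of it. If b = 0,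
   the orbits are Phi(exp(i Omega t) zeta), and |Psi|^2 is an analytic first
   integral which Phi puts in the form x^2 + y^2. *)

From HB Require Import structures.
Require Import Defs.
From mathcomp Require Import complex ring lra zify.

Set Implicit Arguments.
Unset Strict Implicit.
Unset Printing Implicit Defensive.

Local Open Scope classical_set_scope.
Local Open Scope ring_scope.

(** The term [b zeta] stands outside [DPhi] for a reason. The divisor [k - l - 1] compensates for
    the factor [k - l] produced by a derivative along rotations, but not for the factor [k + l]
    produced by a radial derivative, so transporting [b zeta] by [DPhi] would lose a derivative at
    every step. The price is that the equation is a conjugacy only for [b = 0]. For [b <> 0] it
    still gives a Lyapunov function, because [DPsi - id] is small near the origin and [DPsi] moves
    [b zeta] only a little. The recursions raise the degree, so their fixed points exist as formal
    series; norm estimates serve only to keep them in a ball. The ball is preserved at a small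
    radius because all nonlinear terms are at least quadratic. Analyticity decides the dichotomy: a
    convergent real series in [|zeta|^2] either vanishes identically or has near 0 the strict sign
    of its first nonzero coefficient. *)

(** * Convolution of double sums *)

Section TriangularSums.
Variable V : nmodType.
Implicit Types F G : nat -> nat -> V.

Definition diag F n := \sum_(i < n.+1) F i (n - i)%N.
(** Summation by total degree, the order used in [has_power_series]. *)
Definition tri F N := \sum_(n < N) diag F n.

Lemma tri_recr F N : tri F N.+1 = tri F N + diag F N.
Proof. by rewrite /tri big_ord_recr. Qed.

Lemma tri0 F : tri F 0 = 0.
Proof. by rewrite /tri big_ord0. Qed.

Lemma eq_diag F G n : (forall i j, F i j = G i j) -> diag F n = diag G n.
Proof. by move=> FG; apply: eq_bigr => i _. Qed.

Lemma eq_tri F G N : (forall i j, (i + j < N)%N -> F i j = G i j) ->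
  tri F N = tri G N.
Proof.
move=> FG; apply: eq_bigr => n _; apply: eq_bigr => i _; apply: FG.
by rewrite subnKC ?ltn_ord // -ltnS.
Qed.

Lemma triD F G N : tri (fun i j => F i j + G i j) N = tri F N + tri G N.
Proof.
by rewrite /tri -big_split; apply: eq_bigr => n _; rewrite /diag big_split.
Qed.

Lemma tri_rows G N : tri G N = \sum_(i < N) \sum_(p < N - i) G i p.
Proof.
elim: N => [|N IHN]; first by rewrite tri0 big_ord0.
rewrite tri_recr IHN /diag [in RHS]big_ord_recr /= [in LHS]big_ord_recr /=.
rewrite subnn subSnn big_ord1 addrA; congr (_ + _).
rewrite -big_split; apply: eq_bigr => i _ /=.
by rewrite (subSn (ltnW (ltn_ord i))) big_ord_recr.
Qed.

Lemma tri_tr G N : tri G N = tri (fun i j => G j i) N.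
Proof.
apply: eq_bigr => n _; rewrite /diag (reindex_inj rev_ord_inj) /=.
by apply: eq_bigr => i _; rewrite subSS subKn // -ltnS.
Qed.

End TriangularSums.

Section Convolution.
Variable K : comNzRingType.
Implicit Types u v : nat -> nat -> K.

Definition conv u v : nat -> nat -> K := fun k l =>
  \sum_(i < k.+1) \sum_(j < l.+1) u i j * v (k - i)%N (l - j)%N.

Lemma triMl c u N : tri (fun i j => c * u i j) N = c * tri u N.
Proof.
by rewrite /tri mulr_sumr; apply: eq_bigr => n _; rewrite /diag mulr_sumr.
Qed.

(** Both sides sum [u i j * v p q] over [i + j + p + q = n]. Once [i] is fixed they differ only in
    the order of summation over [p] and [j], which [tri_tr] exchanges. *)
Lemma diag_conv u v n :
  diag (conv u v) n = \sum_(m < n.+1) diag u m * diag v (n - m)%N.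
Proof.
pose G i p := \sum_(j < (n - i - p).+1) u i j * v p (n - i - p - j)%N.
pose H i j := \sum_(p < (n - i - j).+1) u i j * v p (n - i - j - p)%N.
transitivity (tri G n.+1).
  apply: eq_bigr => k _; apply: eq_bigr => i _.
  have ik : (i <= k)%N by rewrite -ltnS.
  by rewrite /G -subnDA subnKC.
transitivity (tri H n.+1); last first.
  apply: eq_bigr => m _; rewrite /diag mulr_suml; apply: eq_bigr => i _.
  have im : (i <= m)%N by rewrite -ltnS.
  by rewrite mulr_sumr /H -subnDA subnKC.
rewrite !tri_rows; apply: eq_bigr => i _.
have -> : (n.+1 - i = (n - i).+1)%N by rewrite subSn // -ltnS.
rewrite /G /H {G H}; move: (n - i)%N => N.
transitivity (tri (fun p j => u i j * v p (N - p - j)%N) N.+1).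
  by rewrite tri_rows; apply: eq_bigr => p _; rewrite subSn // -ltnS.
rewrite tri_tr tri_rows; apply: eq_bigr => p _.
rewrite subSn; last by rewrite -ltnS.
by apply: eq_bigr => j _; rewrite -!subnDA [(p + j)%N]addnC.
Qed.

Lemma sum_cauchy_rows (a b : nat -> K) N :
  \sum_(n < N) \sum_(m < n.+1) a m * b (n - m)%N =
  \sum_(m < N) a m * \sum_(k < N - m) b k.
Proof.
transitivity (tri (fun m k => a m * b k) N); first by [].
by rewrite tri_rows; apply: eq_bigr => m _; rewrite mulr_sumr.
Qed.

Fixpoint convX u n : nat -> nat -> K :=
  if n is m.+1 then conv u (convX u m)
  else fun i j => ((i == 0%N) && (j == 0%N))%:R.

(** Convolution respects the bidegree. Hence norms and values of a convolution reduce to products of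
    sums of weighted terms. *)
Lemma conv_weight u v (z w : K) k l :
  conv (fun i j => u i j * z ^+ i * w ^+ j) (fun i j => v i j * z ^+ i * w ^+ j)
    k l = conv u v k l * z ^+ k * w ^+ l.
Proof.
rewrite /conv !mulr_suml; apply: eq_bigr => i _; rewrite !mulr_suml.
apply: eq_bigr => j _.
have ik : (i <= k)%N by rewrite -ltnS.
have jl : (j <= l)%N by rewrite -ltnS.
rewrite -[in z ^+ k](subnKC ik) -[in w ^+ l](subnKC jl) !exprD; ring.
Qed.

End Convolution.

(** * Complex sequences *)

Section ComplexNorm.
Variable R : realType.
Local Notation C := R[i].
Implicit Types (x y z w : C) (s t : nat -> C).

(** The norm of [R[i]] itself takes its values in [R[i]]; passing through [Rcomplex R] gives a real
    number. *)
Definition cnorm (x : C) : R := `|(x : Rcomplex R)|.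
Definition cconj x : C := (x^*)%C.

Lemma cnormE a b : cnorm (Complex a b) = Num.sqrt (a ^+ 2 + b ^+ 2).
Proof. by []. Qed.

Lemma cnorm_ge0 x : 0 <= cnorm x. Proof. exact: normr_ge0. Qed.

Lemma cnormD x y : cnorm (x + y) <= cnorm x + cnorm y.
Proof. exact: (@ler_normD R (Rcomplex R)). Qed.

Lemma cnormN x : cnorm (- x) = cnorm x.
Proof. exact: (@normrN R (Rcomplex R)). Qed.

Lemma cnorm_distC x y : cnorm (x - y) = cnorm (y - x).
Proof. by rewrite -cnormN opprB. Qed.

Lemma cnormM x y : cnorm (x * y) = cnorm x * cnorm y.
Proof. exact: Normc.normcM. Qed.

Lemma cnorm0 : cnorm 0 = 0. Proof. exact: (@normr0 R (Rcomplex R)). Qed.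

Lemma cnorm1 : cnorm 1 = 1. Proof. exact: Normc.normc1. Qed.

Lemma cnorm_eq0 x : cnorm x = 0 -> x = 0.
Proof. exact: Normc.eq0_normc. Qed.

Lemma cnormX x n : cnorm (x ^+ n) = cnorm x ^+ n.
Proof.
by elim: n => [|n IH]; rewrite ?expr0 ?cnorm1 // !exprS cnormM IH.
Qed.

Lemma cnormV x : cnorm x^-1 = (cnorm x)^-1. Proof. exact: Normc.normcV. Qed.

Lemma cnorm_sum (I : Type) (r : seq I) (P : pred I) (F : I -> C) :
  cnorm (\sum_(i <- r | P i) F i) <= \sum_(i <- r | P i) cnorm (F i).
Proof. exact: (@ler_norm_sum R (Rcomplex R)). Qed.

Lemma cnormC (a : R) : cnorm a%:C%C = `|a|.
Proof. by rewrite cnormE expr0n addr0 sqrtr_sqr. Qed.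

Lemma cnorm_i : cnorm 'i%C = 1.
Proof. by rewrite cnormE expr0n add0r expr1n sqrtr1. Qed.

Lemma cnorm_conj x : cnorm (cconj x) = cnorm x.
Proof. by case: x => a b; rewrite /cconj /= !cnormE sqrrN. Qed.

Lemma Re_le_cnorm x : `|Re x| <= cnorm x.
Proof.
case: x => a b; rewrite cnormE -sqrtr_sqr ler_wsqrtr //= lerDl; exact: sqr_ge0.
Qed.

Lemma Im_le_cnorm x : `|Im x| <= cnorm x.
Proof.
case: x => a b; rewrite cnormE -sqrtr_sqr ler_wsqrtr //= lerDr; exact: sqr_ge0.
Qed.

Lemma cnorm_le_ReIm x : cnorm x <= `|Re x| + `|Im x|.
Proof.
have -> : x = (Re x)%:C%C + 'i%C * (Im x)%:C%C by rewrite -complexE.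
apply: le_trans (cnormD _ _) _; rewrite cnormM cnorm_i mul1r !cnormC.
by rewrite -complexE.
Qed.

Lemma cconjD x y : cconj (x + y) = cconj x + cconj y.
Proof. exact: rmorphD. Qed.

Lemma cconjM x y : cconj (x * y) = cconj x * cconj y.
Proof. exact: rmorphM. Qed.

Lemma cconjX x n : cconj (x ^+ n) = cconj x ^+ n.
Proof. exact: rmorphXn. Qed.

Lemma ReD x y : Re (x + y) = Re x + Re y.
Proof. by case: x y => a b []. Qed.

Lemma ImD x y : Im (x + y) = Im x + Im y.
Proof. by case: x y => a b []. Qed.

Lemma ReB x y : Re (x - y) = Re x - Re y.
Proof. by case: x y => a b []. Qed.

Lemma ImB x y : Im (x - y) = Im x - Im y.
Proof. by case: x y => a b []. Qed.

Lemma Re_sum (I : Type) (r : seq I) (P : pred I) (F : I -> C) :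
  Re (\sum_(i <- r | P i) F i) = \sum_(i <- r | P i) Re (F i).
Proof. exact: (big_morph _ ReD (erefl : Re (0 : C) = 0)). Qed.

Lemma Im_sum (I : Type) (r : seq I) (P : pred I) (F : I -> C) :
  Im (\sum_(i <- r | P i) F i) = \sum_(i <- r | P i) Im (F i).
Proof. exact: (big_morph _ ImD (erefl : Im (0 : C) = 0)). Qed.

Lemma cconj_sum (I : Type) (r : seq I) (P : pred I) (F : I -> C) :
  cconj (\sum_(i <- r | P i) F i) = \sum_(i <- r | P i) cconj (F i).
Proof. exact: rmorph_sum. Qed.

(** Complex convergence is expressed by real null sequences, so that only the topology of [R] is
    involved. *)
Definition ccvg s (l : C) := (fun n => cnorm (s n - l)) @ \oo --> (0 : R).
Definition clim s : C :=
  Complex (limn (fun n => Re (s n))) (limn (fun n => Im (s n))).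

Lemma ccvg_dom s l (e : nat -> R) : e @ \oo --> (0 : R) ->
  (forall n, cnorm (s n - l) <= e n) -> ccvg s l.
Proof.
move=> e0 se; apply: (squeeze_cvgr _ (cvg_cst 0) e0).
by near=> n; rewrite cnorm_ge0 se.
Unshelve. all: by end_near. Qed.

Lemma ccvgP s l : ccvg s l <->
  (fun n => Re (s n)) @ \oo --> Re l /\ (fun n => Im (s n)) @ \oo --> Im l.
Proof.
split=> [sl|[sr si]].
  split; apply/cvgrPdist_le => e e0; near=> n.
    rewrite distrC -ReB; apply: le_trans (Re_le_cnorm _) _.
    rewrite -[cnorm _]ger0_norm ?cnorm_ge0 // -[cnorm _]subr0 distrC.
    by near: n; move/cvgrPdist_le: sl; apply.
  rewrite distrC -ImB; apply: le_trans (Im_le_cnorm _) _.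
  rewrite -[cnorm _]ger0_norm ?cnorm_ge0 // -[cnorm _]subr0 distrC.
  by near: n; move/cvgrPdist_le: sl; apply.
apply: (@ccvg_dom _ _ (fun n => `|Re (s n) - Re l| + `|Im (s n) - Im l|)).
  rewrite -[X in _ --> X]addr0 -(normr0 R) -{1}(subrr (Re l)) -(subrr (Im l)).
  by apply: cvgD; apply: cvg_norm; apply: cvgB => //; apply: cvg_cst.
by move=> n; rewrite -ReB -ImB; exact: cnorm_le_ReIm.
Unshelve. all: by end_near. Qed.

Lemma ccvg_clim s l : ccvg s l -> clim s = l.
Proof.
move=> /ccvgP [sr si]; case: l sr si => a b sr si.
by congr Complex; apply: cvg_lim => //; exact: norm_hausdorff.
Qed.

Lemma ccvg_unique s l l' : ccvg s l -> ccvg s l' -> l = l'.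
Proof. by move=> /ccvg_clim <- /ccvg_clim <-. Qed.

Lemma eq_ccvg s t l : (forall n, s n = t n) -> ccvg s l -> ccvg t l.
Proof. by move=> /funext ->. Qed.

Lemma ccvg_near s l N : (forall n, (N <= n)%N -> s n = l) -> ccvg s l.
Proof.
move=> sl; rewrite /ccvg; apply: cvg_near_cst; exists N => // n /= Nn.
by rewrite sl // subrr cnorm0.
Qed.

Lemma ccvgD s t l m : ccvg s l -> ccvg t m ->
  ccvg (fun n => s n + t n) (l + m).
Proof.
move=> sl tm.
apply: (@ccvg_dom _ _ (fun n => cnorm (s n - l) + cnorm (t n - m))).
  by rewrite -[X in _ --> X]addr0; apply: cvgD.
by move=> n; rewrite opprD addrACA; exact: cnormD.
Qed.

Lemma ccvgMl (c : C) s l : ccvg s l -> ccvg (fun n => c * s n) (c * l).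
Proof.
move=> sl; apply: (@ccvg_dom _ _ (fun n => cnorm c * cnorm (s n - l))).
  by rewrite -[X in _ --> X](mulr0 (cnorm c)); apply: cvgM => //; apply: cvg_cst.
by move=> n; rewrite -mulrBr cnormM.
Qed.

Lemma ccvgM s t l m : ccvg s l -> ccvg t m ->
  ccvg (fun n => s n * t n) (l * m).
Proof.
move=> sl tm; apply: (@ccvg_dom _ _ (fun n =>
  cnorm (s n - l) * (cnorm (t n - m) + cnorm m) + cnorm l * cnorm (t n - m))).
  have := cvgD (cvgM sl (cvgD tm (cvg_cst (cnorm m)))) (cvgM (cvg_cst (cnorm l)) tm).
  by rewrite mul0r mulr0 addr0; apply.
move=> n.
have -> : s n * t n - l * m = (s n - l) * t n + l * (t n - m) by ring.
apply: le_trans (cnormD _ _) _; rewrite !cnormM lerD2r.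
apply: ler_wpM2l; first exact: cnorm_ge0.
by rewrite -[X in cnorm X <= _](subrK m) cnormD.
Qed.

Lemma ccvg_le s l (B : R) : ccvg s l ->
  (\forall n \near \oo, cnorm (s n) <= B) -> cnorm l <= B.
Proof.
move=> sl sB; apply/ler_addgt0Pr => e e0; near \oo => n.
have h1 : cnorm (s n) <= B by near: n.
have : `|0 - cnorm (s n - l)| <= e.
  by near: n; move/cvgrPdist_le: sl; apply.
rewrite sub0r normrN ger0_norm ?cnorm_ge0 // cnorm_distC => h2.
have := cnormD (l - s n) (s n); rewrite subrK; lra.
Unshelve. all: by end_near. Qed.

Lemma ccvg_series (a : nat -> C) (B : R) :
  (forall N, \sum_(n < N) cnorm (a n) <= B) ->
  ccvg (fun N => \sum_(n < N) a n) (clim (fun N => \sum_(n < N) a n)).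
Proof.
move=> aB; apply/ccvgP.
have P (p : C -> R) : (forall x, `|p x| <= cnorm x) ->
    cvgn (fun N => \sum_(n < N) p (a n)).
  move=> pc.
  have -> : (fun N => \sum_(n < N) p (a n)) = series (fun n => p (a n)).
    by apply/funext => N; rewrite /series /= big_mkord.
  apply: normed_cvg; apply: nondecreasing_is_cvgn.
    by apply: nondecreasing_series => n _ _; exact: normr_ge0.
  exists B => _ [N _ <-]; apply: le_trans (aB N).
  by rewrite /series /= /series /= big_mkord; apply: ler_sum => n _.
split=> /=.
  under eq_fun do rewrite Re_sum; exact: (P (@Re R) Re_le_cnorm).
under eq_fun do rewrite Im_sum; exact: (P (@Im R) Im_le_cnorm).
Qed.

Lemma ccvg_conj s l : ccvg s l -> ccvg (fun n => cconj (s n)) (cconj l).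
Proof.
move=> sl; apply: (ccvg_dom sl) => n.
by rewrite /cconj -rmorphB /= cnorm_conj.
Qed.

End ComplexNorm.

(** * Double power series *)

Section RealTriangularSums.
Variable R : realType.
Implicit Types F G : nat -> nat -> R.

Lemma ler_tri F G N : (forall i j, (i + j < N)%N -> F i j <= G i j) ->
  tri F N <= tri G N.
Proof.
move=> FG; apply: ler_sum => n _; apply: ler_sum => i _; apply: FG.
by rewrite subnKC // -ltnS.
Qed.

Lemma diag_ge0 F n : (forall i j, 0 <= F i j) -> 0 <= diag F n.
Proof. by move=> F0; apply: sumr_ge0. Qed.

Lemma tri_ge0 F N : (forall i j, 0 <= F i j) -> 0 <= tri F N.
Proof. by move=> F0; apply: sumr_ge0 => n _; exact: diag_ge0. Qed.

Lemma ler_tri_nat F M N : (forall i j, 0 <= F i j) -> (M <= N)%N ->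
  tri F M <= tri F N.
Proof.
move=> F0; elim: N => [|N IH]; first by rewrite leqn0 => /eqP ->.
rewrite leq_eqVlt ltnS => /predU1P[-> //|/IH]; rewrite tri_recr.
by have := diag_ge0 N F0; lra.
Qed.

Lemma term_le_tri F i j N : (forall i j, 0 <= F i j) -> (i + j < N)%N ->
  F i j <= tri F N.
Proof.
move=> F0 ijN; apply: le_trans (ler_tri_nat F0 ijN).
rewrite tri_recr /diag.
have iS : (i < (i + j).+1)%N by rewrite ltnS leq_addr.
rewrite (bigD1 (Ordinal iS)) //= addKn.
have := tri_ge0 (i + j) F0.
have : 0 <= \sum_(k < (i + j).+1 | k != Ordinal iS) F k (i + j - k)%N.
  by apply: sumr_ge0.
lra.
Qed.

Lemma cauchy_le (a b : nat -> R) N : (forall n, 0 <= a n) ->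
  (forall n, 0 <= b n) ->
  \sum_(n < N) \sum_(m < n.+1) a m * b (n - m)%N <=
  (\sum_(n < N) a n) * (\sum_(n < N) b n).
Proof.
move=> a0 b0; rewrite sum_cauchy_rows mulr_suml; apply: ler_sum => m _.
apply: ler_wpM2l => //.
rewrite -!(big_mkord xpredT) [leRHS](@big_cat_nat _ _ _ (N - m)) ?leq_subr //=.
by rewrite lerDl; apply: sumr_ge0.
Qed.

(** The square of side [N] lies in the triangle of side [2N], just as in [cauchy_le] the triangle of
    side [N] lies in the square. *)
Lemma cauchy_ge (a b : nat -> R) N : (forall n, 0 <= a n) ->
  (forall n, 0 <= b n) ->
  (\sum_(n < N) a n) * (\sum_(n < N) b n) <=
  \sum_(n < N + N) \sum_(m < n.+1) a m * b (n - m)%N.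
Proof.
move=> a0 b0; rewrite sum_cauchy_rows mulr_suml big_split_ord /=.
rewrite -[leLHS]addr0; apply: lerD; last first.
  by apply: sumr_ge0 => i _; apply: mulr_ge0 => //; apply: sumr_ge0.
apply: ler_sum => m _; apply: ler_wpM2l => //.
rewrite -!(big_mkord xpredT) [leRHS](@big_cat_nat _ _ _ N) //=; last first.
  by rewrite -addnBA ?leq_addr // ltnW.
by rewrite lerDl; apply: sumr_ge0.
Qed.

Lemma tri_conv_le F G N : (forall i j, 0 <= F i j) ->
  (forall i j, 0 <= G i j) -> tri (conv F G) N <= tri F N * tri G N.
Proof.
move=> F0 G0; apply: le_trans (cauchy_le _ _ _) => [|n|n].
- by apply: ler_sum => n _; rewrite diag_conv.
- exact: diag_ge0.
- exact: diag_ge0.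
Qed.

Lemma nondecreasing_bounded_cvgn (a : nat -> R) (B : R) :
  {homo a : m n / (m <= n)%N >-> m <= n} -> (forall n, a n <= B) -> cvgn a.
Proof.
by move=> am aB; apply: nondecreasing_is_cvgn => //; exists B => _ [n _ <-].
Qed.

(** With [c N] the triangular sum, the product of partial sums lies between [c N] and [c (2N)],
    hence between [c N] and the limit of [c]. *)
Lemma cauchy_defect_cvg (a b : nat -> R) (A B : R) : (forall n, 0 <= a n) ->
  (forall n, 0 <= b n) -> (forall N, \sum_(n < N) a n <= A) ->
  (forall N, \sum_(n < N) b n <= B) ->
  (fun N => (\sum_(n < N) a n) * (\sum_(n < N) b n) -
    \sum_(n < N) \sum_(m < n.+1) a m * b (n - m)%N) @ \oo --> (0 : R).
Proof.
move=> a0 b0 aA bB.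
pose c N := \sum_(n < N) \sum_(m < n.+1) a m * b (n - m)%N.
have c_mono : {homo c : m n / (m <= n)%N >-> m <= n}.
  move=> m n mn; rewrite /c -!(big_mkord xpredT (fun n => \sum_(m < n.+1) a m * b (n - m)%N)).
  rewrite [leRHS](@big_cat_nat _ _ _ m) //= lerDl.
  by apply: sumr_ge0 => i _; apply: sumr_ge0 => j _; apply: mulr_ge0.
have c_cvg : cvgn c.
  apply: (@nondecreasing_bounded_cvgn _ (A * B)) => // N.
  apply: le_trans (cauchy_le N a0 b0) _; apply: ler_pM => //; exact: sumr_ge0.
apply: (@squeeze_cvgr _ _ _ _ (cst 0) (fun N => limn c - c N)).
- near=> N; rewrite subr_ge0 cauchy_le //= lerB //.
  by apply: le_trans (cauchy_ge N a0 b0) _; exact: nondecreasing_cvgn_le.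
- exact: cvg_cst.
- rewrite -(subrr (limn c)); apply: cvgB => //; exact: cvg_cst.
Unshelve. all: by end_near. Qed.

End RealTriangularSums.

(** * Weighted l^1 bounds and evaluation of complex double series *)

Section ComplexSeries.
Variable R : realType.
Local Notation C := R[i].
Implicit Types (u v : nat -> nat -> C) (z w : C) (r B : R).

Definition weight r u : nat -> nat -> R :=
  fun i j => cnorm (u i j) * r ^+ i * r ^+ j.
(** The weighted l^1 norm of [u] at radius [r] is at most [B]. *)
Definition bounded_series r u B := forall N, tri (weight r u) N <= B.

Definition series_term u z w : nat -> nat -> C := fun i j => u i j * z ^+ i * w ^+ j.
(* Locked because unfolding the limits makes unification diverge. *)
Definition evl u z w : C := locked (clim (tri (series_term u z w))).

Definition add_series u v : nat -> nat -> C := fun i j => u i j + v i j.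
Definition scale_series (c : C) u : nat -> nat -> C := fun i j => c * u i j.
(** The series of the conjugate function when the second variable is the conjugate of the first:
    conjugation exchanges the exponents. *)
Definition star u : nat -> nat -> C := fun i j => cconj (u j i).
Definition affine (c a b : C) : nat -> nat -> C := fun i j =>
  match i, j with 0, 0 => c | 1, 0 => a | 0, 1 => b | _, _ => 0%R end%N.

Lemma weight_ge0 r u i j : 0 <= r -> 0 <= weight r u i j.
Proof. by move=> r0; rewrite !mulr_ge0 ?exprn_ge0 ?cnorm_ge0. Qed.

Lemma bounded_series_ge0 r u B : bounded_series r u B -> 0 <= B.
Proof. by move/(_ 0%N); rewrite tri0. Qed.

Lemma bounded_seriesW r u B B' : B <= B' -> bounded_series r u B ->
  bounded_series r u B'.
Proof. by move=> BB' uB N; apply: le_trans (uB N) _. Qed.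

Lemma le_bounded_series r u v B : 0 <= r ->
  (forall i j, cnorm (u i j) <= cnorm (v i j)) ->
  bounded_series r v B -> bounded_series r u B.
Proof.
move=> r0 uv vB N; apply: le_trans (vB N); apply: ler_tri => i j _.
by rewrite /weight !ler_wpM2r ?exprn_ge0.
Qed.

Lemma bounded_series_radius r s u B : 0 <= r -> r <= s ->
  bounded_series s u B -> bounded_series r u B.
Proof.
move=> r0 rs uB N; apply: le_trans (uB N); apply: ler_tri => i j _.
rewrite /weight -!mulrA ler_wpM2l ?cnorm_ge0 //.
by rewrite ler_pM ?exprn_ge0 // lerXn2r ?nnegrE // (le_trans r0).
Qed.

Lemma bounded_add r u v B B' : 0 <= r -> bounded_series r u B ->
  bounded_series r v B' -> bounded_series r (add_series u v) (B + B').
Proof.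
move=> r0 uB vB N; apply: le_trans (lerD (uB N) (vB N)); rewrite -triD.
apply: ler_tri => i j _; rewrite /weight -!mulrDl.
by rewrite !ler_wpM2r ?exprn_ge0 ?cnormD.
Qed.

Lemma bounded_scale r c u B : bounded_series r u B ->
  bounded_series r (scale_series c u) (cnorm c * B).
Proof.
move=> uB N; apply: le_trans (ler_wpM2l (cnorm_ge0 c) (uB N)).
rewrite -triMl; apply: ler_tri => i j _.
by rewrite /weight cnormM -!mulrA.
Qed.

Lemma bounded_star r u B : bounded_series r u B -> bounded_series r (star u) B.
Proof.
move=> uB N; apply: le_trans (uB N); rewrite tri_tr.
by apply: ler_tri => i j _; rewrite /weight /star cnorm_conj mulrAC.
Qed.

Lemma bounded_conv r u v B B' : 0 <= r -> bounded_series r u B ->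
  bounded_series r v B' -> bounded_series r (conv u v) (B * B').
Proof.
move=> r0 uB vB N.
apply: (@le_trans _ _ (tri (weight r u) N * tri (weight r v) N)); last first.
  by apply: ler_pM => //; apply: tri_ge0 => i j; exact: weight_ge0.
apply: le_trans (tri_conv_le _ _ _); try by move=> i j; exact: weight_ge0.
apply: ler_tri => k l _; rewrite conv_weight /weight !ler_wpM2r ?exprn_ge0 //.
apply: le_trans (cnorm_sum _ _ _) _; apply: ler_sum => i _.
apply: le_trans (cnorm_sum _ _ _) _; apply: ler_sum => j _.
by rewrite cnormM.
Qed.

Lemma tri_finite (V : nmodType) (F : nat -> nat -> V) M N :
  (forall i j, (M <= i + j)%N -> F i j = 0) -> (M <= N)%N -> tri F N = tri F M.
Proof.
move=> F0; elim: N => [|N IH]; first by rewrite leqn0 => /eqP ->.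
rewrite leq_eqVlt ltnS => /predU1P[<- //|MN]; rewrite tri_recr IH //.
rewrite /diag big1 ?addr0 // => i _; apply: F0.
by rewrite subnKC // -ltnS.
Qed.

Lemma tri2 (V : nmodType) (F : nat -> nat -> V) :
  tri F 2 = F 0%N 0%N + (F 0%N 1%N + F 1%N 0%N).
Proof.
by rewrite /tri /diag !big_ord_recr !big_ord0 /= !add0r.
Qed.

Lemma affine_finite c a b i j : (2 <= i + j)%N -> affine c a b i j = 0.
Proof. by case: i j => [|[|i]] [|[|j]]. Qed.

Lemma bounded_affine r c a b : 0 <= r ->
  bounded_series r (affine c a b) (cnorm c + (cnorm a + cnorm b) * r).
Proof.
move=> r0 N; have f0 i j : (2 <= i + j)%N -> weight r (affine c a b) i j = 0.
  by move=> ij; rewrite /weight affine_finite // cnorm0 !mul0r.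
apply: (@le_trans _ _ (tri (weight r (affine c a b)) 2)).
  have [N2|N2] := leqP 2 N; first by rewrite (tri_finite f0).
  by apply: ler_tri_nat; [move=> i j; exact: weight_ge0|exact: ltnW].
by rewrite tri2 /weight /= !expr0 !expr1 !mulr1; lra.
Qed.

Lemma bounded_convX0 r : bounded_series r (convX (0 : nat -> nat -> C) 0) 1.
Proof.
move=> N; case: N => [|N]; first by rewrite tri0.
rewrite (@tri_finite _ _ 1) //.
  rewrite tri_recr tri0 /diag big_ord1 /weight /= cnorm1 !expr0; lra.
by move=> [|i] [|j] //; rewrite /weight /= ?andbF cnorm0 !mul0r.
Qed.

Lemma bounded_convX r u B n : 0 <= r -> bounded_series r u B ->
  bounded_series r (convX u n) (B ^+ n).
Proof.
move=> r0 uB; elim: n => [|n IH]; first exact: bounded_convX0.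
by rewrite exprS; exact: bounded_conv.
Qed.

Lemma cnorm_tri_term u z w r N : cnorm z <= r -> cnorm w <= r ->
  \sum_(n < N) cnorm (diag (series_term u z w) n) <= tri (weight r u) N.
Proof.
move=> zr wr; have r0 : 0 <= r by apply: le_trans zr; exact: cnorm_ge0.
apply: ler_sum => n _; apply: le_trans (cnorm_sum _ _ _) _.
apply: ler_sum => i _; rewrite !cnormM !cnormX /weight -!mulrA.
rewrite ler_wpM2l ?cnorm_ge0 //.
by rewrite ler_pM ?exprn_ge0 ?cnorm_ge0 // lerXn2r ?nnegrE ?cnorm_ge0.
Qed.

Section Evaluation.
Variables (r : R) (z w : C).
Hypotheses (zr : cnorm z <= r) (wr : cnorm w <= r).

Let r0 : 0 <= r. Proof. by apply: le_trans zr; exact: cnorm_ge0. Qed.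

Lemma evlP u B : bounded_series r u B ->
  ccvg (tri (series_term u z w)) (evl u z w).
Proof.
move=> uB; rewrite /evl -lock; apply: (@ccvg_series _ _ B) => N.
exact: le_trans (cnorm_tri_term _ _ zr wr) _.
Qed.

Lemma evl_eq u l : ccvg (tri (series_term u z w)) l -> evl u z w = l.
Proof. by rewrite /evl -lock; exact: ccvg_clim. Qed.

Lemma cnorm_evl u B : bounded_series r u B -> cnorm (evl u z w) <= B.
Proof.
move=> uB; apply: (ccvg_le (evlP uB)); near=> N.
apply: le_trans (cnorm_sum _ _ _) _.
exact: le_trans (cnorm_tri_term _ _ zr wr) _.
Unshelve. all: by end_near. Qed.

Lemma evl_add u v B B' : bounded_series r u B -> bounded_series r v B' ->
  evl (add_series u v) z w = evl u z w + evl v z w.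
Proof.
move=> uB vB; apply: evl_eq; apply: eq_ccvg (ccvgD (evlP uB) (evlP vB)) => N.
by rewrite -triD; apply: eq_tri => i j _; rewrite /series_term /add_series !mulrDl.
Qed.

Lemma evl_scale c u B : bounded_series r u B ->
  evl (scale_series c u) z w = c * evl u z w.
Proof.
move=> uB; apply: evl_eq; apply: eq_ccvg (ccvgMl c (evlP uB)) => N.
by rewrite -triMl; apply: eq_tri => i j _; rewrite /series_term /scale_series !mulrA.
Qed.

Lemma evl_conv u v B B' : bounded_series r u B -> bounded_series r v B' ->
  evl (conv u v) z w = evl u z w * evl v z w.
Proof.
move=> uB vB; apply: evl_eq.
have uvcvg := ccvgM (evlP uB) (evlP vB).
pose a n := cnorm (diag (series_term u z w) n).
pose b n := cnorm (diag (series_term v z w) n).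
have aB N : \sum_(n < N) a n <= B.
  exact: le_trans (cnorm_tri_term _ _ zr wr) _.
have bB N : \sum_(n < N) b n <= B'.
  exact: le_trans (cnorm_tri_term _ _ zr wr) _.
have := @cauchy_defect_cvg R a b B B' (fun n => cnorm_ge0 _) (fun n => cnorm_ge0 _) aB bB.
move=> defect; rewrite -[_ * _]addr0.
(* The defect of the truncated product runs over degrees [m, k < N] with [m + k >= N]. Taking norms
   term by term bounds it by the real defect of [a] and [b]. *)
have : ccvg (fun N => tri (series_term (conv u v) z w) N -
    tri (series_term u z w) N * tri (series_term v z w) N) 0.
  apply: (ccvg_dom defect) => N; rewrite subr0 cnorm_distC.
  have -> : tri (series_term (conv u v) z w) N = \sum_(n < N) \sum_(m < n.+1)
      diag (series_term u z w) m * diag (series_term v z w) (n - m).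
    apply: eq_bigr => n _; rewrite -diag_conv; apply: eq_diag => i j.
    by rewrite /series_term conv_weight.
  rewrite !sum_cauchy_rows !mulr_suml -!sumrB.
  apply: le_trans (cnorm_sum _ _ _) _; apply: ler_sum => m _.
  rewrite -!mulrBr cnormM ler_wpM2l ?cnorm_ge0 //.
  rewrite /tri -!(big_mkord xpredT) [X in cnorm (X - _)](@big_cat_nat _ _ _ (N - m)) ?leq_subr //=.
  rewrite [X in _ <= X - _](@big_cat_nat _ _ _ (N - m)) ?leq_subr //=.
  by rewrite ![_ + _ - _]addrAC !subrr !add0r cnorm_sum.
move=> /(ccvgD uvcvg); apply: eq_ccvg => N; ring.
Qed.

Lemma evl_finite u M : (forall i j, (M <= i + j)%N -> u i j = 0) ->
  evl u z w = tri (series_term u z w) M.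
Proof.
move=> u0; apply: evl_eq; apply: (@ccvg_near _ _ _ M) => N MN.
by apply: tri_finite => // i j ij; rewrite /series_term u0 // !mul0r.
Qed.

Lemma evl_affine c a b : evl (affine c a b) z w = c + a * z + b * w.
Proof.
rewrite (@evl_finite _ 2); last exact: affine_finite.
rewrite tri2 /series_term /= !expr0 !expr1; ring.
Qed.

Lemma evl_convX u B n : bounded_series r u B ->
  evl (convX u n) z w = evl u z w ^+ n.
Proof.
move=> uB; elim: n => [|n IH].
  rewrite (@evl_finite _ 1); last by move=> [|i] [|j] //=; rewrite ?andbF.
  rewrite tri_recr tri0 /diag big_ord1 /series_term /= !expr0; ring.
by rewrite exprS -IH; exact: evl_conv uB (bounded_convX n r0 uB).
Qed.

End Evaluation.

Lemma evl_star u r z B : cnorm z <= r -> bounded_series r u B ->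
  evl (star u) z (cconj z) = cconj (evl u z (cconj z)).
Proof.
move=> zr uB; have zr' : cnorm (cconj z) <= r by rewrite cnorm_conj.
apply: evl_eq; apply: eq_ccvg (ccvg_conj (evlP zr zr' uB)) => N.
rewrite tri_tr {1}/tri cconj_sum; apply: eq_bigr => n _.
rewrite /diag cconj_sum; apply: eq_bigr => i _.
rewrite /series_term /star !cconjM !cconjX [cconj (cconj z)](conjcK z); ring.
Qed.

End ComplexSeries.

(** * Composition of power series *)

Section Composition.
Variable R : realType.
Local Notation C := R[i].
Implicit Types (f u v : nat -> nat -> C) (z w : C) (r p B : R).

Definition partial_comp f u v N : nat -> nat -> C := fun k l =>
  tri (fun i j => f i j * conv (convX u i) (convX v j) k l) N.

(* The coefficients are limits, so [u] and [v] may have constant terms. *)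
Definition series_comp f u v : nat -> nat -> C := fun k l =>
  locked (clim (fun N => partial_comp f u v N k l)).

(** Cauchy estimate: a single weighted term is at most the whole sum. *)
Lemma cnorm_coef r u B k l : 0 < r -> bounded_series r u B ->
  cnorm (u k l) <= B / (r ^+ k * r ^+ l).
Proof.
move=> r0 uB; rewrite ler_pdivlMr ?mulr_gt0 ?exprn_gt0 // mulrA.
apply: le_trans (uB (k + l).+1).
apply: (@term_le_tri _ (weight r u) k l) => // i j.
exact: weight_ge0 (ltW r0).
Qed.

Lemma evl_sum r z w (I : Type) (s : seq I) (F : I -> nat -> nat -> C)
    (B : I -> R) : cnorm z <= r -> cnorm w <= r ->
  (forall i, bounded_series r (F i) (B i)) ->
  bounded_series r (fun k l => \sum_(i <- s) F i k l) (\sum_(i <- s) B i) /\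
  evl (fun k l => \sum_(i <- s) F i k l) z w = \sum_(i <- s) evl (F i) z w.
Proof.
move=> zr wr FB; have r0 : 0 <= r by apply: le_trans zr; exact: cnorm_ge0.
elim: s => [|i s [IHB IHe]].
  have -> : (fun k l => \sum_(i <- [::]) F i k l) = fun _ _ => 0.
    by apply/funext => k; apply/funext => l; rewrite big_nil.
  rewrite !big_nil; split.
    move=> N; rewrite /tri big1 // => n _; rewrite /diag big1 // => k _.
    by rewrite /weight cnorm0 !mul0r.
  by rewrite (@evl_finite _ _ _ _ 0) ?tri0.
have -> : (fun k l => \sum_(i <- i :: s) F i k l) =
    add_series (F i) (fun k l => \sum_(i <- s) F i k l).
  by apply/funext => k; apply/funext => l; rewrite big_cons.
rewrite !big_cons; split; first exact: bounded_add.
by rewrite (evl_add zr wr (FB i) IHB) IHe.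
Qed.

Section Bounds.
Variables (f u v : nat -> nat -> C) (r p T : R).
Hypotheses (r_gt0 : 0 < r) (fT : bounded_series p f T).
Hypotheses (up : bounded_series r u p) (vp : bounded_series r v p).

Let r_ge0 : 0 <= r := ltW r_gt0.
Let p_ge0 : 0 <= p := bounded_series_ge0 up.

Lemma bounded_monomial i j :
  bounded_series r (conv (convX u i) (convX v j)) (p ^+ i * p ^+ j).
Proof. by apply: bounded_conv => //; exact: bounded_convX. Qed.

Lemma pcompP k l : ccvg (fun N => partial_comp f u v N k l) (series_comp f u v k l).
Proof.
rewrite /series_comp -lock.
apply: (@ccvg_series _ _ (T / (r ^+ k * r ^+ l))) => N.
apply: (@le_trans _ _ (tri (weight p f) N / (r ^+ k * r ^+ l))); last first.
  by rewrite ler_wpM2r ?invr_ge0 ?mulr_ge0 ?exprn_ge0.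
rewrite mulr_suml; apply: ler_sum => n _; apply: le_trans (cnorm_sum _ _ _) _.
rewrite mulr_suml; apply: ler_sum => i _; rewrite cnormM /weight -!mulrA.
rewrite ler_wpM2l ?cnorm_ge0 // mulrA; apply: cnorm_coef => //.
exact: bounded_monomial.
Qed.

(** The series [u^i v^j] has weighted norm at most [p^(i+j)], so the terms of degrees [M] to [N - 1]
    cost exactly that slice of the weighted sum of [f]. *)
Lemma bounded_pcompB M N : (M <= N)%N ->
  bounded_series r (fun k l => partial_comp f u v N k l - partial_comp f u v M k l)
    (tri (weight p f) N - tri (weight p f) M).
Proof.
elim: N => [|N IH].
  rewrite leqn0 => /eqP -> K; rewrite subrr /tri big1 // => n _.
  by rewrite /diag big1 // => i _; rewrite /weight subrr cnorm0 !mul0r.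
rewrite leq_eqVlt ltnS => /predU1P[->|/IH {}IH].
  move=> K; rewrite subrr /tri big1 // => n _.
  by rewrite /diag big1 // => i _; rewrite /weight subrr cnorm0 !mul0r.
pose D k l := \sum_(i < N.+1) f i (N - i)%N *
  conv (convX u i) (convX v (N - i)) k l.
have -> : (fun k l => partial_comp f u v N.+1 k l - partial_comp f u v M k l) =
    add_series (fun k l => partial_comp f u v N k l - partial_comp f u v M k l) D.
  apply/funext => k; apply/funext => l; rewrite /add_series /partial_comp tri_recr.
  by rewrite addrAC.
rewrite tri_recr addrAC; apply: bounded_add => //.
have z0 : cnorm (0 : C) <= r by rewrite cnorm0.
have [] := @evl_sum r 0 0 _ (index_enum 'I_N.+1) (fun i =>
  scale_series (f i (N - i)%N) (conv (convX u i) (convX v (N - i))))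
  (fun i => weight p f i (N - i)) z0 z0 => // i.
rewrite /weight -mulrA; apply: bounded_scale; exact: bounded_monomial.
Qed.

(** The limit of [bounded_pcompB] as the upper truncation grows. The bound [T'] is kept apart from
    [T] so that the exact weighted sum of [f] can be inserted. *)
Lemma bounded_compB M T' : bounded_series p f T' ->
  bounded_series r (fun k l => series_comp f u v k l - partial_comp f u v M k l)
    (T' - tri (weight p f) M).
Proof.
move=> fT' N.
(* For fixed [N] only finitely many coefficients enter, so their separate convergence makes [g] tend
   to 0. *)
pose g M' := tri (weight r (fun k l => series_comp f u v k l - partial_comp f u v M' k l)) N.
have g0 : g @ \oo --> (0 : R).
  have -> : 0 = tri (fun _ _ => 0 : R) N.
    by rewrite /tri big1 // => n _; rewrite /diag big1.
  apply: cvg_big; first exact: add_continuous.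
  move=> n _; apply: cvg_big; first exact: add_continuous.
  move=> i _; rewrite /weight.
  under eq_fun do rewrite -mulrA cnorm_distC.
  have := cvgM (pcompP i (n - i)%N) (cvg_cst (r ^+ i * r ^+ (n - i)%N)).
  by rewrite mul0r; apply.
rewrite -subr_le0; apply: (cvgr_to_ge g0); near=> M'.
have MM' : (M <= M')%N by near: M'; exists M.
rewrite lerBlDl.
apply: (@le_trans _ _ (tri (weight r (fun k l => partial_comp f u v M' k l -
    partial_comp f u v M k l)) N + g M')).
  rewrite /g -triD; apply: ler_tri => k l _; rewrite /weight -!mulrDl.
  rewrite !ler_wpM2r ?exprn_ge0 //.
  set a := series_comp _ _ _ _ _; set b := partial_comp _ _ _ M _ _; set c := partial_comp _ _ _ _ _ _.
  have -> : a - b = (c - b) + (a - c) by ring.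
  exact: cnormD.
rewrite lerD2r; apply: le_trans (bounded_pcompB MM' N) _.
by rewrite lerD2r; exact: fT'.
Unshelve. all: by end_near. Qed.

Lemma bounded_comp : bounded_series r (series_comp f u v) T.
Proof.
have := bounded_compB 0 fT; rewrite tri0 subr0; congr (bounded_series r _ T).
by apply/funext => k; apply/funext => l; rewrite /partial_comp tri0 subr0.
Qed.

Variables (z w : C).
Hypotheses (zr : cnorm z <= r) (wr : cnorm w <= r).

Lemma evl_pcomp N : exists B, bounded_series r (partial_comp f u v N) B /\
  evl (partial_comp f u v N) z w = tri (series_term f (evl u z w) (evl v z w)) N.
Proof.
have diagE n : let G k l := diag (fun i j =>
    f i j * conv (convX u i) (convX v j) k l) n in
    bounded_series r G (diag (weight p f) n) /\
    evl G z w = diag (series_term f (evl u z w) (evl v z w)) n.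
  have [|bB E] := @evl_sum r z w _ (index_enum 'I_n.+1) (fun i =>
    scale_series (f i (n - i)%N) (conv (convX u i) (convX v (n - i))))
    (fun i => weight p f i (n - i)) zr wr.
    by move=> i; rewrite /weight -mulrA; apply: bounded_scale;
      exact: bounded_monomial.
  split=> //; apply: etrans E _; apply: eq_bigr => i _; have bm := bounded_monomial i (n - i)%N.
  rewrite (evl_scale zr wr _ bm) /series_term -mulrA; congr (_ * _).
  have bu := bounded_convX i r_ge0 up; have bv := bounded_convX (n - i) r_ge0 vp.
  by rewrite (evl_conv zr wr bu bv) (evl_convX zr wr _ up) (evl_convX zr wr _ vp).
have [|bB E] := @evl_sum r z w _ (index_enum 'I_N) (fun n k l => diag (fun i j =>
    f i j * conv (convX u i) (convX v j) k l) n) (fun n => diag (weight p f) n)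
    zr wr.
  by move=> n; have [] := diagE n.
exists (\sum_n diag (weight p f) (n : 'I_N)); split => //.
by apply: etrans E _; apply: eq_bigr => n _; have [_] := diagE n.
Qed.

Lemma evl_comp : evl (series_comp f u v) z w = evl f (evl u z w) (evl v z w).
Proof.
have fc : cvgn (tri (weight p f)).
  apply: (@nondecreasing_bounded_cvgn _ _ T) => // m n mn.
  by apply: ler_tri_nat => // i j; exact: weight_ge0.
(* With the exact sum as bound, the remainder given by [bounded_compB] tends to 0. *)
have fT' : bounded_series p f (limn (tri (weight p f))).
  move=> N; apply: nondecreasing_cvgn_le => // m n mn.
  by apply: ler_tri_nat => // i j; exact: weight_ge0.
symmetry; apply: evl_eq.
apply: (@ccvg_dom _ _ _ (fun N => limn (tri (weight p f)) - tri (weight p f) N)).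
  rewrite -(subrr (limn (tri (weight p f)))).
  by apply: cvgB => //; exact: cvg_cst.
move=> N; have [B [bB E]] := evl_pcomp N.
have bD := bounded_compB N fT'.
have -> : series_comp f u v = add_series (partial_comp f u v N)
    (fun k l => series_comp f u v k l - partial_comp f u v N k l).
  by apply/funext => k; apply/funext => l; rewrite /add_series addrC subrK.
rewrite (evl_add zr wr bB bD) E opprD addrA subrr sub0r cnormN.
exact: (cnorm_evl zr wr bD).
Qed.

End Bounds.

End Composition.

(** * Formal fixed points *)

Section Formal.
Variable R : realType.
Local Notation C := R[i].
Implicit Types (f u v : nat -> nat -> C) (z w : C) (r p B : R).

Definition agree n u v := forall k l, (k + l < n)%N -> u k l = v k l.
Definition order_ge n u := forall k l, (k + l < n)%N -> u k l = 0.

Lemma order_geW m n u : (m <= n)%N -> order_ge n u -> order_ge m u.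
Proof. by move=> mn un k l kl; apply: un; exact: leq_trans mn. Qed.

Lemma order_add n u v : order_ge n u -> order_ge n v ->
  order_ge n (add_series u v).
Proof. by move=> un vn k l kl; rewrite /add_series un // vn // addr0. Qed.

Lemma order_scale n c u : order_ge n u -> order_ge n (scale_series c u).
Proof. by move=> un k l kl; rewrite /scale_series un // mulr0. Qed.

Lemma order_star n u : order_ge n u -> order_ge n (star u).
Proof.
by move=> un k l kl; rewrite /star un 1?addnC // /cconj rmorph0.
Qed.

Lemma agree_add n u u' v v' : agree n u u' -> agree n v v' ->
  agree n (add_series u v) (add_series u' v').
Proof. by move=> uu vv k l kl; rewrite /add_series uu // vv. Qed.

Lemma agree_scale n c u u' : agree n u u' ->
  agree n (scale_series c u) (scale_series c u').
Proof. by move=> uu k l kl; rewrite /scale_series uu. Qed.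

Lemma agree_star n u u' : agree n u u' -> agree n (star u) (star u').
Proof. by move=> uu k l kl; rewrite /star uu // addnC. Qed.

Lemma order_conv a b u v : order_ge a u -> order_ge b v ->
  order_ge (a + b) (conv u v).
Proof.
move=> ua vb k l kl; rewrite /conv big1 // => i _; rewrite big1 // => j _.
have [ij|ij] := ltnP (i + j) a; first by rewrite ua // mul0r.
rewrite vb ?mulr0 //; have := ltn_ord i; have := ltn_ord j; lia.
Qed.

(** The reason is [u v - u' v' = (u - u') v + u' (v - v')]: in each product the order of one factor
    adds to the degree of agreement of the other. *)
Lemma agree_conv (m n a b p : nat) u u' v v' : (p <= n + b)%N -> (p <= m + a)%N ->
  agree n u u' -> order_ge a u -> order_ge a u' ->
  agree m v v' -> order_ge b v -> order_ge b v' ->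
  agree p (conv u v) (conv u' v').
Proof.
move=> pn pm uu ua ua' vv vb vb' k l kl; rewrite /conv.
apply: eq_bigr => i _; apply: eq_bigr => j _.
have := ltn_ord i; have := ltn_ord j => jl ik.
have [ij|ij] := ltnP (i + j) n; last by rewrite vb ?vb' ?mulr0 //; lia.
have [kl'|kl'] := ltnP ((k - i) + (l - j)) m; first by rewrite uu // vv.
rewrite ua ?ua' ?mul0r //; lia.
Qed.

Lemma order_convX n u : order_ge 1 u -> order_ge n (convX u n).
Proof.
by move=> u1; elim: n => // n IH; rewrite -[n.+1]add1n; exact: order_conv.
Qed.

Lemma agree_convX n i u u' : order_ge 1 u -> order_ge 1 u' ->
  agree n.+1 u u' -> agree (n + i) (convX u i) (convX u' i).
Proof.
move=> u1 u1' uu; elim: i => [|i IH]; first by [].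
apply: (@agree_conv (n + i) n.+1 1 i) => //; try exact: order_convX; lia.
Qed.

(** Without constant terms, [u^i v^j] starts in degree [i + j], so the limit defining a coefficient
    is reached at a finite stage. *)
Lemma comp_finite f u v k l N : order_ge 1 u -> order_ge 1 v ->
  (k + l < N)%N -> series_comp f u v k l = partial_comp f u v N k l.
Proof.
move=> u1 v1 klN; rewrite /series_comp -lock.
apply: ccvg_clim; apply: (@ccvg_near _ _ _ N) => M NM.
apply: tri_finite NM => i j Nij.
have := order_conv (@order_convX i _ u1) (@order_convX j _ v1) => ->; first exact: mulr0.
exact: leq_trans Nij.
Qed.

Lemma order_comp n f u v : order_ge n f -> order_ge 1 u -> order_ge 1 v ->
  order_ge n (series_comp f u v).
Proof.
move=> fn u1 v1 k l kl; rewrite (comp_finite _ u1 v1 (ltnSn _)).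
rewrite /partial_comp /tri big1 // => m _; rewrite /diag big1 // => i _.
rewrite fn ?mul0r // subnKC; last by rewrite -ltnS.
have := ltn_ord m; lia.
Qed.

(** Every monomial of [f] has at least two factors, and the extra factor of order 1 gains a degree.
    This gain makes the recursions below contract degree by degree. *)
Lemma agree_comp n f u u' v v' : order_ge 2 f ->
  order_ge 1 u -> order_ge 1 u' -> order_ge 1 v -> order_ge 1 v' ->
  agree n.+1 u u' -> agree n.+1 v v' ->
  agree n.+2 (series_comp f u v) (series_comp f u' v').
Proof.
move=> f2 u1 u1' v1 v1' uu vv k l kl.
rewrite (comp_finite _ u1 v1 (ltnSn _)) (comp_finite _ u1' v1' (ltnSn _)).
apply: eq_tri => i j _; have [ij|ij] := ltnP (i + j) 2.
  by rewrite f2 // !mul0r.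
congr (_ * _).
apply: (@agree_conv (n + j) (n + i) i j n.+2) kl; try lia;
  by [exact: order_convX|exact: agree_convX].
Qed.

(** Schwarz lemma for the weighted norm: terms of degree at least [n] shrink by at least
    [(r / p)^n]. *)
Lemma bounded_order r p u B n : 0 <= r -> r <= p -> 0 < p ->
  order_ge n u -> bounded_series p u B ->
  bounded_series r u (B * (r / p) ^+ n).
Proof.
move=> r0 rp p0 un uB N.
have rp0 : 0 <= r / p by rewrite divr_ge0 // ltW.
apply: le_trans (ler_wpM2r (exprn_ge0 n rp0) (uB N)).
rewrite mulrC -triMl; apply: ler_tri => i j _.
have [ij|ij] := ltnP (i + j) n.
  by rewrite /weight un // cnorm0 !(mul0r, mulr0).
have -> : weight r u i j = (r / p) ^+ (i + j) * weight p u i j.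
  rewrite /weight exprD !expr_div_n; field.
  by rewrite !expf_neq0 // gt_eqF.
rewrite ler_wpM2r ?weight_ge0 ?(ltW p0) //.
by rewrite ler_wiXn2l // ler_pdivrMr // mul1r.
Qed.

(** Iterate [T] from 0. The coefficients of degree at most [n] are final from step [n] on, so each
    truncation of the limit is a truncation of an iterate and inherits the bound [B]. *)
Lemma formal_fixpoint (T : (nat -> nat -> C) -> nat -> nat -> C) r B :
  0 <= r -> 0 <= B ->
  (forall u, order_ge 2 u -> order_ge 2 (T u)) ->
  (forall n u v, order_ge 2 u -> order_ge 2 v -> agree n.+1 u v ->
    agree n.+2 (T u) (T v)) ->
  (forall u, order_ge 2 u -> bounded_series r u B ->
    bounded_series r (T u) B) ->
  exists u, [/\ order_ge 2 u, bounded_series r u B & T u = u].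
Proof.
move=> r0 B0 T2 Tagree TB; pose x n := iter n T (fun _ _ => 0).
have x2 n : order_ge 2 (x n) by elim: n => [|n IH] //; exact: T2.
have xB n : bounded_series r (x n) B.
  elim: n => [|n IH]; last exact: TB.
  move=> N; rewrite /tri big1 // => n _; rewrite /diag big1 // => i _.
  by rewrite /weight cnorm0 !mul0r.
have xS n : agree n.+1 (x n) (x n.+1).
  elim: n => [|n IH]; last exact: Tagree (x2 n) (x2 n.+1) IH.
  by move=> k l kl; rewrite !x2 //; exact: leq_trans kl _.
have xx m n : (m <= n)%N -> agree m.+1 (x m) (x n).
  elim: n => [|n IH]; first by rewrite leqn0 => /eqP ->.
  rewrite leq_eqVlt ltnS => /predU1P[-> //|mn] k l kl.
  by rewrite IH // xS //; lia.
pose u k l := x (k + l)%N k l.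
have xu n : agree n.+1 (x n) u by move=> k l kl; rewrite /u -(@xx (k + l)%N n).
have u2 : order_ge 2 u by move=> k l kl; exact: x2.
exists u; split=> //.
  move=> N; apply: le_trans (xB N N); apply: ler_tri => i j ij.
  by rewrite /weight xu // ltnS ltnW.
apply/funext => k; apply/funext => l.
have <- : T (x (k + l)%N) k l = T u k l.
  by apply: (Tagree (k + l)%N) => //; exact: leqnSn.
by rewrite -[T _]/(x (k + l).+1) -xS.
Qed.

End Formal.

(** * The homological equation *)

Section NearIdentity.
Variable R : realType.
Local Notation C := R[i].
Implicit Types (f u v phi : nat -> nat -> C) (z w zeta : C) (r p B : R).

Definition near_id phi := add_series (affine 0 1 0) phi.
(** Substituting the conjugate series for the second variable makes this composition of planar maps;
    see [evlc_comp]. *)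
Definition compc f u := series_comp f u (star u).
Definition evlc u z := evl u z (cconj z).

Lemma order_affine (a b : C) : order_ge 1 (affine 0 a b).
Proof. by move=> [|i] [|j]. Qed.

Lemma order_near_id phi : order_ge 2 phi -> order_ge 1 (near_id phi).
Proof.
by move=> phi2; apply: order_add; [exact: order_affine|exact: order_geW phi2].
Qed.

Lemma bounded_near_id r phi B : 0 <= r -> bounded_series r phi B ->
  bounded_series r (near_id phi) (r + B).
Proof.
move=> r0 phiB; apply: bounded_add => //.
have := @bounded_affine R r 0 1 0 r0.
by rewrite cnorm0 cnorm1 add0r addr0 mul1r.
Qed.

Lemma evlc_near_id r phi B z : cnorm z <= r -> bounded_series r phi B ->
  evlc (near_id phi) z = z + evlc phi z.
Proof.
move=> zr phiB; have zr' : cnorm (cconj z) <= r by rewrite cnorm_conj.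
have r0 : 0 <= r by apply: le_trans zr; exact: cnorm_ge0.
rewrite /evlc (evl_add zr zr' (@bounded_affine R r 0 1 0 r0) phiB) evl_affine.
by rewrite add0r mul1r mul0r addr0.
Qed.

Lemma evlc_comp f u r p T B z : 0 < r -> cnorm z <= r ->
  bounded_series p f T -> bounded_series r u p ->
  evlc (compc f u) z = evlc f (evlc u z).
Proof.
move=> r0 zr fT up; have zr' : cnorm (cconj z) <= r by rewrite cnorm_conj.
rewrite /evlc /compc (evl_comp r0 fT up (bounded_star up) zr zr').
by rewrite (evl_star zr up).
Qed.

Lemma agree_compc n f phi psi : order_ge 2 f -> order_ge 2 phi ->
  order_ge 2 psi -> agree n.+1 phi psi ->
  agree n.+2 (compc f (near_id phi)) (compc f (near_id psi)).
Proof.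
move=> f2 phi2 psi2 pp.
have pp' : agree n.+1 (near_id phi) (near_id psi) by apply: agree_add.
apply: agree_comp => //; try exact: agree_star;
  by [exact: order_near_id|apply: order_star; exact: order_near_id].
Qed.

Lemma order_compc f phi : order_ge 2 f -> order_ge 2 phi ->
  order_ge 2 (compc f (near_id phi)).
Proof.
move=> f2 phi2; apply: order_comp => //.
  exact: order_near_id.
by apply: order_star; exact: order_near_id.
Qed.

Lemma quadratic_bound f p B : 0 < p -> order_ge 2 f -> bounded_series p f B ->
  exists2 K, 0 < K & forall r, 0 <= r -> r <= p ->
    bounded_series r f (K * r ^+ 2).
Proof.
move=> p0 f2 fB; have B0 := bounded_series_ge0 fB.
(* [B + 1] instead of [B] makes [K] positive, so that radii may be divided by it. *)
exists ((B + 1) / p ^+ 2); first by rewrite divr_gt0 ?exprn_gt0 //; lra.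
move=> r r0 rp; apply: bounded_seriesW (bounded_order r0 rp p0 f2 fB).
have -> : (B + 1) / p ^+ 2 * r ^+ 2 = B * (r / p) ^+ 2 + (r / p) ^+ 2.
  by rewrite expr_div_n; ring.
by rewrite lerDl exprn_ge0 // divr_ge0 // ltW.
Qed.

Lemma bounded_compc f phi r p K : 0 < r -> r + r <= p ->
  (forall r, 0 <= r -> r <= p -> bounded_series r f (K * r ^+ 2)) ->
  bounded_series r phi r ->
  bounded_series r (compc f (near_id phi)) (4 * K * r ^+ 2).
Proof.
move=> r0 rp fK phir.
have -> : 4 * K * r ^+ 2 = K * (r + r) ^+ 2 by ring.
have idb := bounded_near_id (ltW r0) phir.
apply: (bounded_comp r0 (fK _ _ rp) idb (bounded_star idb)).
by rewrite addr_ge0 // ltW.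
Qed.

(** The correction solves [chi = - phi o (id + chi)]. Only a right inverse is produced; applying the
    lemma again, to [chi], later makes it two-sided. *)
Lemma near_id_right_inverse phi p B : 0 < p -> order_ge 2 phi ->
  bounded_series p phi B ->
  exists r chi, [/\ 0 < r, r + r <= p, order_ge 2 chi, bounded_series r chi r &
    forall z, cnorm z <= r -> let zeta := evlc (near_id chi) z in
      cnorm zeta <= r + r /\ evlc (near_id phi) zeta = z].
Proof.
move=> p0 phi2 phiB; have [K K0 phiK] := quadratic_bound p0 phi2 phiB.
(* [2 r <= p] keeps [id + chi] in the domain of [phi], and [4 K r <= 1] turns the bound [4 K r^2] of
   the composite into [r]. *)
pose r := Num.min (p / 2) (1 / (4 * K)).
have r0 : 0 < r by rewrite lt_min !divr_gt0 // mulr_gt0.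
have rp : r + r <= p.
  by have : r <= p / 2; [rewrite ge_min lexx|lra].
have rK : 4 * K * r <= 1.
  rewrite mulrC -ler_pdivlMr ?mulr_gt0 //.
  by rewrite ge_min lexx orbT.
pose T chi := scale_series (-1) (compc phi (near_id chi)).
have [|||chi [chi2 chir Tchi]] := @formal_fixpoint R T r r (ltW r0) (ltW r0).
- by move=> u u2; apply: order_scale; exact: order_compc.
- by move=> n u v u2 v2 uv; apply: agree_scale; exact: agree_compc.
- move=> u u2 ur.
  have := bounded_scale (-1) (bounded_compc r0 rp phiK ur).
  apply: bounded_seriesW; rewrite cnormN cnorm1 mul1r expr2 mulrA.
  by rewrite ler_piMl // ltW.
exists r, chi; split=> // z zr zeta.
have zr' : cnorm (cconj z) <= r by rewrite cnorm_conj.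
have idb := bounded_near_id (ltW r0) chir.
have zetar : cnorm zeta <= r + r by exact: (cnorm_evl zr zr' idb).
split=> //.
have phirr : bounded_series (r + r) phi (K * (r + r) ^+ 2).
  by apply: phiK => //; rewrite addr_ge0 // ltW.
have chiE : evlc chi z = - evlc phi zeta.
  rewrite -{1}Tchi /T /evlc (evl_scale zr zr' _ (bounded_compc r0 rp phiK chir)).
  by rewrite -/(evlc _ z) (evlc_comp 0 r0 zr phirr idb) mulN1r.
rewrite (evlc_near_id zetar phirr) {1}/zeta (evlc_near_id zr chir) chiE; ring.
Qed.

End NearIdentity.

(** * Resonant and nonresonant parts of a series *)

Section NormalForm.
Variable R : realType.
Local Notation C := R[i].
Implicit Types (f u v phi : nat -> nat -> C) (z w zeta : C) (r p B : R).

(** Under [zeta -> exp(it) zeta] the monomial of exponents [k, l] is multiplied by [exp(i(k - l)t)].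
    So this is the derivative along [i zeta] divided by [i]; see [dC_rotation]. *)
Definition rotation_derivative phi : nat -> nat -> C := fun k l =>
  (k%:R - l%:R)%:C%C * phi k l.

(* On the resonant monomials k = l + 1 the divisor vanishes and 0^-1 = 0. *)
Definition homological_inverse (omega : R) v : nat -> nat -> C := fun k l =>
  ('i%C * omega%:C%C)^-1 * ((k%:R - l%:R - 1)^-1)%:C%C * v k l.

(** The resonant monomial of exponents [i + 1, i] is [zeta |zeta|^(2i)]. The imaginary part of its
    coefficient changes the angular speed and is measured in units of [omega]; the real part, in
    [resonant_re], pushes radially. *)
Definition resonant_im (omega : R) v : nat -> nat -> C := fun i j =>
  if i == j then (Im (v i.+1 i) / omega)%:C%C else 0.
Definition resonant_re v : nat -> nat -> C := fun i j =>
  if i == j then (Re (v i.+1 i))%:C%C else 0.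

(** A nonzero integer has absolute value at least 1, and the quotient is [1 + 1 / (k - l - 1)]; at
    resonance both expressions are 0. The second bound is what prevents a loss of derivative. *)
Lemma small_divisor (k l : nat) : `|(k%:R - l%:R - 1)^-1 : R| <= 1 /\
  `|(k%:R - l%:R) * (k%:R - l%:R - 1)^-1 : R| <= 2.
Proof.
have [->|kl] := eqVneq k l.+1.
  by rewrite -natr1 [X in X - 1]addrAC addrK subrr invr0 mulr0 normr0; lra.
have h : 1 <= `|k%:R - l%:R - 1 : R|.
  have [lk|lk] := leqP k l.
    have : (k%:R <= l%:R :> R) by rewrite ler_nat.
    by move=> ?; rewrite ltr0_norm; lra.
  have : (l%:R + 2 <= k%:R :> R).
    by rewrite -natrD ler_nat; lia.
  by move=> ?; rewrite ger0_norm; lra.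
have h0 : 0 < `|k%:R - l%:R - 1 : R| by lra.
split; first by rewrite normfV invf_le1.
rewrite normrM normfV ler_pdivrMr //.
have := ler_normD (k%:R - l%:R - 1 : R) 1; rewrite subrK normr1; lra.
Qed.

Section Bounds.
Variables (omega r B : R) (v : nat -> nat -> C).
Hypotheses (omega0 : 0 < omega) (r0 : 0 < r) (vB : bounded_series r v B).
Hypothesis v2 : order_ge 2 v.

Let phi := homological_inverse omega v.

Lemma cnorm_iomegaV : cnorm ('i%C * omega%:C%C : C)^-1 = omega^-1.
Proof. by rewrite cnormV cnormM cnorm_i cnormC mul1r gtr0_norm. Qed.

Lemma bounded_homological : bounded_series r phi (omega^-1 * B).
Proof.
move: (bounded_scale (omega^-1)%:C%C vB); rewrite cnormC gtr0_norm ?invr_gt0 //.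
apply: le_bounded_series; first exact: ltW.
move=> i j; rewrite /phi /homological_inverse /scale_series !cnormM !cnormC.
rewrite cnorm_iomegaV (@gtr0_norm _ omega^-1) ?invr_gt0 //.
rewrite ler_wpM2r ?cnorm_ge0 //.
by rewrite ler_piMr ?invr_ge0 ?(ltW omega0) //; have [] := small_divisor i j.
Qed.

Lemma bounded_rotation : bounded_series r (rotation_derivative phi)
  (2 * omega^-1 * B).
Proof.
move: (bounded_scale (2 * omega^-1)%:C%C vB).
rewrite cnormC gtr0_norm ?mulr_gt0 ?invr_gt0 //.
apply: le_bounded_series; first exact: ltW.
move=> i j; rewrite /rotation_derivative /phi /homological_inverse.
rewrite /scale_series !cnormM !cnormC cnorm_iomegaV.
rewrite (@gtr0_norm _ (2 * omega^-1)) ?mulr_gt0 ?invr_gt0 //.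
rewrite !mulrA ler_wpM2r ?cnorm_ge0 // mulrAC ler_wpM2r ?invr_ge0 ?(ltW omega0)//.
by rewrite -normrM; have [] := small_divisor i j.
Qed.

(** Dividing by one factor [zeta] shifts the first index and costs [r^-1]. *)
Lemma bounded_resonant (s : nat -> nat -> C) (c : R) : 0 <= c ->
  (forall i j, cnorm (s i j) <= c * cnorm (v i.+1 j)) ->
  bounded_series r s (c * r^-1 * B).
Proof.
move=> c0 sv N.
apply: (@le_trans _ _ (c * r^-1 * tri (weight r v) N.+1)); last first.
  by rewrite ler_wpM2l // mulr_ge0 // invr_ge0 ltW.
(* The nonnegative terms of [v 0 j] are discarded, first diagonal 0 and then the head of each later
   diagonal; what remains is indexed by [v i.+1 j]. *)
rewrite {2}/tri big_ord_recl mulrDr -[leLHS]add0r; apply: lerD.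
  rewrite mulr_ge0 ?diag_ge0 ?mulr_ge0 ?invr_ge0 ?(ltW r0) // => i j.
  exact: weight_ge0 (ltW r0).
rewrite mulr_sumr; apply: ler_sum => n _; rewrite {2}/diag big_ord_recl mulrDr.
rewrite -[leLHS]add0r; apply: lerD.
  by rewrite !mulr_ge0 ?invr_ge0 ?exprn_ge0 ?cnorm_ge0 ?(ltW r0).
rewrite mulr_sumr; apply: ler_sum => i _; rewrite /weight !lift0 subSS.
have -> : c * r^-1 * (cnorm (v i.+1 (n - i)%N) * r ^+ i.+1 * r ^+ (n - i)) =
    c * cnorm (v i.+1 (n - i)%N) * r ^+ i * r ^+ (n - i).
  by rewrite exprS; field; rewrite gt_eqF.
by rewrite !ler_wpM2r ?exprn_ge0 ?(ltW r0).
Qed.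

Lemma bounded_resonant_im : bounded_series r (resonant_im omega v)
  (omega^-1 * r^-1 * B).
Proof.
apply: bounded_resonant; first by rewrite invr_ge0 ltW.
move=> i j; rewrite /resonant_im; case: eqP => [<-|_]; last first.
  by rewrite cnorm0 mulr_ge0 ?cnorm_ge0 ?invr_ge0 ?ltW.
rewrite cnormC normrM mulrC gtr0_norm ?invr_gt0 //.
by rewrite ler_wpM2l ?invr_ge0 ?(ltW omega0) ?Im_le_cnorm.
Qed.

Lemma bounded_resonant_re : bounded_series r (resonant_re v) (1 * r^-1 * B).
Proof.
apply: bounded_resonant => // i j; rewrite /resonant_re mul1r.
case: eqP => [<-|_]; last by rewrite cnorm0 cnorm_ge0.
by rewrite cnormC Re_le_cnorm.
Qed.

Lemma order_homological : order_ge 2 phi.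
Proof. by move=> k l kl; rewrite /phi /homological_inverse v2 // mulr0. Qed.

Lemma order_resonant_im : order_ge 1 (resonant_im omega v).
Proof.
move=> [|i] [|j] // _; rewrite /resonant_im eqxx v2 //=.
by rewrite mul0r.
Qed.

Lemma conv_zeta (s : nat -> nat -> C) k l :
  conv (affine 0 1 0) s k l = if k is k'.+1 then s k' l else 0.
Proof.
rewrite /conv.
have row0 : \sum_(j < l.+1) affine 0 1 0 0%N j * s (k - 0)%N (l - j)%N = 0.
  by apply: big1 => -[[|[|j]] jl] _; rewrite mul0r.
case: k row0 => [|k] row0; first by rewrite big_ord1.
rewrite big_ord_recl row0 add0r (bigD1 ord0) //= [X in _ + X]big1 ?addr0.
  rewrite (bigD1 ord0) //= big1 ?addr0 ?mul1r ?subn0 ?subSS ?subn0 //.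
  by move=> [[|j] jl] //= _; rewrite mul0r.
move=> [[|i] ik] // _; apply: big1 => j _ /=.
by case: (nat_of_ord j) => [|j'] ; rewrite /bump /= mul0r.
Qed.

(** The operator [i omega (k - l - 1)] reaches every nonresonant coefficient; the resonant ones form
    [zeta (i omega a + b)] with real diagonal [a] and [b]. *)
Lemma homological_decomposition :
  v = add_series
    (scale_series ('i%C * omega%:C%C)
      (add_series (rotation_derivative phi) (scale_series (-1) phi)))
    (conv (affine 0 1 0) (add_series
      (scale_series ('i%C * omega%:C%C) (resonant_im omega v))
      (resonant_re v))).
Proof.
have w0 : ('i%C * omega%:C%C : C) != 0.
  apply/eqP => /(congr1 (@cnorm R)) /eqP.
  by rewrite cnormM cnorm_i cnormC cnorm0 mul1r normr_eq0 gt_eqF.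
apply/funext => k; apply/funext => l; rewrite /add_series conv_zeta.
rewrite /scale_series /rotation_derivative /phi /homological_inverse.
(* At resonance the homological term is 0 and the coefficient is reassembled from its real and
   imaginary parts. *)
have [->|kl] := eqVneq k l.+1.
  rewrite -natr1 [X in X - 1]addrAC addrK subrr invr0 !mulr0 !mul0r.
  rewrite !mulr0 add0r mulr0 add0r /resonant_im /resonant_re eqxx.
  rewrite -mulrA -rmorphM mulrCA divff ?gt_eqF // mulr1 addrC.
  by rewrite -complexE.
have -> : (if k is k'.+1 then 'i%C * omega%:C%C * resonant_im omega v k' l +
    resonant_re v k' l else 0) = 0.
  case: k kl => // k kl; rewrite /resonant_im /resonant_re.
  have /negPf -> : k != l by apply: contra kl => /eqP ->.
  by rewrite mulr0 addr0.
rewrite addr0.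
have c0 : (k%:R - l%:R - 1 : R) != 0.
  by rewrite subr_eq0 subr_eq -(natrD _ 1) eqr_nat add1n.
transitivity ((k%:R - l%:R - 1)%:C%C * ((k%:R - l%:R - 1)^-1)%:C%C * v k l : C).
  by rewrite -rmorphM divff // rmorph1 mul1r.
rewrite (rmorphB _ (k%:R - l%:R)) rmorph1; field.
have cC0 : (k%:R - l%:R - 1 : C) != 0.
  by rewrite subr_eq0 subr_eq -(natrD _ 1) eqr_nat add1n.
by move: w0; rewrite mulf_eq0 negb_or cC0 => /andP[-> ->].
Qed.

End Bounds.

End NormalForm.

(** * Solving the normal form equation *)

Section NormalFormTheorem.
Variable R : realType.
Local Notation C := R[i].
Implicit Types (f u v phi : nat -> nat -> C) (z w zeta : C) (r p B omega : R).

(** The coefficients of a real power series in [|zeta|^2]. *)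
Definition real_diagonal (s : nat -> nat -> C) :=
  forall i j, s i j = if i == j then (Re (s i i))%:C%C else 0.

Lemma agree_homological omega n u v : agree n u v ->
  agree n (homological_inverse omega u) (homological_inverse omega v).
Proof. by move=> uv k l kl; rewrite /homological_inverse uv. Qed.

Lemma agree_rotation n u v : agree n u v ->
  agree n (rotation_derivative u) (rotation_derivative v).
Proof. by move=> uv k l kl; rewrite /rotation_derivative uv. Qed.

Lemma order_rotation n u : order_ge n u -> order_ge n (rotation_derivative u).
Proof. by move=> un k l kl; rewrite /rotation_derivative un ?mulr0. Qed.

Lemma agree_resonant_im omega n u v : agree n.+1 u v ->
  agree n (resonant_im omega u) (resonant_im omega v).
Proof.
move=> uv k l kl; rewrite /resonant_im; case: eqP => // kl_eq.
by rewrite uv //; lia.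
Qed.

Lemma real_diagonal_im omega v : real_diagonal (resonant_im omega v).
Proof. by move=> i j; rewrite /resonant_im eqxx. Qed.

Lemma real_diagonal_re v : real_diagonal (resonant_re v).
Proof. by move=> i j; rewrite /resonant_re eqxx. Qed.

(* The resonant terms of X o Phi = DPhi.(i omega (1 + a) zeta) + b zeta are
   split into [a] and [b]. The part [b] is not fed back into the right-hand
   side of the recursion, so the majorant estimate needs no assumption on the
   Lyapunov constants. *)
Lemma normal_form omega f p B : 0 < omega -> 0 < p -> order_ge 2 f ->
  bounded_series p f B ->
  exists r phi a b, [/\ 0 < r, r + r <= p & [/\ order_ge 2 phi,
    bounded_series r phi r, exists M, bounded_series r (rotation_derivative phi) M,
    real_diagonal a /\ order_ge 1 a & real_diagonal b] /\
    [/\ exists M, bounded_series r a M, exists M, bounded_series r b M &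
    forall zeta, cnorm zeta <= r -> let Z := evlc (near_id phi) zeta in
      cnorm Z <= r + r /\
      'i%C * omega%:C%C * Z + evlc f Z =
      'i%C * omega%:C%C * (1 + evlc a zeta) *
        (zeta + evlc (rotation_derivative phi) zeta) + evlc b zeta * zeta]].
Proof.
move=> w0 p0 f2 fB; have [K K0 fK] := quadratic_bound p0 f2 fB.
(* The composite contributes [4 K r^2]. The product term contributes [(2 M r / omega) M r^2], which
   [10 M r <= omega] reduces to [K r^2]; together they make [M r^2]. The same condition bounds [phi]
   by [r]. *)
pose M := 5 * K; have M0 : 0 < M by rewrite mulr_gt0.
pose r := Num.min (p / 2) (omega / (10 * M)).
have r0 : 0 < r by rewrite lt_min !divr_gt0 // mulr_gt0.
have rp : r + r <= p.
  by have : r <= p / 2; [rewrite ge_min lexx|lra].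
have rM : 10 * (M * r) <= omega.
  have -> : 10 * (M * r) = r * (10 * M) by ring.
  by rewrite -ler_pdivlMr ?mulr_gt0 // ge_min lexx orbT.
pose Phi v := homological_inverse omega v.
(* The unknown is the right-hand side [v = f o (id + phi) - i omega a phi'] of the homological
   equation, with [phi'] the rotation derivative; [phi] and [a] are read off [v]. *)
pose T v := add_series (compc f (near_id (Phi v)))
  (scale_series (- ('i%C * omega%:C%C)) (conv (resonant_im omega v)
    (rotation_derivative (Phi v)))).
have Phir v : bounded_series r v (M * r ^+ 2) -> bounded_series r (Phi v) r.
  move=> vM; apply: bounded_seriesW (bounded_homological w0 r0 vM).
  have Mr0 : 0 < M * r by rewrite mulr_gt0.
  rewrite mulrC ler_pdivrMr //.
  have -> : M * r ^+ 2 = r * (M * r) by ring.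
  rewrite ler_pM2l //; lra.
have cw : cnorm ('i%C * omega%:C%C : C) = omega.
  by rewrite cnormM cnorm_i cnormC mul1r gtr0_norm.
have [||||v [v2 vM Tv]] := @formal_fixpoint R T r (M * r ^+ 2) (ltW r0).
- by rewrite mulr_ge0 ?exprn_ge0 // ltW.
- move=> u u2; apply: order_add.
    by apply: order_compc => //; exact: order_homological.
  apply: order_scale; apply: (@order_geW _ 2 (1 + 2)) => //; apply: order_conv.
    exact: order_resonant_im.
  by apply: order_rotation; exact: order_homological.
- move=> n u v u2 v2 uv; apply: agree_add.
    by apply: agree_compc => //; [exact: order_homological..|exact: agree_homological].
  (* Reading [a] off [v] loses a degree of agreement, because the factor [zeta] is divided out; the
     order 2 of the rotation derivative makes up for it. *)
  apply: agree_scale; apply: (@agree_conv _ n.+1 n 1 2) => //; try lia.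
  + exact: agree_resonant_im.
  + exact: order_resonant_im.
  + exact: order_resonant_im.
  + by apply: agree_rotation; exact: agree_homological.
  + by apply: order_rotation; exact: order_homological.
  + by apply: order_rotation; exact: order_homological.
- move=> u u2 uM.
  have b1 := bounded_compc r0 rp fK (Phir u uM).
  have b2 := bounded_conv (ltW r0) (bounded_resonant_im w0 r0 uM)
    (bounded_rotation w0 r0 uM).
  apply: bounded_seriesW
    (bounded_add (ltW r0) b1 (bounded_scale (- ('i%C * omega%:C%C)) b2)).
  rewrite cnormN cw.
  have -> : omega * (omega^-1 * r^-1 * (M * r ^+ 2) *
      (2 * omega^-1 * (M * r ^+ 2))) = (2 * (M * r) / omega) * (M * r ^+ 2).
    by field; rewrite !gt_eqF.
  have h : 2 * (M * r) / omega <= 1 / 5 by rewrite ler_pdivrMr //; lra.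
  have h2 : 0 <= M * r ^+ 2 by rewrite mulr_ge0 ?exprn_ge0 // ltW.
  have := ler_wpM2r h2 h; rewrite /M; lra.
have Phi2 : order_ge 2 (Phi v) by exact: order_homological.
have Pr := Phir v vM.
have bR := bounded_rotation w0 r0 vM.
have bI := bounded_resonant_im w0 r0 vM.
have bRe := bounded_resonant_re r0 vM.
exists r, (Phi v), (resonant_im omega v), (resonant_re v); split=> //; split.
  split=> //; first by eexists; exact: bR.
    by split; [exact: real_diagonal_im|exact: order_resonant_im].
  exact: real_diagonal_re.
split; [by eexists; exact: bI|by eexists; exact: bRe|move=> zeta zr Z].
have zr' : cnorm (cconj zeta) <= r by rewrite cnorm_conj.
have idb := bounded_near_id (ltW r0) Pr.
have Zr : cnorm Z <= r + r by exact: (cnorm_evl zr zr' idb).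
split=> //.
have frr : bounded_series (r + r) f (K * (r + r) ^+ 2).
  by apply: fK => //; rewrite addr_ge0 // ltW.
(* [E1] is the fixed point equation and [E2] the homological decomposition. When [v] is eliminated,
   the terms [i omega phi] cancel and the rest factors through [1 + a]. *)
have E1 : evlc v zeta = evlc f Z - 'i%C * omega%:C%C *
    (evlc (resonant_im omega v) zeta * evlc (rotation_derivative (Phi v)) zeta).
  rewrite -{1}Tv /T /evlc.
  have bc := bounded_conv (ltW r0) bI bR.
  rewrite (evl_add zr zr' (bounded_compc r0 rp fK Pr) (bounded_scale _ bc)).
  rewrite (evl_scale zr zr' _ bc) (evl_conv zr zr' bI bR) mulNr.
  by rewrite -[evl (compc _ _) _ _]/(evlc _ _) (evlc_comp 0 r0 zr frr idb).
have E2 : evlc v zeta = 'i%C * omega%:C%C *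
    (evlc (rotation_derivative (Phi v)) zeta - evlc (Phi v) zeta) +
    zeta * ('i%C * omega%:C%C * evlc (resonant_im omega v) zeta +
      evlc (resonant_re v) zeta).
  have bA := @bounded_affine R r 0 1 0 (ltW r0).
  have bS := bounded_scale ('i%C * omega%:C%C) bI.
  have bP := bounded_scale (-1) Pr.
  rewrite {1}(@homological_decomposition R omega v w0) /evlc.
  rewrite (evl_add zr zr' (bounded_scale _ (bounded_add (ltW r0) bR bP))
    (bounded_conv (ltW r0) bA (bounded_add (ltW r0) bS bRe))).
  rewrite (evl_scale zr zr' _ (bounded_add (ltW r0) bR bP)).
  rewrite (evl_add zr zr' bR bP) (evl_scale zr zr' _ Pr).
  rewrite (evl_conv zr zr' bA (bounded_add (ltW r0) bS bRe)).
  rewrite (evl_add zr zr' bS bRe) (evl_scale zr zr' _ bI) evl_affine.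
  by ring.
have ZE : Z = zeta + evlc (Phi v) zeta by exact: evlc_near_id zr Pr.
have -> : evlc f Z = evlc v zeta + 'i%C * omega%:C%C *
    (evlc (resonant_im omega v) zeta * evlc (rotation_derivative (Phi v)) zeta).
  by rewrite E1 subrK.
by rewrite E2 {1}ZE; ring.
Qed.

Lemma evlc_real_diagonal (s : nat -> nat -> C) r B zeta : cnorm zeta <= r ->
  bounded_series r s B -> real_diagonal s ->
  evlc s zeta = (Re (evlc s zeta))%:C%C.
Proof.
move=> zr sB sr; have : evlc (star s) zeta = cconj (evlc s zeta).
  exact: evl_star zr sB.
have -> : star s = s.
  apply/funext => i; apply/funext => j; rewrite /star sr [RHS]sr eq_sym.
  by case: eqP => [->|_]; rewrite /cconj /= ?oppr0.
by case: (evlc s zeta) => x y [] /eqP; rewrite -addr_eq0 -mulr2n mulrn_eq0 /= => /eqP ->.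
Qed.

End NormalFormTheorem.

(** * Analytic functions on the plane *)

Section PlaneCoordinates.
Variable R : realType.
Local Notation C := R[i].
Implicit Types (x h : 'rV[R]_2) (z : C).

Lemma coord_le_norm x i : `|x 0 i| <= `|x|.
Proof.
rewrite [leRHS]/Num.Def.normr /= mx_normrE.
exact: (le_bigmax _ (fun i : 'I_1 * 'I_2 => `|x i.1 i.2|) (0, i)).
Qed.

Lemma norm_le_coord x (B : R) : `|x 0 0| <= B -> `|x 0 1| <= B -> `|x| <= B.
Proof.
move=> x0 x1; have B0 : 0 <= B by apply: le_trans x0.
rewrite /Num.Def.normr /= mx_normrE bigmax_le // => -[i j] _ /=.
by rewrite (ord1 i); case: j => [[|[|j]] jl] //=;
  [move: x0|move: x1]; congr (`|x _ _| <= _); apply: val_inj.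
Qed.

Lemma eq_rV2 x h : x 0 0 = h 0 0 -> x 0 1 = h 0 1 -> x = h.
Proof.
move=> x0 x1; apply/rowP => -[[|[|j]] jl] //=.
  by rewrite (_ : Ordinal jl = 0) //; apply: val_inj.
by rewrite (_ : Ordinal jl = 1) //; apply: val_inj.
Qed.

Definition toC x : C := Complex (x 0 0) (x 0 1).
Definition ofC z : 'rV[R]_2 := \row_(i < 2) if i == 0 then Re z else Im z.

Lemma ofC0 z : ofC z 0 0 = Re z. Proof. by rewrite mxE. Qed.
Lemma ofC1 z : ofC z 0 1 = Im z. Proof. by rewrite mxE. Qed.

Lemma toCK : cancel toC ofC.
Proof. by move=> x; apply: eq_rV2; rewrite ?ofC0 ?ofC1. Qed.

Lemma ofCK : cancel ofC toC.
Proof. by move=> [a b]; rewrite /toC ofC0 ofC1. Qed.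

Lemma toC_affine x : (x 0 0)%:C%C + 'i%C * (x 0 1)%:C%C = toC x :> C.
Proof. by rewrite [RHS]complexE. Qed.

Lemma conj_toC x : (x 0 0)%:C%C - 'i%C * (x 0 1)%:C%C = cconj (toC x) :> C.
Proof. by apply/eqP; rewrite eq_complex /=; apply/andP; split; apply/eqP; ring. Qed.

End PlaneCoordinates.

Section PowerSeries.
Variable R : realType.
Local Notation C := R[i].
Implicit Types (u P Q : nat -> nat -> C) (z w : C) (r p s B : R).
Implicit Types (F : 'rV[R]_2 -> R) (x h : 'rV[R]_2).

Lemma series_diag (c : nat -> nat -> R) h N :
  series (fun n => \sum_(i < n.+1) monomial2 c i (n - i) h) N =
  tri (fun i j => monomial2 c i j h) N.
Proof. by rewrite /series /= big_mkord. Qed.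

(** Absolute convergence at the point with both coordinates [r / 2] is a weighted bound; halving the
    radius puts that point inside the open polydisc. *)
Lemma bounded_of_power_series F (p0 : 'rV[R]_2) (c : nat -> nat -> R) r : 0 < r ->
  has_power_series F p0 c r ->
  let u : nat -> nat -> C := fun i j => (c i j)%:C%C in
  (exists B, bounded_series (r / 2) u B) /\
  forall h, `|h| <= r / 2 ->
    evl u (h 0 0)%:C%C (h 0 1)%:C%C = (F (p0 + h))%:C%C.
Proof.
move=> r0 Fc u; have r20 : 0 < r / 2 by rewrite divr_gt0.
have r2r : r / 2 < r by lra.
have [B uB] : exists B, bounded_series (r / 2) u B.
  pose h : 'rV[R]_2 := const_mx (r / 2).
  have hr : `|h| < r.
    by apply: le_lt_trans r2r; apply: norm_le_coord; rewrite mxE gtr0_norm.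
  have [cv _] := Fc h hr.
  exists (limn (series (fun n => \sum_(i < n.+1) `|monomial2 c i (n - i) h|))).
  move=> N; apply: le_trans (nondecreasing_cvgn_le _ cv N); last first.
    by apply: nondecreasing_series => n _ _; exact: sumr_ge0.
  rewrite /series /= big_mkord; apply: ler_sum => n _; apply: ler_sum => i _.
  rewrite /weight /monomial2 cnormC !normrM !normrX !mxE.
  by rewrite (gtr0_norm r20).
split; first by exists B.
move=> h hr; have [_ cv] := Fc h (le_lt_trans hr r2r).
have h0 : cnorm (h 0 0)%:C%C <= r / 2.
  by rewrite cnormC (le_trans (coord_le_norm _ _)).
have h1 : cnorm (h 0 1)%:C%C <= r / 2.
  by rewrite cnormC (le_trans (coord_le_norm _ _)).
apply: evl_eq; apply/ccvgP => /=.
have E N : tri (series_term u (h 0 0)%:C%C (h 0 1)%:C%C) N =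
    (tri (fun i j => monomial2 c i j h) N)%:C%C.
  rewrite /tri /diag rmorph_sum; apply: eq_bigr => n _.
  rewrite rmorph_sum; apply: eq_bigr => i _.
  by rewrite /series_term /monomial2 !rmorphM !rmorphXn.
split.
  rewrite [X in X @ _](_ : _ =
    series (fun n => \sum_(i < n.+1) monomial2 c i (n - i) h)) //.
  by apply/funext => N; rewrite E series_diag.
by under eq_fun do rewrite E /=; exact: cvg_cst.
Qed.

Lemma power_series_of_bounded F (p0 : 'rV[R]_2) Q s B : 0 < s -> bounded_series s Q B ->
  (forall h, `|h| < s -> F (p0 + h) = Re (evl Q (h 0 0)%:C%C (h 0 1)%:C%C)) ->
  has_power_series F p0 (fun i j => Re (Q i j)) s.
Proof.
move=> s0 QB FQ h hs.
have h0 : cnorm (h 0 0)%:C%C <= s.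
  by rewrite cnormC (le_trans (coord_le_norm _ _)) // ltW.
have h1 : cnorm (h 0 1)%:C%C <= s.
  by rewrite cnormC (le_trans (coord_le_norm _ _)) // ltW.
split.
  apply: (@nondecreasing_bounded_cvgn _ _ B).
    by apply: nondecreasing_series => n _ _; exact: sumr_ge0.
  move=> N; apply: le_trans (QB N); rewrite /series /= big_mkord.
  apply: ler_sum => n _; apply: ler_sum => i _.
  rewrite /monomial2 !normrM !normrX /weight -!mulrA; rewrite !cnormC in h0 h1.
  by apply: ler_pM; rewrite ?mulr_ge0 ?exprn_ge0 ?Re_le_cnorm //;
    apply: ler_pM; rewrite ?exprn_ge0 // lerXn2r // nnegrE // ltW.
rewrite FQ //; have /ccvgP [cv _] := evlP h0 h1 QB.
rewrite [X in X @ _](_ : _ = (fun N => Re (tri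
  (series_term Q (h 0 0)%:C%C (h 0 1)%:C%C) N))) //; apply/funext => N.
rewrite series_diag /tri /diag Re_sum; apply: eq_bigr => n _.
rewrite Re_sum; apply: eq_bigr => i _; rewrite /series_term /monomial2 -!rmorphXn.
case: (Q i (n - i)%N) => a b /=; ring.
Qed.

(** Re-expansion at [x]: affine functions of the real increment, with constant terms [l x] and
    [m x], are substituted in [P]. This passes to real coordinates and moves the centre at once. *)
Lemma analytic_at_affine P p B (a a' b b' : C) (F : 'rV[R]_2 -> R) x s :
  0 < s -> bounded_series p P B ->
  let l h := a * (h 0 0)%:C%C + a' * (h 0 1)%:C%C in
  let m h := b * (h 0 0)%:C%C + b' * (h 0 1)%:C%C in
  cnorm (l x) + (cnorm a + cnorm a') * s <= p ->
  cnorm (m x) + (cnorm b + cnorm b') * s <= p ->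
  (forall h, `|h| < s -> F (x + h) = Re (evl P (l (x + h)) (m (x + h)))) ->
  has_power_series F x
    (fun i j => Re (series_comp P (affine (l x) a a') (affine (m x) b b') i j)) s.
Proof.
move=> s0 PB l m lp mp FE.
have bl := bounded_seriesW lp (bounded_affine (l x) a a' (ltW s0)).
have bm := bounded_seriesW mp (bounded_affine (m x) b b' (ltW s0)).
apply: (power_series_of_bounded s0 (bounded_comp s0 PB bl bm)) => h hs.
have h0 : cnorm (h 0 0)%:C%C <= s.
  by rewrite cnormC (le_trans (coord_le_norm _ _)) // ltW.
have h1 : cnorm (h 0 1)%:C%C <= s.
  by rewrite cnormC (le_trans (coord_le_norm _ _)) // ltW.
have lE : l (x + h) = l x + a * (h 0 0)%:C%C + a' * (h 0 1)%:C%C.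
  by rewrite /l !mxE !rmorphD; ring.
have mE : m (x + h) = m x + b * (h 0 0)%:C%C + b' * (h 0 1)%:C%C.
  by rewrite /m !mxE !rmorphD; ring.
have E := evl_comp s0 PB bl bm h0 h1.
rewrite (evl_affine _ _ (l x)) (evl_affine _ _ (m x)) -lE -mE in E.
by rewrite E; exact: FE.
Qed.

Definition linear2 (a b : R) (h : 'rV[R]_2) : R := a * h 0 0 + b * h 0 1.

Lemma linear2_is_linear a b : linear (linear2 a b).
Proof.
move=> k x y; rewrite /linear2 !mxE /GRing.scale /=; ring.
Qed.

HB.instance Definition _ a b :=
  GRing.isLinear.Build R 'rV[R]_2 R _ (linear2 a b) (@linear2_is_linear a b).

Lemma linear2_continuous a b : continuous (linear2 a b).
Proof.
move=> x.
have c j : (fun h : 'rV[R]_2 => h 0 j) @ x --> x 0 j by exact: coord_continuous.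
exact: (cvgD (cvgM (cvg_cst a) (c 0)) (cvgM (cvg_cst b) (c 1))).
Qed.

Lemma is_diff_power_series F x (c : nat -> nat -> R) r : 0 < r ->
  has_power_series F x c r -> is_diff x F (linear2 (c 1 0)%N (c 0 1)%N).
Proof.
move=> r0 Fc; have [[B uB] uF] := bounded_of_power_series r0 Fc.
set u := (fun i j => _) in uB uF; set s := r / 2 in uB uF.
have s0 : 0 < s by rewrite divr_gt0.
(* The part of degree at least 2, whose value at [h] is at most [B / s^2 * |h|^2] by
   [bounded_order]. *)
pose v i j : C := if (i + j < 2)%N then 0 else u i j.
have v2 : order_ge 2 v by move=> i j ij; rewrite /v ij.
have vB : bounded_series s v B.
  apply: le_bounded_series uB; first exact: ltW.
  by move=> i j; rewrite /v; case: ifP; rewrite ?cnorm0 ?cnorm_ge0.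
pose A := affine (u 0 0)%N (u 1 0)%N (u 0 1)%N.
have uE : u = add_series A v.
  apply/funext => i; apply/funext => j; rewrite /add_series /v /A /affine.
  by case: i j => [|[|i]] [|[|j]] //=; rewrite ?addr0 ?add0r.
have est h : `|h| <= s ->
    `|F (x + h) - F x - linear2 (c 1 0)%N (c 0 1)%N h| <= B / s ^+ 2 * `|h| ^+ 2.
  move=> hs.
  have E : (F (x + h) - F x - linear2 (c 1 0)%N (c 0 1)%N h)%:C%C =
      evl v (h 0 0)%:C%C (h 0 1)%:C%C :> C.
    have k0 : cnorm (h 0 0)%:C%C <= s by rewrite cnormC (le_trans (coord_le_norm _ _)).
    have k1 : cnorm (h 0 1)%:C%C <= s by rewrite cnormC (le_trans (coord_le_norm _ _)).
    rewrite 2!rmorphB /= -uF // -[in F x](addr0 x) -uF ?normr0 ?ltW //.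
    have bA := bounded_affine (u 0 0)%N (u 1 0)%N (u 0 1)%N (ltW s0).
    have c0 : cnorm ((0 : 'rV[R]_2) 0 0)%:C%C <= s by rewrite mxE cnormC normr0 ltW.
    have c1 : cnorm ((0 : 'rV[R]_2) 0 1)%:C%C <= s by rewrite mxE cnormC normr0 ltW.
    rewrite uE (evl_add k0 k1 bA vB) (evl_add c0 c1 bA vB).
    rewrite !evl_affine !mxE.
    have -> : evl v 0%:C%C 0%:C%C = 0.
      have z0 : cnorm (0%:C%C : C) <= 0 by rewrite cnormC normr0.
      have := cnorm_evl z0 z0 (bounded_order (lexx 0) (ltW s0) s0 v2 vB).
      rewrite mul0r expr0n mulr0 => le0; apply: cnorm_eq0; apply/eqP.
      by rewrite eq_le le0 cnorm_ge0.
    rewrite /linear2 /u rmorphD !rmorphM rmorph0 /=; ring.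
  rewrite -(@cnormC R) E.
  have k0 : cnorm (h 0 0)%:C%C <= `|h| by rewrite cnormC coord_le_norm.
  have k1 : cnorm (h 0 1)%:C%C <= `|h| by rewrite cnormC coord_le_norm.
  have := cnorm_evl k0 k1 (bounded_order (normr_ge0 h) hs s0 v2 vB).
  by rewrite expr_div_n [_ / _]mulrC mulrA.
have B0 := bounded_series_ge0 vB.
have expansion : F \o shift x = cst (F x) + linear2 (c 1 0)%N (c 0 1)%N
    +o_ (0 : 'rV[R]_2) (id : 'rV[R]_2 -> 'rV[R]_2).
  apply/eqaddoP => e e0.
  have K0 : 0 < B / s ^+ 2 + 1 by rewrite ltr_wpDl // divr_ge0 // exprn_ge0 // ltW.
  near=> h.
  rewrite /= !fctE /= [h + x]addrC opprD addrA.
  have hs : `|h| <= s.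
    near: h; apply/nbhs_ballP; exists s => //= h; rewrite -ball_normE /= sub0r normrN.
    exact: ltW.
  apply: le_trans (est h hs) _; rewrite [`|h| ^+ 2]expr2 mulrA ler_wpM2r //.
  have : `|h| <= e / (B / s ^+ 2 + 1).
    near: h; apply/nbhs_ballP; exists (e / (B / s ^+ 2 + 1)) => /=.
      exact: divr_gt0.
    by move=> h; rewrite -ball_normE /= sub0r normrN => /ltW.
  rewrite ler_pdivlMr // => /(le_trans _); apply.
  by rewrite mulrC ler_wpM2l // lerDl.
have cont := @linear2_continuous (c 1 0)%N (c 0 1)%N.
have dE := diff_unique cont expansion.
have dF : differentiable F x.
  by apply/diff_locallyP; rewrite dE; split.
exact: DiffDef dF dE.
Unshelve. all: by end_near. Qed.

End PowerSeries.

(** * Derivatives along curves *)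

Section ChainRule.
Variables (R : realType) (V W : normedModType R).

Lemma is_derive_curve (G : V -> W) (Y : R -> V) (t : R) (y' : V) :
  differentiable G (Y t) -> is_derive t 1 Y y' ->
  is_derive t 1 (G \o Y) ('d G (Y t) y').
Proof.
move=> dG dY; have dY1 : differentiable Y t by apply/derivable1_diffP.
have dc := differentiable_comp dY1 dG.
apply: DeriveDef; first exact/derivable1_diffP.
rewrite deriveE // diff_comp //=; congr ('d G (Y t) _).
by rewrite -deriveE //; exact: derive_val.
Qed.

End ChainRule.

Lemma is_derive_rV2 (R : realType) (Y : R -> 'rV[R]_2) (t : R) (y' : 'rV[R]_2) :
  (forall j, is_derive t 1 (fun s => Y s 0 j) (y' 0 j)) <-> is_derive t 1 Y y'.
Proof.
split=> [dY|dY j].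
  have dYt : derivable Y t 1.
    by apply/derivable_mxP => i j; rewrite (ord1 i).
  apply: DeriveDef => //; rewrite derive_mx //; apply/rowP => j; rewrite mxE.
  by have := dY j; move=> h; rewrite derive_val.
have dYt : derivable Y t 1 by [].
apply: DeriveDef; first by move/derivable_mxP: dYt; apply.
have := @derive_val _ _ _ _ _ _ _ dY; rewrite derive_mx // => <-.
by rewrite mxE.
Qed.

(** * Differentiating a series in [z] and its conjugate along curves *)

Section ComplexCurves.
Variable R : realType.
Local Notation C := R[i].
Implicit Types (u P phi : nat -> nat -> C) (z w h zeta : C) (r p s t B : R).
Implicit Types (y : R -> C).

Definition cderive y t (y' : C) :=
  is_derive t 1 (fun s => Re (y s)) (Re y') /\
  is_derive t 1 (fun s => Im (y s)) (Im y').

(** The expansion of [evlc P] at [z] in the real coordinates of the increment. Its two linear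
    coefficients are the real partial derivatives that make up [dC]. *)
Definition recentered P z :=
  series_comp P (affine z 1 'i%C) (affine (cconj z) 1 (- 'i%C)).

Definition dC P z h : C :=
  recentered P z 1%N 0%N * (Re h)%:C%C + recentered P z 0%N 1%N * (Im h)%:C%C.

Lemma dCD P z h k : dC P z (h + k) = dC P z h + dC P z k.
Proof. by rewrite /dC ReD ImD !rmorphD; ring. Qed.

Lemma dCZ P z (c : R) h : dC P z (c%:C%C * h) = c%:C%C * dC P z h.
Proof.
rewrite /dC; case: h => a b /=; rewrite !mul0r subr0 addr0 !rmorphM; ring.
Qed.

Lemma bounded_recentered P z p B s : 0 < s -> cnorm z + 2 * s <= p ->
  bounded_series p P B -> bounded_series s (recentered P z) B.
Proof.
move=> s0 zp PB.
apply: (bounded_comp s0 PB); (apply: bounded_seriesW; last exact: bounded_affine (ltW s0));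
by rewrite ?cnorm_conj ?cnormN cnorm1 cnorm_i.
Qed.

Lemma recentered_power_series P z p B s : 0 < s -> cnorm z + 2 * s <= p ->
  bounded_series p P B ->
  has_power_series (fun x => Re (evlc P (toC x))) (ofC z)
    (fun i j => Re (recentered P z i j)) s.
Proof.
move=> s0 zp PB.
have lE (x : 'rV[R]_2) : 1 * (x 0 0)%:C%C + 'i%C * (x 0 1)%:C%C = toC x.
  by rewrite mul1r toC_affine.
have mE (x : 'rV[R]_2) : 1 * (x 0 0)%:C%C + - 'i%C * (x 0 1)%:C%C = cconj (toC x).
  by rewrite mul1r mulNr conj_toC.
have := @analytic_at_affine R P p B 1 'i%C 1 (- 'i%C)
  (fun x => Re (evlc P (toC x))) (ofC z) s s0 PB.
rewrite /= lE mE ofCK; apply.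
- by rewrite cnorm1 cnorm_i.
- by rewrite cnorm_conj cnormN cnorm1 cnorm_i.
- by move=> h _; rewrite lE mE.
Qed.

Lemma recentered_scale c P z p B s i j : 0 < s -> cnorm z + 2 * s <= p ->
  bounded_series p P B ->
  recentered (scale_series c P) z i j = c * recentered P z i j.
Proof.
move=> s0 zp PB.
have b1 : bounded_series s (affine z 1 'i%C) p.
  by apply: bounded_seriesW (bounded_affine _ _ _ (ltW s0)); rewrite cnorm1 cnorm_i.
have b2 : bounded_series s (affine (cconj z) 1 (- 'i%C)) p.
  apply: bounded_seriesW (bounded_affine _ _ _ (ltW s0)).
  by rewrite cnorm_conj cnormN cnorm1 cnorm_i.
rewrite {1}/recentered /series_comp -lock.
apply: ccvg_clim; apply: eq_ccvg (ccvgMl c (pcompP s0 PB b1 b2 i j)) => N.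
by rewrite /partial_comp -triMl; apply: eq_tri => k l _; rewrite /scale_series mulrA.
Qed.

Lemma cderive_ofC y t (y' : C) : cderive y t y' <->
  is_derive t 1 (fun s => ofC (y s)) (ofC y').
Proof.
have e0 : (fun s => ofC (y s) 0 0) = (fun s => Re (y s)).
  by apply/funext => s; rewrite ofC0.
have e1 : (fun s => ofC (y s) 0 1) = (fun s => Im (y s)).
  by apply/funext => s; rewrite ofC1.
split=> [[d0 d1]|/is_derive_rV2 d].
  apply/is_derive_rV2 => -[[|[|j]] jl] //.
    by rewrite (_ : Ordinal jl = 0) ?e0 ?ofC0 //; exact: val_inj.
  by rewrite (_ : Ordinal jl = 1) ?e1 ?ofC1 //; exact: val_inj.
by split; [have := d 0|have := d 1]; rewrite ?e0 ?e1 ?ofC0 ?ofC1.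
Qed.

Lemma cderive_evlc P p B y t (y' : C) : bounded_series p P B ->
  cnorm (y t) < p -> cderive y t y' ->
  cderive (fun s => evlc P (y s)) t (dC P (y t) y').
Proof.
move=> PB yp /cderive_ofC dy.
pose s := (p - cnorm (y t)) / 2.
have s0 : 0 < s by rewrite divr_gt0 // subr_gt0.
have sp : cnorm (y t) + 2 * s <= p.
  by rewrite mulrC divfK ?pnatr_eq0 // addrC subrK.
have aux Q B' : bounded_series p Q B' ->
    is_derive t 1 (fun s => Re (evlc Q (y s))) (Re (dC Q (y t) y')).
  move=> QB; have dQ := is_diff_power_series s0 (recentered_power_series s0 sp QB).
  have := @is_derive_curve _ _ _ (fun x => Re (evlc Q (toC x)))
    (fun s => ofC (y s)) t (ofC y') (@ex_diff _ _ _ _ _ _ _ dQ) dy.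
  rewrite (@diff_val _ _ _ _ _ _ _ dQ) /linear2 ofC0 ofC1.
  rewrite (_ : _ \o _ = fun s => Re (evlc Q (y s))); last first.
    by apply/funext => s' /=; rewrite ofCK.
  rewrite (_ : Re (dC _ _ _) = Re (recentered Q (y t) 1%N 0%N) * Re y' +
    Re (recentered Q (y t) 0%N 1%N) * Im y') //.
  rewrite /dC ReD; case: (recentered _ _ 1%N 0%N) => a b.
  by case: (recentered _ _ 0%N 1%N) => c d /=; rewrite !mulr0 !subr0.
split; first exact: aux PB.
(* The imaginary part is the real part of the series scaled by [- i]. *)
have ImE (x : C) : Im x = Re (- 'i%C * x) by case: x => a b /=; ring.
have bi := bounded_scale (- 'i%C) PB.
have := aux _ _ bi.
have -> : Re (dC (scale_series (- 'i%C) P) (y t) y') = Im (dC P (y t) y').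
  rewrite ImE /dC !(recentered_scale _ _ _ s0 sp PB); congr Re; ring.
have p0 : 0 < p by apply: le_lt_trans yp; exact: cnorm_ge0.
have yc : {for t, continuous (fun s => ofC (y s))}.
  by apply: differentiable_continuous; apply/derivable1_diffP.
move=> d; apply: near_eq_is_derive d.
(* Scaling commutes with evaluation only inside radius [p], so the two functions are compared just
   near [t], where continuity keeps the curve in that ball. *)
near=> s'.
have yp' : cnorm (y s') <= p.
  have h : `|ofC (y t) - ofC (y s')| < s.
    by near: s'; move/cvgrPdist_lt : yc; exact.
  have h0 := le_lt_trans (coord_le_norm _ 0) h.
  have h1 := le_lt_trans (coord_le_norm _ 1) h.
  rewrite !mxE /= -ReB -?ImB in h0 h1.
  have := cnorm_le_ReIm (y t - y s'); have := cnormD (y t) (y s' - y t).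
  rewrite addrC subrK cnorm_distC; lra.
have yp'' : cnorm (cconj (y s')) <= p by rewrite cnorm_conj.
by rewrite ImE /evlc (evl_scale yp' yp'' _ PB).
Unshelve. all: by end_near. Qed.

End ComplexCurves.

(** * Differentials along rotations, and small differentials *)

Section RotationDerivative.
Variable R : realType.
Local Notation C := R[i].
Implicit Types (u v P phi : nat -> nat -> C) (z w h zeta : C) (r p s t B : R).

Lemma conv00 u v : conv u v 0%N 0%N = u 0%N 0%N * v 0%N 0%N.
Proof. by rewrite /conv !big_ord1. Qed.

Lemma conv10 u v : conv u v 1%N 0%N = u 0%N 0%N * v 1%N 0%N + u 1%N 0%N * v 0%N 0%N.
Proof. by rewrite /conv !big_ord_recl !big_ord0 /= !addr0. Qed.

Lemma conv01 u v : conv u v 0%N 1%N = u 0%N 0%N * v 0%N 1%N + u 0%N 1%N * v 0%N 0%N.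
Proof. by rewrite /conv !big_ord_recl !big_ord0 /= !addr0. Qed.

(** The product rule in a direction along which the base has derivative [k c]: its [n]-th power has
    derivative [n k c^n]. *)
Lemma convX_affine (c a b h0 h1 k : C) n : a * h0 + b * h1 = k * c ->
  convX (affine c a b) n 0%N 0%N = c ^+ n /\
  convX (affine c a b) n 1%N 0%N * h0 + convX (affine c a b) n 0%N 1%N * h1 =
    n%:R * k * c ^+ n.
Proof.
move=> hk; elim: n => [|n [IH0 IH1]]; first by rewrite /= !mul0r addr0 expr0.
have cS : convX (affine c a b) n.+1 = conv (affine c a b) (convX (affine c a b) n) by [].
rewrite !cS conv00 conv10 conv01 IH0 /=.
split; first by rewrite exprS.
transitivity (c * (convX (affine c a b) n 1%N 0%N * h0 +
    convX (affine c a b) n 0%N 1%N * h1) + (a * h0 + b * h1) * c ^+ n).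
  by ring.
by rewrite IH1 hk exprS -natr1; ring.
Qed.

(** The direction [i zeta] multiplies [zeta] by [i] and its conjugate by [- i], so each monomial is
    multiplied by [i (k - l)]. Both sides are limits of the same partial sums. *)
Lemma dC_rotation phi p B r M zeta : bounded_series p phi B ->
  cnorm zeta < p -> bounded_series r (rotation_derivative phi) M ->
  cnorm zeta <= r ->
  dC phi zeta ('i%C * zeta) = 'i%C * evlc (rotation_derivative phi) zeta.
Proof.
move=> phiB zp rM zr.
pose s := (p - cnorm zeta) / 2.
have s0 : 0 < s by rewrite divr_gt0 // subr_gt0.
have sp : cnorm zeta + 2 * s <= p.
  by rewrite mulrC divfK ?pnatr_eq0 // addrC subrK.
have zr' : cnorm (cconj zeta) <= r by rewrite cnorm_conj.
set h := 'i%C * zeta; pose h0 := (Re h)%:C%C; pose h1 := (Im h)%:C%C.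
have e1 : 1 * h0 + 'i%C * h1 = 'i%C * zeta by rewrite mul1r -complexE.
have e2 : 1 * h0 + - 'i%C * h1 = - 'i%C * cconj zeta.
  rewrite /h0 /h1 /h; case: (zeta) => a b; apply/eqP; rewrite eq_complex /=.
  by apply/andP; split; apply/eqP; ring.
have b1 : bounded_series s (affine zeta 1 'i%C) p.
  by apply: bounded_seriesW (bounded_affine _ _ _ (ltW s0)); rewrite cnorm1 cnorm_i.
have b2 : bounded_series s (affine (cconj zeta) 1 (- 'i%C)) p.
  apply: bounded_seriesW (bounded_affine _ _ _ (ltW s0)).
  by rewrite cnorm_conj cnormN cnorm1 cnorm_i.
have l10 := ccvgMl h0 (pcompP s0 phiB b1 b2 1%N 0%N).
have l01 := ccvgMl h1 (pcompP s0 phiB b1 b2 0%N 1%N).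
have := ccvgMl 'i%C (evlP zr zr' rM); apply: ccvg_unique.
rewrite /dC [_ * h0]mulrC [_ * h1]mulrC.
apply: eq_ccvg (ccvgD l10 l01) => N; rewrite /partial_comp -!triMl -triD.
apply: eq_tri => i j _.
have [x0 x1] := convX_affine i e1; have [y0 y1] := convX_affine j e2.
rewrite conv10 conv01 x0 y0.
transitivity (phi i j * (zeta ^+ i * (convX (affine (cconj zeta) 1 (- 'i%C)) j 1%N 0%N * h0 +
    convX (affine (cconj zeta) 1 (- 'i%C)) j 0%N 1%N * h1) +
   (convX (affine zeta 1 'i%C) i 1%N 0%N * h0 +
    convX (affine zeta 1 'i%C) i 0%N 1%N * h1) * cconj zeta ^+ j)).
  by ring.
rewrite x1 y1 /series_term /rotation_derivative rmorphB !rmorph_nat; ring.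
Qed.

Lemma dC_small chi p B : 0 < p -> order_ge 2 chi -> bounded_series p chi B ->
  exists2 d, 0 < d & forall z h, cnorm z <= d ->
    cnorm (dC chi z h) <= 1 / 4 * cnorm h.
Proof.
move=> p0 chi2 chiB; have [K K0 chiK] := quadratic_bound p0 chi2 chiB.
(* Recentring at [|z| <= d] with radius [d] stays within [3 d], and the Cauchy estimate bounds each
   partial derivative by [K (3 d)^2 / d = 9 K d <= 1 / 8]; there are two of them. *)
pose d := Num.min (p / 3) (1 / (72 * K)).
have d0 : 0 < d by rewrite lt_min !divr_gt0 // mulr_gt0.
have dp : 3 * d <= p by have : d <= p / 3; [rewrite ge_min lexx|lra].
have dK : 72 * (K * d) <= 1.
  have -> : 72 * (K * d) = d * (72 * K) by ring.
  by rewrite -ler_pdivlMr ?mulr_gt0 // ge_min lexx orbT.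
exists d => // z h zd.
have b : bounded_series d (recentered chi z) (K * (3 * d) ^+ 2).
  apply: bounded_recentered (chiK _ _ dp) => //; first lra.
  by rewrite mulr_ge0 // ltW.
have c10 := cnorm_coef 1%N 0%N d0 b; have c01 := cnorm_coef 0%N 1%N d0 b.
have E : K * (3 * d) ^+ 2 / d = 9 * (K * d) by field; rewrite gt_eqF.
rewrite expr0 expr1 mulr1 E in c10; rewrite expr0 expr1 mul1r E in c01.
apply: le_trans (cnormD _ _) _; rewrite !cnormM !cnormC.
have : cnorm (recentered chi z 1%N 0%N) * `|Re h| <= 9 * (K * d) * cnorm h.
  by apply: ler_pM; rewrite ?cnorm_ge0 ?Re_le_cnorm.
have : cnorm (recentered chi z 0%N 1%N) * `|Im h| <= 9 * (K * d) * cnorm h.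
  by apply: ler_pM; rewrite ?cnorm_ge0 ?Im_le_cnorm.
have : 9 * (K * d) * cnorm h <= 1 / 8 * cnorm h.
  by apply: ler_wpM2r; [exact: cnorm_ge0|lra].
lra.
Qed.

Section Curves.
Implicit Types y : R -> C.

Lemma cderiveD y1 y2 t (d1 d2 : C) : cderive y1 t d1 -> cderive y2 t d2 ->
  cderive (fun s => y1 s + y2 s) t (d1 + d2).
Proof.
move=> [r1 i1] [r2 i2]; split; rewrite ?ReD ?ImD.
  under eq_fun do rewrite ReD; exact: is_deriveD.
by under eq_fun do rewrite ImD; exact: is_deriveD.
Qed.

Lemma cderive_unique y t (d1 d2 : C) : cderive y t d1 -> cderive y t d2 ->
  d1 = d2.
Proof.
move=> [r1 i1] [r2 i2]; apply/eqP; rewrite eq_complex.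
by rewrite -(@derive_val _ _ _ _ _ _ _ r1) -(@derive_val _ _ _ _ _ _ _ i1)
   (@derive_val _ _ _ _ _ _ _ r2) (@derive_val _ _ _ _ _ _ _ i2) !eqxx.
Qed.

Definition rotation_curve (Om : R) zeta (t : R) : C :=
  Complex (cos (Om * t)) (sin (Om * t)) * zeta.

Lemma cnorm_rotation_curve Om zeta t : cnorm (rotation_curve Om zeta t) = cnorm zeta.
Proof. by rewrite cnormM cnormE cos2Dsin2 sqrtr1 mul1r. Qed.

Lemma rotation_curve0 Om zeta : rotation_curve Om zeta 0 = zeta.
Proof.
rewrite /rotation_curve mulr0 cos0 sin0 -[Complex 1 0]/(1 : C); exact: mul1r.
Qed.

Lemma cderive_rotation_curve Om zeta t :
  cderive (rotation_curve Om zeta) t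
    (Om%:C%C * ('i%C * rotation_curve Om zeta t)).
Proof.
have dl : is_derive t 1 (fun s : R => Om * s) Om.
  by have := @is_deriveZ _ _ _ id Om t 1 1 _; rewrite /GRing.scale /= mulr1; apply.
have dc : is_derive t 1 (fun s => cos (Om * s)) (- sin (Om * t) * Om).
  exact: (@is_derive1_comp _ cos (fun s => Om * s)).
have ds : is_derive t 1 (fun s => sin (Om * s)) (cos (Om * t) * Om).
  exact: (@is_derive1_comp _ sin (fun s => Om * s)).
case: zeta => a b; split => /=.
  have := @is_deriveB _ _ _ _ _ _ _ _ _ (@is_deriveZ _ _ _ _ a _ _ _ dc)
    (@is_deriveZ _ _ _ _ b _ _ _ ds).
  rewrite /GRing.scale /= => H.
  rewrite (_ : (fun s => _) = (fun s => a * cos (Om * s)) - (fun s => b * sin (Om * s))).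
    by apply: is_derive_eq H _; ring.
  by apply/funext => s; rewrite !fctE; ring.
have := @is_deriveD _ _ _ _ _ _ _ _ _ (@is_deriveZ _ _ _ _ b _ _ _ dc)
  (@is_deriveZ _ _ _ _ a _ _ _ ds).
rewrite /GRing.scale /= => H.
rewrite (_ : (fun s => _) = (fun s => b * cos (Om * s)) + (fun s => a * sin (Om * s))).
  by apply: is_derive_eq H _; ring.
by apply/funext => s; rewrite !fctE; ring.
Qed.

Definition sqn z : R := Re z ^+ 2 + Im z ^+ 2.

Lemma sqnE z : sqn z = cnorm z ^+ 2.
Proof. by case: z => a b; rewrite cnormE sqr_sqrtr // addr_ge0 // sqr_ge0. Qed.

Lemma is_derive_sqn y t (d : C) : cderive y t d ->
  is_derive t 1 (fun s => sqn (y s)) (2 * Re (cconj (y t) * d)).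
Proof.
move=> [dr di].
have H := is_deriveD (is_deriveM dr dr) (is_deriveM di di).
rewrite (_ : (fun s => _) = (fun s => Re (y s)) * (fun s => Re (y s)) +
  (fun s => Im (y s)) * (fun s => Im (y s))).
  apply: is_derive_eq H _; rewrite /GRing.scale /=.
  by case: (y t) d {dr di} => a b [c e] /=; ring.
by apply/funext => s; rewrite !fctE /sqn !expr2.
Qed.

End Curves.

End RotationDerivative.

(** * The matrix exponential *)

Section MatrixExponential.
Variable R : realType.
Local Notation C := R[i].
Implicit Types (A : 'M[R]_2) (v : 'rV[R]_2) (z : C).

(** The complex exponential as a double series without the second variable, so that the lemmas on
    products and conjugates apply to it. *)
Definition exp_series : nat -> nat -> C := fun i j =>
  if j == 0%N then ((i`!%:R)^-1 : R)%:C%C else 0.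

Lemma bounded_exp_series (r : R) : 0 <= r -> bounded_series r exp_series (expR r).
Proof.
move=> r0 N; apply: (@le_trans _ _ (series (exp_coeff r) N)); last first.
  rewrite /expR; apply: nondecreasing_cvgn_le (is_cvg_series_exp_coeff r) N.
  by apply: nondecreasing_series => n _ _; rewrite mulr_ge0 ?exprn_ge0 ?invr_ge0.
rewrite /series /= big_mkord; apply: ler_sum => n _.
rewrite /diag big_ord_recr /= big1 ?add0r; last first.
  move=> i _; rewrite /weight /exp_series subn_eq0 leqNgt ltn_ord /=.
  by rewrite cnorm0 !mul0r.
rewrite /weight /exp_series subnn eqxx expr0 mulr1 cnormC ger0_norm ?invr_ge0//.
by rewrite /exp_coeff /= mulrC.
Qed.

Lemma exp_series_cvg z : ccvg (fun N => \sum_(k < N) ((k`!%:R)^-1 : R)%:C%C * z ^+ k)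
  (evlc exp_series z).
Proof.
have zz : cnorm (cconj z) <= cnorm z by rewrite cnorm_conj.
have := evlP (lexx (cnorm z)) zz (bounded_exp_series (cnorm_ge0 z)).
apply: eq_ccvg => N; apply: eq_bigr => n _.
rewrite /diag big_ord_recr /= big1 ?add0r; last first.
  move=> i _; rewrite /series_term /exp_series subn_eq0 leqNgt ltn_ord /=.
  by rewrite !mul0r.
by rewrite /series_term /exp_series subnn eqxx expr0 mulr1.
Qed.

(** The functional equation for [z] and its conjugate, whose sum is [2 Re z]; degree by degree it is
    the binomial theorem. *)
Lemma sqn_exp_series z : evlc exp_series z * cconj (evlc exp_series z) =
  (expR (2 * Re z))%:C%C.
Proof.
have zz : cnorm (cconj z) <= cnorm z by rewrite cnorm_conj.
have b := bounded_exp_series (cnorm_ge0 z).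
rewrite /evlc -(evl_star (lexx _) b).
rewrite -(evl_conv (lexx _) zz b (bounded_star b)).
apply: evl_eq; apply/ccvgP => /=.
have E N : tri (series_term (conv exp_series (star exp_series)) z (cconj z)) N =
    (series (exp_coeff (2 * Re z)) N)%:C%C.
  rewrite /series /= big_mkord rmorph_sum; apply: eq_bigr => n _.
  have zE : ((2 * Re z)%:C)%C = z + cconj z by rewrite rmorphM rmorph_nat /cconj addcJ.
  transitivity ((z + cconj z) ^+ n * ((n`!%:R)^-1 : R)%:C%C); last first.
    by rewrite -zE -rmorphXn -rmorphM.
  rewrite addrC exprDn mulr_suml.
  apply: eq_bigr => i _; rewrite /series_term.
  have -> : conv exp_series (star exp_series) i (n - i)%N =
      ((i`!%:R)^-1 * ((n - i)`!%:R)^-1 : R)%:C%C.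
    rewrite /conv big_ord_recr /= [X in X + _]big1 ?add0r; last first.
      move=> k _; apply: big1 => l _; rewrite /star /exp_series.
      by rewrite subn_eq0 leqNgt ltn_ord [if _ then _ else _]/= /cconj rmorph0 mulr0.
    rewrite big_ord_recl /= [X in _ + X]big1 ?addr0; last first.
      by move=> k _; rewrite /exp_series /= mul0r.
    have cr (x : R) : cconj x%:C%C = x%:C%C by exact: conjc_real.
    by rewrite /star /exp_series !subnn !subn0 !eqxx cr -rmorphM.
  have ni : (i <= n)%N by rewrite -ltnS.
  rewrite -(bin_fact ni) !natrM !invfM !rmorphM !fmorphV !rmorph_nat.
  rewrite -mulr_natl.
  have bn : ('C(n, i)%:R : C) != 0 by rewrite pnatr_eq0 -lt0n bin_gt0.
  have f1 : (i`!%:R : C) != 0 by rewrite pnatr_eq0 -lt0n fact_gt0.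
  have f2 : ((n - i)`!%:R : C) != 0 by rewrite pnatr_eq0 -lt0n fact_gt0.
  by field; rewrite f1 f2 bn.
split.
  rewrite [X in X @ _](_ : _ = series (exp_coeff (2 * Re z))).
    exact: is_cvg_series_exp_coeff.
  by apply/funext => N; rewrite E.
by under eq_fun do rewrite E /=; exact: cvg_cst.
Qed.

Lemma norm_mulmx2 A B : `|(A * B : 'M[R]_2)| <= 2 * `|A| * `|B|.
Proof.
rewrite /Num.Def.normr /= mx_normrE bigmax_le //=.
  by rewrite !mulr_ge0 // /mx_norm.
move=> [i j] _ /=; rewrite mxE; apply: le_trans (ler_norm_sum _ _ _) _.
have h (M : 'M[R]_2) k l : `|M k l| <= mx_norm M.
  rewrite mx_normrE.
  exact: (le_bigmax _ (fun i : 'I_2 * 'I_2 => `|M i.1 i.2|) (k, l)).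
rewrite big_ord_recl big_ord1 !normrM.
have := ler_pM (normr_ge0 _) (normr_ge0 _) (h A i ord0) (h B ord0 j).
have := ler_pM (normr_ge0 _) (normr_ge0 _) (h A i (lift ord0 ord0)) (h B (lift ord0 ord0) j).
rewrite -mulrA; lra.
Qed.

Lemma expmx_cvg A : series (fun k => (k`!%:R)^-1 *: A ^+ k) @ \oo --> expmx A.
Proof.
pose u k := (k`!%:R)^-1 *: A ^+ k.
suff : cvgn (series (fun k => `|u k|)).
  move=> /cauchy_cvgP/cauchy_seriesP u_ncvg.
  apply/(@cauchy_cvgP 'M[R]_2)/(@cauchy_seriesP _ 'M[R]_2) => e /u_ncvg.
  apply: filterS => n /=; rewrite ger0_norm ?sumr_ge0 //.
  by apply: le_lt_trans; apply: ler_norm_sum.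
(* The factor 2 lost in each matrix product is absorbed in [2 |A|]; the constant covers the power
   0. *)
apply: (@series_le_cvg _ _ (fun k => (`|1 : 'M[R]_2| + 1) * exp_coeff (2 * `|A|) k)).
- by move=> n.
- move=> n; rewrite /exp_coeff /= mulr_ge0 ?addr_ge0 // divr_ge0 //.
- move=> n; rewrite normrZ ger0_norm ?invr_ge0 // mulrC /exp_coeff /= mulrA.
  rewrite ler_wpM2r ?invr_ge0 //.
  elim: n => [|n IH]; first by rewrite !expr0 mulr1 lerDl.
  rewrite !exprS; apply: le_trans (norm_mulmx2 _ _) _.
  rewrite mulrCA ler_wpM2l ?mulr_ge0 //.
- have -> : (fun k => (`|1 : 'M[R]_2| + 1) * exp_coeff (2 * `|A|) k) =
     (`|1 : 'M[R]_2| + 1) *: exp_coeff (2 * `|A|).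
    by apply/funext => k; rewrite fctE.
  by apply: is_cvg_seriesZ; exact: is_cvg_series_exp_coeff.
Qed.

Lemma expmx_entry_cvg A i j :
  (fun N => series (fun k => (k`!%:R)^-1 *: A ^+ k) N i j) @ \oo --> expmx A i j.
Proof.
exact: (@continuous_cvg _ _ _ _ _ _ (fun M : 'M[R]_2 => M i j) _
  (@coord_continuous R 2 2 i j _) (@expmx_cvg A)).
Qed.

(** A real row vector times a complex column. An eigencolumn of [A] turns the real action of [A]
    into a complex scalar. *)
Definition pair_with v (u0 u1 : C) : C := (v 0 0)%:C%C * u0 + (v 0 1)%:C%C * u1.

Lemma expmx_eigenvector A v (u0 u1 lam : C) (t : R) :
  (forall w : 'rV[R]_2, pair_with (w *m A) u0 u1 = lam * pair_with w u0 u1) ->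
  pair_with (v *m expmx (t *: A)) u0 u1 =
  evlc exp_series (t%:C%C * lam) * pair_with v u0 u1.
Proof.
move=> Au; pose S N := series (fun k => (k`!%:R)^-1 *: (t *: A) ^+ k) N.
have pairD w w' : pair_with (w + w') u0 u1 = pair_with w u0 u1 + pair_with w' u0 u1.
  by rewrite /pair_with !mxE !rmorphD; ring.
have pairZ (c : R) w : pair_with (c *: w) u0 u1 = c%:C%C * pair_with w u0 u1.
  by rewrite /pair_with !mxE !rmorphM; ring.
have pair0 : pair_with 0 u0 u1 = 0 by rewrite /pair_with !mxE !rmorph0 !mul0r addr0.
have Ak k : pair_with (v *m (t *: A) ^+ k) u0 u1 = (t%:C%C * lam) ^+ k * pair_with v u0 u1.
  elim: k => [|k IH]; first by rewrite !expr0 mulmx1 mul1r.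
  rewrite exprSr mulmxA -scalemxAr pairZ Au IH exprS; ring.
have lhs : ccvg (fun N => pair_with (v *m S N) u0 u1)
    (pair_with (v *m expmx (t *: A)) u0 u1).
  have entry j : ccvg (fun N => ((v *m S N) 0 j)%:C%C) ((v *m expmx (t *: A)) 0 j)%:C%C.
    apply/ccvgP; split => /=; last exact: cvg_cst.
    have e i := @expmx_entry_cvg (t *: A) i j.
    rewrite !mxE !big_ord_recl big_ord0 addr0.
    under eq_fun do rewrite !mxE !big_ord_recl big_ord0 addr0.
    exact: (cvgD (cvgM (cvg_cst _) (e _)) (cvgM (cvg_cst _) (e _))).
  have := ccvgD (ccvgMl u0 (entry 0)) (ccvgMl u1 (entry 1)).
  rewrite [X in ccvg _ X](_ : _ = pair_with (v *m expmx (t *: A)) u0 u1); last first.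
    by rewrite /pair_with; ring.
  by apply: eq_ccvg => N; rewrite /pair_with; ring.
have rhs := ccvgMl (pair_with v u0 u1) (exp_series_cvg (t%:C%C * lam)).
apply: (ccvg_unique lhs); rewrite mulrC; apply: eq_ccvg rhs => N.
rewrite /S /series /= big_mkord mulmx_sumr.
rewrite (big_morph (fun w => pair_with w u0 u1) pairD pair0) mulr_sumr.
by apply: eq_bigr => k _; rewrite -scalemxAr pairZ Ak; ring.
Qed.

(** Periodicity at time 0, paired with the eigencolumn, says that [exp(T lam) = 1]; taking squared
    moduli gives [2 T Re lam = 0]. *)
Lemma rotation_eigenvalue A (u0 u1 lam : C) v : generates_rotation A ->
  (forall w : 'rV[R]_2, pair_with (w *m A) u0 u1 = lam * pair_with w u0 u1) ->
  pair_with v u0 u1 != 0 -> Re lam = 0.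
Proof.
move=> rotA Au vu.
have v0 : v != 0.
  apply: contraNneq vu => ->; by rewrite /pair_with !mxE !rmorph0 !mul0r addr0.
have [[T T0 per] _] := rotA v v0.
have /(congr1 (fun w => pair_with w u0 u1)) := per 0.
rewrite add0r !(expmx_eigenvector _ _ Au) => /(mulIf vu) E.
have := sqn_exp_series (T%:C%C * lam); rewrite E sqn_exp_series => /(@complexI R).
move/expR_inj => H; have : 2 * Re (T%:C%C * lam) = 0.
  by rewrite -H; case: (lam) => a b /=; rewrite !mul0r subr0 mulr0.
case: (lam) => a b /=; rewrite mul0r subr0 => h.
have /eqP : T * a = 0 by lra.
by rewrite mulf_eq0 (gt_eqF T0) => /eqP.
Qed.

(** A kernel vector is fixed by the exponential flow, against the nontriviality of its orbit. *)
Lemma rotation_no_kernel A v : generates_rotation A -> v != 0 -> v *m A != 0.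
Proof.
move=> rotA v0; apply/eqP => vA; have [_ [t /eqP]] := rotA v v0; apply.
pose S N := series (fun k => (k`!%:R)^-1 *: (t *: A) ^+ k) N.
have vS N : v *m S N.+1 = v.
  rewrite /S /series /= big_mkord mulmx_sumr big_ord_recl big1 /=.
    by rewrite fact0 invr1 scale1r expr0 mulmx1 addr0.
  by move=> k _; rewrite -scalemxAr exprS mulmxA -scalemxAr vA scaler0 mul0mx scaler0.
apply/rowP => j.
have e i := @expmx_entry_cvg (t *: A) i j.
have h : (fun N => (v *m S N) 0 j) @ \oo --> (v *m expmx (t *: A)) 0 j.
  rewrite !mxE !big_ord_recl big_ord0 addr0.
  under eq_fun do rewrite !mxE !big_ord_recl big_ord0 addr0.
  exact: (cvgD (cvgM (cvg_cst _) (e _)) (cvgM (cvg_cst _) (e _))).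
have h' : (fun N => (v *m S N) 0 j) @ \oo --> v 0 j.
  by apply: cvg_near_cst; exists 1%N => // -[|n] //= _; rewrite vS.
exact: cvg_unique h h'.
Qed.

Lemma generates_rotation_trace_det A : generates_rotation A ->
  A 1 1 = - A 0 0 /\ 0 < - (A 0 0 ^+ 2 + A 0 1 * A 1 0).
Proof.
move=> rotA; set a := A 0 0; set b := A 0 1; set c := A 1 0; set d := A 1 1.
have mulE (w : 'rV[R]_2) j : (w *m A) 0 j = w 0 0 * A 0 j + w 0 1 * A 1 j.
  rewrite mxE !big_ord_recl big_ord0 addr0; congr (_ * A _ _ + w _ _ * A _ _);
  by apply: val_inj.
have det0 : a * d - b * c != 0.
  apply/eqP => det0.
  have ker (v0 v1 : R) : v0 * a + v1 * c = 0 -> v0 * b + v1 * d = 0 -> v0 = 0 /\ v1 = 0.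
    move=> h0 h1; pose v := ofC (Complex v0 v1).
    have vA : v *m A = 0.
      by apply: eq_rV2; rewrite mulE !mxE /= ?h0 ?h1.
    have /eqP v00 : v == 0.
      by apply/negP => /negP /(rotation_no_kernel rotA); rewrite vA eqxx.
    by move/rowP: v00 => v00; have := v00 0; have := v00 1; rewrite !mxE.
  (* A singular matrix has [(c, - a)] and [(d, - b)] in its left kernel. Since the kernel is trivial
     all entries vanish, and then [(1, 0)] is in the kernel too. *)
  have [c0 /eqP] := ker c (- a) ltac:(ring) ltac:(lra).
  rewrite oppr_eq0 => /eqP a0.
  have [d0 /eqP] := ker d (- b) ltac:(lra) ltac:(ring).
  rewrite oppr_eq0 => /eqP b0.
  by have [/eqP] := ker 1 0 ltac:(lra) ltac:(lra); rewrite oner_eq0.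
(* If [b = 0], the column [(0, 1)] has the real eigenvalue [d], which must be 0, and the determinant
   vanishes. *)
have b0 : b != 0.
  apply/eqP => b0; have := @rotation_eigenvalue A 0 1 d%:C%C (ofC (Complex 0 1)) rotA.
  rewrite /pair_with !mxE /= => H; have d0 : d = 0.
    apply: H; last by rewrite mulr0 add0r mulr1 oner_eq0.
    by move=> w; rewrite !mulE -/a -/b -/c -/d b0 !rmorphD !rmorphM rmorph0; ring.
  by move: det0; rewrite b0 d0 mulr0 mul0r subr0 eqxx.
(* A root of the characteristic polynomial has the eigencolumn [(b, lam - a)], whose pairing with
   [(1, 0)] is [b <> 0]. *)
have root (lam : C) : (lam - a%:C%C) * (lam - d%:C%C) = b%:C%C * c%:C%C -> Re lam = 0.
  move=> char; apply: (@rotation_eigenvalue A b%:C%C (lam - a%:C%C) lam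
    (ofC (Complex 1 0)) rotA).
    move=> w; rewrite /pair_with !mulE -/a -/b -/c -/d !rmorphD !rmorphM.
    apply/eqP; rewrite -subr_eq0; apply/eqP.
    transitivity ((w 0 1)%:C%C * (b%:C%C * c%:C%C -
        (lam - a%:C%C) * (lam - d%:C%C))); first by ring.
    by rewrite char subrr mulr0.
  rewrite /pair_with !mxE /= mul0r addr0 mul1r; apply/eqP => /(@complexI R) /eqP.
  by rewrite (negPf b0).
pose del := ((a - d) / 2) ^+ 2 + b * c.
(* [del] is a quarter of the discriminant. A real root would be 0, against the nonzero determinant;
   a complex root has real part half the trace. *)
have [del0|del0] := leP 0 del.
  have := root ((a + d) / 2 + Num.sqrt del)%:C%C.
  have E : ((a + d) / 2 + Num.sqrt del - a) * ((a + d) / 2 + Num.sqrt del - d) = b * c.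
    have := sqr_sqrtr del0; set s := Num.sqrt del => s2.
    have -> : ((a + d) / 2 + s - a) * ((a + d) / 2 + s - d) = s ^+ 2 - ((a - d) / 2) ^+ 2.
      by field.
    by rewrite s2 /del; ring.
  rewrite -!rmorphB -!rmorphM E => /(_ erefl) /= l0.
  by move: E det0; rewrite l0 !sub0r mulrNN => ->; rewrite subrr eqxx.
have := root (Complex ((a + d) / 2) (Num.sqrt (- del))).
have nd : 0 <= - del by rewrite oppr_ge0 ltW.
have := sqr_sqrtr nd; set s := Num.sqrt (- del) => s2 H.
have ad : (a + d) / 2 = 0.
  apply: H; apply/eqP; rewrite eq_complex /=; apply/andP; split; apply/eqP.
    have -> : ((a + d) / 2 - a) * ((a + d) / 2 - d) - (s - 0) * (s - 0) =
      - s ^+ 2 - ((a - d) / 2) ^+ 2 by field.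
    by rewrite s2 /del; ring.
  by field.
have da : d = - a by lra.
split=> //; move: del0; rewrite /del da.
have -> : ((a - - a) / 2) ^+ 2 = a ^+ 2 by field.
by rewrite oppr_gt0.
Qed.

End MatrixExponential.

(** * Coordinates diagonalizing the linear part *)

Section RowValued.
Variable R : realType.

Lemma is_diff_rV2 (X : 'rV[R]_2 -> 'rV[R]_2) (p : 'rV[R]_2)
    (d : 'I_2 -> 'rV[R]_2 -> R) :
  (forall j, is_diff p (fun q => X q 0 j) (d j)) ->
  differentiable X p /\ forall h j, 'd X p h 0 j = d j h.
Proof.
move=> dX; pose e j : 'rV[R]_2 := delta_mx 0 j.
have XE : X = (fun q => X q 0 0 *: e 0) + (fun q => X q 0 1 *: e 1).
  apply/funext => q; rewrite fctE; apply: eq_rV2; rewrite !mxE /=;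
  by rewrite ?mulr1 ?mulr0 ?addr0 ?add0r.
have dj j : differentiable (fun q => X q 0 j) p by have [] := dX j.
have dZ j : is_diff p (fun q => X q 0 j *: e j) (fun h => d j h *: e j).
  apply: DiffDef; first exact: differentiableZl.
  apply: etrans (diffZl (e j) (dj j)) _; apply/funext => h.
  by have [_ ->] := dX j.
have [dXp dXE] := is_diffD (dZ 0) (dZ 1).
rewrite -XE in dXp dXE; split=> // h j; rewrite dXE fctE !mxE /=.
by case: j => [[|[|j]] jl] //=; rewrite ?mulr1 ?mulr0 ?addr0 ?add0r;
  congr (d _ h); apply: val_inj.
Qed.

End RowValued.

Section LinearCoordinates.
Variable R : realType.
Local Notation C := R[i].
Variables (a b omega : R).
Hypotheses (b_neq0 : b != 0) (omega_gt0 : 0 < omega).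

(* For A = [[a, b], [c, - a]] with determinant omega^2, the column
   (b, i omega - a) is an eigenvector for i omega. *)
Definition eigen_coord (p : 'rV[R]_2) : C :=
  pair_with p b%:C%C (Complex (- a) omega).
(** The inverse change of coordinates: coordinate [j] of the point is [mu_j z] plus its conjugate,
    an affine series in [z] and the conjugate of [z]. *)
Definition eigen_mu (j : 'I_2) : C :=
  if j == 0 then Complex (1 / (2 * b)) (- a / (2 * b * omega))
  else Complex 0 (- 1 / (2 * omega)).
Definition eigen_inv (z : C) : 'rV[R]_2 :=
  \row_j (2 * Re (eigen_mu j * z)).

Lemma eigen_invK : cancel eigen_inv eigen_coord.
Proof.
case=> x y; apply/eqP; rewrite eq_complex /eigen_coord /pair_with !mxE /=.
have w0 : omega != 0 by rewrite gt_eqF.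
by apply/andP; split; apply/eqP; field; rewrite ?b_neq0 ?w0.
Qed.

Lemma eigen_coordK : cancel eigen_coord eigen_inv.
Proof.
move=> p; have w0 : omega != 0 by rewrite gt_eqF.
by apply: eq_rV2; rewrite mxE /=; field; rewrite ?b_neq0 ?w0.
Qed.

Lemma eigen_invE z j : ((eigen_inv z) 0 j)%:C%C =
  0 + eigen_mu j * z + cconj (eigen_mu j) * cconj z.
Proof.
rewrite mxE add0r -cconjM; case: (_ * z) => x y; rewrite /cconj.
by apply/eqP; rewrite eq_complex /=; apply/andP; split; apply/eqP; ring.
Qed.

Lemma eigen_inv_bound : exists2 K : R, 0 < K & forall z, `|eigen_inv z| <= K * cnorm z.
Proof.
exists (2 * (cnorm (eigen_mu 0) + cnorm (eigen_mu 1)) + 1).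
  by rewrite ltr_wpDl // mulr_ge0 // addr_ge0 // cnorm_ge0.
move=> z; have h j : cnorm (eigen_mu j) <= cnorm (eigen_mu 0) + cnorm (eigen_mu 1) ->
    `|(eigen_inv z) 0 j| <= (2 * (cnorm (eigen_mu 0) + cnorm (eigen_mu 1)) + 1) * cnorm z.
  move=> hj; rewrite mxE normrM ger0_norm //.
  have := Re_le_cnorm (eigen_mu j * z); rewrite cnormM.
  have := ler_wpM2r (cnorm_ge0 z) hj; have := cnorm_ge0 z; lra.
apply: norm_le_coord; apply: h; rewrite ?lerDl ?lerDr; exact: cnorm_ge0.
Qed.

Lemma eigen_coord_bound : exists2 K : R, 0 < K & forall p, cnorm (eigen_coord p) <= K * `|p|.
Proof.
exists (cnorm b%:C%C + cnorm (Complex (- a) omega) + 1).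
  by rewrite ltr_wpDl // addr_ge0 // cnorm_ge0.
move=> p; apply: le_trans (cnormD _ _) _; rewrite !cnormM !(cnormC (p _ _)).
have := ler_wpM2r (cnorm_ge0 b%:C%C) (coord_le_norm p 0).
have := ler_wpM2r (cnorm_ge0 (Complex (- a) omega)) (coord_le_norm p 1).
have := normr_ge0 p; lra.
Qed.

End LinearCoordinates.

(** * The vector field in the complex coordinate *)

Section ComplexField.
Variable R : realType.
Local Notation C := R[i].

Lemma complex_field (X : 'rV[R]_2 -> 'rV[R]_2) :
  (forall j : 'I_2, analytic_at (fun p => X p 0 j) 0) -> X 0 = 0 ->
  generates_rotation ('J X 0) ->
  exists a b omega f p B, [/\ b != 0, 0 < omega, 0 < p, order_ge 2 f &
    bounded_series p f B /\ forall z, cnorm z <= p ->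
    eigen_coord a b omega (X (eigen_inv a b omega z)) =
      'i%C * omega%:C%C * z + evlc f z].
Proof.
move=> X_an X0 rotX.
have /choice [cs csP] := X_an.
have /choice [rs rsP] : forall j, exists r, 0 < r /\
    has_power_series (fun p => X p 0 j) 0 (cs j) r by exact: csP.
have dX j := is_diff_power_series (proj1 (rsP j)) (proj2 (rsP j)).
have [dXp dXE] := is_diff_rV2 dX.
have JE i j : 'J X 0 i j = linear2 (cs j 1 0)%N (cs j 0 1)%N (delta_mx 0 i).
  by rewrite /jacobian mxE dXE.
have J0 j : 'J X 0 0 j = cs j 1%N 0%N.
  by rewrite JE /linear2 !mxE /= mulr1 mulr0 addr0.
have J1 j : 'J X 0 1 j = cs j 0%N 1%N.
  by rewrite JE /linear2 !mxE /= mulr1 mulr0 add0r.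
have [trA detA] := generates_rotation_trace_det rotX.
rewrite !J0 !J1 in trA detA.
set a := cs 0 1%N 0%N in trA detA; set b := cs 1 1%N 0%N in detA.
set c := cs 0 0%N 1%N in detA.
pose omega := Num.sqrt (- (a ^+ 2 + b * c)).
have w0 : 0 < omega by rewrite sqrtr_gt0.
have w2 : omega ^+ 2 = - (a ^+ 2 + b * c) by rewrite sqr_sqrtr // ltW.
have b0 : b != 0.
  apply/eqP => b0; move: detA; rewrite b0 mul0r addr0 oppr_gt0.
  by rewrite ltNge sqr_ge0.
pose s := Num.min (rs 0 / 2) (rs 1 / 2).
have s0 : 0 < s.
  have [h0 _] := rsP 0; have [h1 _] := rsP 1; by rewrite lt_min !divr_gt0.
have srs j : s <= rs j / 2.
  by case: j => [[|[|j]] jl] //; rewrite /s ge_min; apply/orP; [left|right];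
    rewrite le_eqVlt; apply/orP; left; apply/eqP; congr (rs _ / 2); apply: val_inj.
pose u j : nat -> nat -> C := fun i k => (cs j i k)%:C%C.
have uP j : (exists B, bounded_series s (u j) B) /\
    forall h : 'rV[R]_2, `|h| <= s ->
      evl (u j) (h 0 0)%:C%C (h 0 1)%:C%C = (X h 0 j)%:C%C.
  have [[B uB] uE] := bounded_of_power_series (proj1 (rsP j)) (proj2 (rsP j)).
  split; first by exists B; apply: bounded_series_radius (srs j) uB; exact: ltW.
  by move=> h hs; rewrite uE ?add0r //; exact: le_trans (srs j).
have /choice [Bs BsP] : forall j, exists B, bounded_series s (u j) B.
  by move=> j; have [] := uP j.
pose v j i k : C := if (i + k < 2)%N then 0 else u j i k.
have v2 j : order_ge 2 (v j) by move=> i k ik; rewrite /v ik.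
have vB j : bounded_series s (v j) (Bs j).
  apply: le_bounded_series (BsP j); first exact: ltW.
  by move=> i k; rewrite /v; case: ifP; rewrite ?cnorm0 ?cnorm_ge0.
have u00 j : u j 0%N 0%N = 0.
  have [_ /(_ 0)] := uP j; rewrite normr0 X0 !mxE => /(_ (ltW s0)) E.
  apply: etrans E.
  have z0 : cnorm (0%:C%C : C) <= 0 by rewrite cnormC normr0.
  symmetry; apply: evl_eq; apply: (@ccvg_near _ _ _ 1) => N N1.
  rewrite (@tri_finite _ _ 1) //.
    by rewrite tri_recr tri0 add0r /diag big_ord1 /series_term !expr0 !mulr1.
  move=> [|i] [|k] // _; rewrite /series_term rmorph0 ?exprS ?mul0r ?mulr0 //.
  by rewrite mul0r.
have uE j : u j = add_series (affine 0 (u j 1 0)%N (u j 0 1)%N) (v j).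
  apply/funext => i; apply/funext => k; rewrite /add_series /v /affine.
  by case: i k => [|[|i]] [|[|k]] //=; rewrite ?addr0 ?add0r ?u00.
pose mu := eigen_mu a b omega.
pose l j := affine 0 (mu j) (cconj (mu j)).
(* [K] bounds the inverse coordinate change, which therefore sends radius [p = s / K] into radius
   [s]. *)
pose K := 2 * (cnorm (mu 0) + cnorm (mu 1)) + 1.
have K0 : 0 < K by rewrite ltr_wpDl // mulr_ge0 // addr_ge0 // cnorm_ge0.
pose p := s / K.
have p0 : 0 < p by rewrite divr_gt0.
have lB j : bounded_series p (l j) s.
  apply: bounded_seriesW (bounded_affine _ _ _ (ltW p0)).
  rewrite cnorm0 add0r cnorm_conj /p mulrA ler_pdivrMr // mulrC ler_pM2l //.
  have := cnorm_ge0 (mu 0); have := cnorm_ge0 (mu 1); rewrite /K.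
  by case: j => [[|[|j]] jl] //=; rewrite /mu /eigen_mu /=; lra.
pose g j := series_comp (v j) (l 0) (l 1).
have gB j : bounded_series p (g j) (Bs j) by exact: bounded_comp (lB 0) (lB 1).
pose f := add_series (scale_series b%:C%C (g 0))
  (scale_series (Complex (- a) omega) (g 1)).
have g2 j : order_ge 2 (g j) by apply: order_comp => //; exact: order_affine.
exists a, b, omega, f, p; eexists; split=> //.
  by apply: order_add; apply: order_scale; exact: g2.
split.
  by apply: bounded_add; [exact: ltW|exact: bounded_scale (gB 0)|exact: bounded_scale (gB 1)].
move=> z zp; have zp' : cnorm (cconj z) <= p by rewrite cnorm_conj.
pose q := eigen_inv a b omega z.
have qE j : evl (l j) z (cconj z) = (q 0 j)%:C%C.
  by rewrite /l evl_affine /q eigen_invE.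
have qs : `|q| <= s.
  have h j : `|q 0 j| <= s.
    by rewrite -(@cnormC R) -qE; exact: (cnorm_evl zp zp' (lB j)).
  exact: norm_le_coord.
have k0 : cnorm (q 0 0)%:C%C <= s by rewrite cnormC (le_trans (coord_le_norm _ _)).
have k1 : cnorm (q 0 1)%:C%C <= s by rewrite cnormC (le_trans (coord_le_norm _ _)).
have XE j : (X q 0 j)%:C%C = u j 1%N 0%N * (q 0 0)%:C%C +
    u j 0%N 1%N * (q 0 1)%:C%C + evlc (g j) z.
  have [_ /(_ q qs) <-] := uP j.
  rewrite {1}uE (evl_add k0 k1 (bounded_affine _ _ _ (ltW s0)) (vB j)) evl_affine.
  rewrite add0r.
  have -> : evlc (g j) z = evl (v j) (q 0 0)%:C%C (q 0 1)%:C%C by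
    rewrite -!qE; exact: (evl_comp p0 (vB j) (lB 0) (lB 1) zp zp').
  by [].
have fE : evlc f z = b%:C%C * evlc (g 0) z + Complex (- a) omega * evlc (g 1) z.
  rewrite /evlc (evl_add zp zp' (bounded_scale _ (gB 0)) (bounded_scale _ (gB 1))).
  by rewrite (evl_scale zp zp' _ (gB 0)) (evl_scale zp zp' _ (gB 1)).
have zE : z = eigen_coord a b omega q by rewrite /q eigen_invK.
have ua : u 0 1%N 0%N = a%:C%C by [].
have uc : u 0 0%N 1%N = c%:C%C by [].
have ub : u 1 1%N 0%N = b%:C%C by [].
have ud : u 1 0%N 1%N = (- a)%:C%C by rewrite -trA.
rewrite fE /eigen_coord /pair_with !XE ua ub uc ud.
set e0 := evlc (g 0) z; set e1 := evlc (g 1) z.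
rewrite zE /eigen_coord /pair_with.
(* What remains is that [(b, i omega - a)] is an eigencolumn of the linear part, by
   [omega^2 = - (a^2 + b c)]. *)
suff : b%:C%C * (a%:C%C * (q 0 0)%:C%C + c%:C%C * (q 0 1)%:C%C) +
    Complex (- a) omega * (b%:C%C * (q 0 0)%:C%C + (- a)%:C%C * (q 0 1)%:C%C) =
    'i%C * omega%:C%C * ((q 0 0)%:C%C * b%:C%C + (q 0 1)%:C%C * Complex (- a) omega) :> C.
  set X1 := Complex (- a) omega => H.
  transitivity (b%:C%C * (a%:C%C * (q 0 0)%:C%C + c%:C%C * (q 0 1)%:C%C) +
    X1 * (b%:C%C * (q 0 0)%:C%C + (- a)%:C%C * (q 0 1)%:C%C) +
    (b%:C%C * e0 + X1 * e1)); first by ring.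
  by rewrite H.
apply/eqP; rewrite eq_complex /=; apply/andP; split; apply/eqP; last by ring.
rewrite -[LHS]subr0 -(subrr (omega ^+ 2 * q 0 1)) [in X in _ - (_ - X)]w2; ring.
Qed.

End ComplexField.

(** * The normal form *)

Section DiagonalSeries.
Variable R : realType.
Local Notation C := R[i].
Implicit Types (s v : nat -> nat -> C) (z zeta : C) (r M : R).

Lemma mul_conjc z : z * cconj z = (cnorm z ^+ 2)%:C%C.
Proof.
rewrite -sqnE; case: z => a b; rewrite /cconj /sqn.
by apply/eqP; rewrite eq_complex /=; apply/andP; split; apply/eqP; ring.
Qed.

Lemma evlc_diagonal_radial s z z' : real_diagonal s -> cnorm z = cnorm z' ->
  evlc s z = evlc s z'.
Proof.
move=> sd zz; rewrite /evlc /evl.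
suff -> : tri (series_term s z (cconj z)) = tri (series_term s z' (cconj z')) by [].
apply/funext => N; apply: eq_tri => i j _; rewrite /series_term sd; case: eqP => [<-|_]; last by rewrite !mul0r.
by rewrite -!mulrA -!exprMn !mul_conjc zz.
Qed.

Lemma real_diagonal_sign s r M : 0 < r -> bounded_series r s M ->
  real_diagonal s ->
  (forall zeta, cnorm zeta <= r -> evlc s zeta = 0) \/
  exists sg e, [/\ sg = 1 \/ sg = -1 :> R, 0 < e & forall zeta, zeta != 0 ->
    cnorm zeta <= e -> 0 < sg * Re (evlc s zeta)].
Proof.
move=> r0 sM sd; have M0 := bounded_series_ge0 sM.
have [s0|/existsNP [m0 /eqP sm0]] := pselect (forall m, s m m = 0).
  left=> zeta _; rewrite /evlc (@evl_finite _ _ _ _ 0) ?tri0 // => i j _.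
  by rewrite sd s0; case: eqP.
right; have exm : exists m, s m m != 0 by exists m0.
case: (ex_minnP exm) => m sm min.
have a1 k l : (m.*2 < k + l)%N -> k = m -> l = m -> False by lia.
have a2 : (m < m.*2.+1)%N by lia.
have a3 : (m.*2 - m)%N = m by lia.
have a4 n i : (n < m.*2)%N -> (i < n.+1)%N -> i = m -> (n - i)%N = m -> False by lia.
have a5 k : k != m -> (k + k < m.*2.+1)%N -> (k < m)%N by lia.
pose beta := Re (s m m).
have smE : s m m = beta%:C%C by rewrite sd eqxx.
have beta0 : 0 < `|beta|.
  by rewrite normr_gt0; apply: contraNneq sm => b0; rewrite smE b0.
have ord k : (k < m)%N -> s k k = 0.
  by move=> km; apply/eqP; apply: contraTT km => /min; rewrite -leqNgt.
(* The series is its first nonzero term [beta |zeta|^(2m)] plus a remainder of order at least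
   [2m + 1]. *)
pose v k l := if (k + l < m.*2.+1)%N then 0 else s k l.
pose fin k l := if (k == m) && (l == m) then s m m else 0.
have sE : s = add_series fin v.
  apply/funext => k; apply/funext => l; rewrite /add_series /fin /v.
  have [kl|kl] := ltnP (k + l) m.*2.+1.
    have [/andP [/eqP -> /eqP ->]|nkl] := boolP ((k == m) && (l == m)).
      by rewrite addr0.
    rewrite addr0; have [kleq|kl'] := eqVneq k l; last by rewrite sd (negPf kl').
    by subst l; apply: ord; move: nkl; rewrite andbb => /a5; apply.
  have -> : (k == m) && (l == m) = false.
    by apply/negP => /andP [/eqP ek /eqP el]; exact: (a1 k l).
  by rewrite add0r.
have v_ord : order_ge m.*2.+1 v by move=> k l kl; rewrite /v kl.
have finM : bounded_series r fin M.
  apply: le_bounded_series sM; first exact: ltW.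
  move=> k l; rewrite /fin; case: ifP => [/andP [/eqP -> /eqP ->] //|_].
  by rewrite cnorm0 cnorm_ge0.
have vM : bounded_series r v M.
  apply: le_bounded_series sM; first exact: ltW.
  by move=> k l; rewrite /v; case: ifP; rewrite ?cnorm0 ?cnorm_ge0.
pose K := r ^+ m.*2.+1.
have K0 : 0 < K by rewrite exprn_gt0.
(* The remainder is at most [M (|zeta| / r)^(2m+1)], which is below [|beta| |zeta|^(2m)] as soon as
   [M |zeta| < |beta| K]; [M + 1] makes this strict. *)
pose e := Num.min r (`|beta| * K / (M + 1)).
have M1 : 0 < M + 1 by lra.
have e0 : 0 < e by rewrite lt_min r0 divr_gt0 // mulr_gt0.
have er : e <= r by rewrite ge_min lexx.
have eM : e * (M + 1) <= `|beta| * K.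
  by rewrite -ler_pdivlMr // ge_min lexx orbT.
exists (Num.sg beta), e; split=> //.
  by have [b0|b0|b0] := sgrP beta; [move: beta0; rewrite b0 normr0 ltxx|left|right].
move=> zeta z0 ze; have zr := le_trans ze er.
have zr' : cnorm (cconj zeta) <= r by rewrite cnorm_conj.
have n0 : 0 < cnorm zeta.
  rewrite lt_neqAle cnorm_ge0 andbT eq_sym.
  by apply: contraNneq z0 => /cnorm_eq0 ->.
have finE : evlc fin zeta = (beta * cnorm zeta ^+ m.*2)%:C%C.
  rewrite /evlc (@evl_finite _ _ _ _ m.*2.+1); last first.
    move=> k l kl; rewrite /fin; case: ifP => // /andP [/eqP ek /eqP el].
    by case: (a1 k l).
  rewrite tri_recr /tri big1 ?add0r; last first.
    move=> n _; rewrite /diag big1 // => i _; rewrite /series_term /fin.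
    case: ifP => [/andP [/eqP ei /eqP en]|_]; last by rewrite !mul0r.
    by case: (a4 n i).
  rewrite /diag (bigD1 (Ordinal a2)) //= big1 ?addr0; last first.
    move=> i im; rewrite /series_term /fin.
    have /negPf -> : (i : nat) != m by apply: contra im => /eqP im; apply/eqP/val_inj.
    by rewrite andFb !mul0r.
  rewrite /series_term a3 /fin eqxx /= smE -mulrA -exprMn mul_conjc [RHS]rmorphM.
  congr (_ * _); rewrite -mul2n exprM; symmetry; exact: rmorphXn.
have vle : cnorm (evlc v zeta) <= M * (cnorm zeta / r) ^+ m.*2.+1.
  apply: (@cnorm_evl _ (cnorm zeta)) => //; first by rewrite cnorm_conj.
  exact: bounded_order (cnorm_ge0 _) zr r0 v_ord vM.
rewrite /evlc sE (evl_add zr zr' finM vM) -!/(evlc _ _) finE ReD /= mulrDr mulrA.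
rewrite -normrEsg.
have sgE : `|Num.sg beta * Re (evlc v zeta)| <= M * (cnorm zeta / r) ^+ m.*2.+1.
  apply: le_trans vle; rewrite normrM normr_sg.
  by rewrite (_ : beta != 0) ?mul1r ?Re_le_cnorm // -normr_gt0.
have key : M * (cnorm zeta / r) ^+ m.*2.+1 < `|beta| * cnorm zeta ^+ m.*2.
  rewrite expr_div_n -/K mulrA ltr_pdivrMr // exprSr.
  have p0 : 0 < cnorm zeta ^+ m.*2 by rewrite exprn_gt0.
  rewrite mulrCA [ltRHS]mulrAC [ltRHS]mulrC ltr_pM2l //.
  have : M * cnorm zeta < (M + 1) * cnorm zeta by rewrite ltr_pM2r //; lra.
  have : cnorm zeta * (M + 1) <= e * (M + 1) by rewrite ler_pM2r.
  lra.
have := ler_norm (- (Num.sg beta * Re (evlc v zeta))); rewrite normrN; lra.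
Qed.

End DiagonalSeries.

(** * Mutually inverse coordinate changes on a common ball *)

Section Conjugacy.
Variable R : realType.
Local Notation C := R[i].
Implicit Types (f phi chi : nat -> nat -> C) (z h zeta : C) (r p s t B : R).

Definition near_map phi z : C := z + evlc phi z.

Lemma near_mapE r phi B z : cnorm z <= r -> bounded_series r phi B ->
  near_map phi z = evlc (near_id phi) z.
Proof. by move=> zr phiB; rewrite (evlc_near_id zr phiB). Qed.

Lemma near_map_le r phi z : 0 < r -> cnorm z <= r -> order_ge 2 phi ->
  bounded_series r phi r -> cnorm (near_map phi z) <= 2 * cnorm z.
Proof.
move=> r0 zr phi2 phir; rewrite (near_mapE zr phir).
have idb := bounded_order (cnorm_ge0 z) zr r0 (order_near_id phi2)
  (bounded_near_id (ltW r0) phir).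
have zz : cnorm (cconj z) <= cnorm z by rewrite cnorm_conj.
apply: le_trans (cnorm_evl (lexx _) zz idb) _.
have -> : (r + r) * (cnorm z / r) ^+ 1 = 2 * cnorm z.
  by rewrite expr1; field; rewrite gt_eqF.
by [].
Qed.

Lemma near_map0 r phi : 0 < r -> order_ge 2 phi -> bounded_series r phi r ->
  near_map phi 0 = 0.
Proof.
move=> r0 phi2 phir; apply: cnorm_eq0; apply/eqP.
have z0 : cnorm (0 : C) <= r by rewrite cnorm0 ltW.
have := near_map_le r0 z0 phi2 phir; rewrite cnorm0 mulr0 => h.
by rewrite eq_le h cnorm_ge0.
Qed.

Lemma cderive_near_map phi p B (y : R -> C) t (d : C) : bounded_series p phi B ->
  cnorm (y t) < p -> cderive y t d ->
  cderive (fun s => near_map phi (y s)) t (d + dC phi (y t) d).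
Proof.
by move=> phiB yp yd; apply: cderiveD => //; exact: cderive_evlc phiB yp yd.
Qed.

Lemma normal_conjugacy omega f p B : 0 < omega -> 0 < p -> order_ge 2 f ->
  bounded_series p f B ->
  exists phi chi (Om be : C -> R) (d r : R),
  let Phi := near_map phi in let Psi := near_map chi in
  [/\ [/\ 0 < d, 8 * d <= r & r <= p],
      [/\ order_ge 2 phi, order_ge 2 chi, bounded_series r phi r &
        bounded_series r chi r],
      (forall zeta, cnorm zeta <= 2 * d -> Psi (Phi zeta) = zeta) /\
      (forall z, cnorm z <= 2 * d -> Phi (Psi z) = z),
      (forall z h, cnorm z <= 4 * d -> cnorm (dC chi z h) <= 1 / 4 * cnorm h) /\
      (forall zeta, cnorm zeta <= 2 * d ->
        'i%C * omega%:C%C * Phi zeta + evlc f (Phi zeta) =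
        (Om zeta)%:C%C * ('i%C * zeta + dC phi zeta ('i%C * zeta)) +
        (be zeta)%:C%C * zeta) &
      [/\ forall zeta, cnorm zeta <= 2 * d -> 0 < Om zeta,
          forall z z', cnorm z = cnorm z' -> Om z = Om z' &
          (forall zeta, cnorm zeta <= 2 * d -> be zeta = 0) \/
          exists2 sg : R, sg = 1 \/ sg = -1 &
            forall zeta, zeta != 0 -> cnorm zeta <= 2 * d ->
              0 < sg * be zeta]].
Proof.
move=> w0 p0 f2 fB.
have [r1 [phi [a [b [r10 r1p [[phi2 phir1 [M rotM]] [ad a1] bd]
  [[Ma aM] [Mb bM] nf]]]]]] := normal_form w0 p0 f2 fB.
have [r2 [chi [r20 r2r1 chi2 chir2 inv1]]] := near_id_right_inverse r10 phi2 phir1.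
have [r3 [chi' [r30 r3r2 _ chir3 inv2]]] := near_id_right_inverse r20 chi2 chir2.
have [d4 d40 small] := dC_small r20 chi2 chir2.
have Ma0 := bounded_series_ge0 aM.
(* Below this radius [|a| < 1], so the angular speed [omega (1 + a)] is positive. *)
pose d5 := r1 / (Ma + 1).
have d50 : 0 < d5 by rewrite divr_gt0 // ltr_wpDl.
have [e6 e60 sign] : exists2 e6, 0 < e6 &
    ((forall zeta, cnorm zeta <= e6 -> evlc b zeta = 0) \/
     exists2 sg : R, sg = 1 \/ sg = -1 & forall zeta, zeta != 0 ->
      cnorm zeta <= e6 -> 0 < sg * Re (evlc b zeta)).
  have [b0|[sg [e [sg1 e0 sgP]]]] := real_diagonal_sign r10 bM bd.
    by exists r1 => //; left.
  by exists e => //; right; exists sg.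
(* Each use of [Phi] or [Psi] may double a norm; the factor 16 leaves room for this and for the
   common radius [r = 8 d]. *)
pose d := Num.min (Num.min r3 d4) (Num.min d5 e6) / 16.
have m0 : 0 < Num.min (Num.min r3 d4) (Num.min d5 e6).
  by rewrite !lt_min r30 d40 d50 e60.
have d0 : 0 < d by rewrite divr_gt0.
have dr3 : 16 * d <= r3 by rewrite mulrC divfK ?pnatr_eq0 // !ge_min lexx.
have dd4 : 16 * d <= d4 by rewrite mulrC divfK ?pnatr_eq0 // !ge_min lexx orbT.
have dd5 : 16 * d <= d5 by rewrite mulrC divfK ?pnatr_eq0 // !ge_min lexx !orbT.
have de6 : 16 * d <= e6 by rewrite mulrC divfK ?pnatr_eq0 // !ge_min lexx !orbT.
pose r := 8 * d.
have r0 : 0 < r by rewrite mulr_gt0.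
(* Order 2 makes the bound shrink at least as fast as the radius, so the form bound equal to radius
   survives. *)
have lin q u : 0 < q -> r <= q -> order_ge 2 u -> bounded_series q u q ->
    bounded_series r u r.
  move=> q0 rq u2 uq; apply: bounded_seriesW (bounded_order (ltW r0) rq q0 u2 uq).
  have -> : q * (r / q) ^+ 2 = r * (r / q) by field; rewrite gt_eqF.
  by rewrite ler_piMr ?(ltW r0) // ler_pdivrMr // mul1r.
have rr2 : r <= r2 by rewrite /r; lra.
have rr1 : r <= r1 by lra.
exists phi, chi, (fun zeta => omega * (1 + Re (evlc a zeta))),
  (fun zeta => Re (evlc b zeta)), d, r => Phi Psi.
have phir : bounded_series r phi r by exact: lin r10 rr1 phi2 phir1.
have chir : bounded_series r chi r by exact: lin r20 rr2 chi2 chir2.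
have PhiPsi z : cnorm z <= r2 -> Phi (Psi z) = z.
  move=> zr2; have [h1 h2] := inv1 z zr2.
  rewrite /Phi /Psi (near_mapE zr2 chir2) (near_mapE _ phir1) //.
  exact: le_trans h1 r2r1.
(* [chi'] provides a point [z] with [zeta = Psi z]; then [Psi (Phi (Psi z)) = Psi z] because
   [Phi (Psi z) = z]. *)
have PsiPhi zeta : cnorm zeta <= r3 -> Psi (Phi zeta) = zeta.
  move=> zr3; have [h1 h2] := inv2 zeta zr3.
  set z := evlc (near_id chi') zeta in h1 h2.
  have zr2 : cnorm z <= r2 by exact: le_trans h1 r3r2.
  have Pz : Psi z = zeta by rewrite /Psi (near_mapE zr2 chir2).
  by rewrite -{1}Pz PhiPsi.
split.
- by split; [exact: d0|exact: lexx|rewrite /r; lra].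
- by split.
- by split=> zeta zd; [apply: PsiPhi|apply: PhiPsi]; lra.
- split=> [z h zd|zeta zd]; first by apply: small; lra.
  have zr1 : cnorm zeta <= r1 by lra.
  have [_] := nf zeta zr1; rewrite -(near_mapE zr1 phir1) -/(Phi zeta) => ->.
  have zlt : cnorm zeta < r1 by lra.
  rewrite (dC_rotation phir1 zlt rotM zr1) (evlc_real_diagonal zr1 aM ad).
  rewrite (evlc_real_diagonal zr1 bM bd) /= rmorphM rmorphD rmorph1; ring.
- split.
  + move=> zeta zd; rewrite mulr_gt0 //.
    have zr1 : cnorm zeta <= r1 by lra.
    have zz : cnorm (cconj zeta) <= cnorm zeta by rewrite cnorm_conj.
    have := cnorm_evl (lexx _) zz (bounded_order (cnorm_ge0 zeta) zr1 r10 a1 aM).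
    rewrite expr1 -/(evlc a zeta) => le1.
    have : Ma * (cnorm zeta / r1) < 1.
      rewrite mulrA ltr_pdivrMr // mul1r.
      have : cnorm zeta * (Ma + 1) <= r1.
        by rewrite -ler_pdivlMr ?ltr_wpDl // -/d5; lra.
      have := cnorm_ge0 zeta; rewrite le_eqVlt => /predU1P[<-|n0]; last by nra.
      by rewrite mulr0 => _.
    have := Re_le_cnorm (evlc a zeta); have := ler_norm (- Re (evlc a zeta)).
    rewrite normrN; lra.
  + by move=> z z' zz; rewrite (evlc_diagonal_radial ad zz).
  + have [b0|[sg sg1 sgP]] := sign.
      by left=> zeta zd; rewrite b0 //; lra.
    by right; exists sg => // zeta z0 zd; apply: sgP => //; lra.
Qed.

End Conjugacy.

(** * Real analyticity of the maps in plane coordinates *)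

Section AnalyticPullback.
Variable R : realType.
Local Notation C := R[i].
Implicit Types (P : nat -> nat -> C) (z : C) (r d s B : R).
Implicit Types (x h q : 'rV[R]_2).

Lemma pair_withD x h (u0 u1 : C) :
  pair_with (x + h) u0 u1 = pair_with x u0 u1 + pair_with h u0 u1.
Proof. by rewrite /pair_with !mxE !rmorphD; ring. Qed.

Lemma conj_pair_with x (u0 u1 : C) :
  cconj (pair_with x u0 u1) = pair_with x (cconj u0) (cconj u1).
Proof.
have cr (y : R) : cconj y%:C%C = y%:C%C by exact: conjc_real.
by rewrite /pair_with cconjD !cconjM !cr.
Qed.

Lemma pair_with_le x (u0 u1 : C) : cnorm (pair_with x u0 u1) <= (cnorm u0 + cnorm u1) * `|x|.
Proof.
apply: le_trans (cnormD _ _) _; rewrite !cnormM !(cnormC (x _ _)).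
have := ler_wpM2r (cnorm_ge0 u0) (coord_le_norm x 0).
have := ler_wpM2r (cnorm_ge0 u1) (coord_le_norm x 1).
lra.
Qed.

Lemma analytic_at_pullback P r d B (u0 u1 : C) (F : 'rV[R]_2 -> R) q : 0 < d ->
  2 * d <= r -> bounded_series r P B ->
  (forall x, cnorm (pair_with x u0 u1) <= 2 * d ->
    F x = Re (evlc P (pair_with x u0 u1))) ->
  cnorm (pair_with q u0 u1) < d -> analytic_at F q.
Proof.
move=> d0 dr PB FE qd.
pose K := cnorm u0 + cnorm u1 + 1.
have K0 : 0 < K by rewrite ltr_wpDl // addr_ge0 // cnorm_ge0.
pose s := d / K; have s0 : 0 < s by rewrite divr_gt0.
have Ks : (cnorm u0 + cnorm u1) * s <= d.
  rewrite /s mulrCA ler_piMr ?(ltW d0) // ler_pdivrMr // mul1r /K; lra.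
have lE x : u0 * (x 0 0)%:C%C + u1 * (x 0 1)%:C%C = pair_with x u0 u1.
  by rewrite /pair_with; ring.
have mE x : cconj u0 * (x 0 0)%:C%C + cconj u1 * (x 0 1)%:C%C =
    cconj (pair_with x u0 u1).
  by rewrite conj_pair_with /pair_with; ring.
eexists; exists s; split; first exact: s0.
apply: (@analytic_at_affine R P r B u0 u1 (cconj u0) (cconj u1) F q s s0 PB).
- by rewrite lE; lra.
- by rewrite mE !cnorm_conj; lra.
- move=> h hs; rewrite lE mE FE // pair_withD.
  apply: le_trans (cnormD _ _) _.
  have := le_trans (pair_with_le h u0 u1) (ler_wpM2l _ (ltW hs)).
  by move=> /(_ (addr_ge0 (cnorm_ge0 _) (cnorm_ge0 _))); lra.
Qed.

Lemma analytic_differentiable (F : 'rV[R]_2 -> R) q : analytic_at F q ->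
  differentiable F q.
Proof.
by move=> [c [r [r0 Fc]]]; have [] := is_diff_power_series r0 Fc.
Qed.

(** The factor [k] selects a real coordinate: 1 or [- i] for real and imaginary parts, [2 mu_j] for
    the coordinates of [eigen_inv]. *)
Lemma analytic_near_map_component P r d (u0 u1 k : C) q : 0 < d ->
  2 * d <= r -> bounded_series r P r ->
  cnorm (pair_with q u0 u1) < d ->
  analytic_at (fun x => Re (k * near_map P (pair_with x u0 u1))) q.
Proof.
move=> d0 dr ur; have r0 : 0 <= r by lra.
have idb := bounded_near_id r0 ur.
apply: (analytic_at_pullback d0 dr (bounded_scale k idb)) => x xd.
have xr : cnorm (pair_with x u0 u1) <= r by lra.
have xr' : cnorm (cconj (pair_with x u0 u1)) <= r by rewrite cnorm_conj.
by rewrite /evlc (evl_scale xr xr' _ idb) (near_mapE xr ur).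
Qed.

Lemma analytic_sqn_near_map P r d (u0 u1 : C) q : 0 < d ->
  2 * d <= r -> bounded_series r P r ->
  cnorm (pair_with q u0 u1) < d ->
  analytic_at (fun x => sqn (near_map P (pair_with x u0 u1))) q.
Proof.
move=> d0 dr ur; have r0 : 0 <= r by lra.
have idb := bounded_near_id r0 ur.
apply: (analytic_at_pullback d0 dr (bounded_conv r0 idb (bounded_star idb))) => x xd.
have xr : cnorm (pair_with x u0 u1) <= r by lra.
have xr' : cnorm (cconj (pair_with x u0 u1)) <= r by rewrite cnorm_conj.
rewrite /evlc (evl_conv xr xr' idb (bounded_star idb)) (evl_star xr idb).
rewrite -/(evlc _ _) -(near_mapE xr ur) mul_conjc sqnE; reflexivity.
Qed.

Lemma open_near_map_domain P r d (u0 u1 : C) : 0 < d ->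
  2 * d <= r -> bounded_series r P r ->
  open [set x | cnorm (pair_with x u0 u1) < d /\
    cnorm (near_map P (pair_with x u0 u1)) < d].
Proof.
move=> d0 dr ur; rewrite openE => q [/= qd qu].
pose K := cnorm u0 + cnorm u1 + 1.
have K0 : 0 < K by rewrite ltr_wpDl // addr_ge0 // cnorm_ge0.
pose e := (d - cnorm (pair_with q u0 u1)) / K.
have e0 : 0 < e by rewrite divr_gt0 // subr_gt0.
have /analytic_differentiable/differentiable_continuous cq :=
  analytic_sqn_near_map d0 dr ur qd.
have qu2 : sqn (near_map P (pair_with q u0 u1)) < d ^+ 2.
  by rewrite sqnE ltr_pXn2r ?nnegrE ?cnorm_ge0 ?(ltW d0).
have h1 : \forall x \near q, sqn (near_map P (pair_with x u0 u1)) < d ^+ 2.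
  exact: (cvgr_lt _ cq _ qu2).
have h2 : \forall x \near q, `|q - x| < e.
  by apply/nbhs_ballP; exists e => //= x; rewrite -ball_normE.
near=> x; split => /=.
  have hx : `|q - x| < e by near: x.
  have := cnormD (pair_with q u0 u1) (pair_with (x - q) u0 u1).
  rewrite -pair_withD addrC subrK => /le_lt_trans; apply.
  have := pair_with_le (x - q) u0 u1; rewrite distrC.
  have : (cnorm u0 + cnorm u1) * `|q - x| <= K * `|q - x|.
    by apply: ler_wpM2r => //; rewrite /K; lra.
  have : K * `|q - x| < d - cnorm (pair_with q u0 u1).
    by rewrite mulrC -ltr_pdivlMr.
  lra.
have hx : sqn (near_map P (pair_with x u0 u1)) < d ^+ 2 by near: x.
rewrite sqnE in hx; move: hx.
by rewrite ltr_pXn2r ?nnegrE ?cnorm_ge0 ?(ltW d0).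
Unshelve. all: by end_near. Qed.

End AnalyticPullback.

(** * Dynamics near the origin *)

Section FirstExit.
Variable R : realType.

(** [T] is the infimum of the times at which [h] is at least [d]. *)
Lemma first_exit (h : R -> R) (d t1 : R) : continuous h -> h 0 < d -> 0 <= t1 ->
  d <= h t1 ->
  exists T, [/\ 0 < T, h T = d & forall t, 0 <= t -> t < T -> h t < d].
Proof.
move=> hc h0 t10 ht1.
pose A := [set t | 0 <= t /\ d <= h t].
have A1 : A t1 by [].
have Alb : lbound A 0 by move=> t [].
have iA : has_inf A by split; [exists t1|exists 0].
pose T := inf A.
have T0 : 0 <= T by apply: lb_le_inf => //; exists t1.
have below t : 0 <= t -> t < T -> h t < d.
  move=> t0 tT; rewrite ltNge; apply/negP => dt.
  have : T <= t by apply: ge_inf; [exists 0|split].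
  lra.
have dT : d <= h T.
  rewrite leNgt; apply/negP => hT.
  have /nbhs_ballP [e /= e0 he] : \forall t \near T, h t < d by exact: (cvgr_lt _ (hc T) _ hT).
  have [t [At0 At1] tT] := inf_adherent e0 iA.
  have Tt : T <= t by apply: ge_inf; [exists 0|split].
  have := he t; rewrite /ball /= => /(_ _) H.
  have : h t < d by apply: H; rewrite ler0_norm ?subr_le0 //; lra.
  lra.
have T1 : 0 < T.
  by rewrite lt_neqAle T0 andbT; apply: contraTneq dT => <-; rewrite -ltNge.
exists T; split=> //; apply/eqP; rewrite eq_le dT andbT leNgt; apply/negP => hT.
have /nbhs_ballP [e /= e0 he] : \forall t \near T, d < h t by exact: (cvgr_gt _ (hc T) _ hT).
pose t := Num.max 0 (T - e / 2).
have t0 : 0 <= t by rewrite le_max lexx.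
have tT : t < T by rewrite gt_max T1 /=; lra.
have tT2 : T - e / 2 <= t by rewrite le_max lexx orbT.
have := below t t0 tT; have : d < h t.
  by apply: he; rewrite /ball /= ger0_norm ?subr_ge0; lra.
lra.
Qed.

End FirstExit.

Section Monotonicity.
Variable R : realType.

Lemma nonincreasing_is_derive (N : R -> R) (T : R) :
  (forall t : R, 0 <= t -> t <= T -> exists2 D : R, D <= 0 & is_derive t 1 N D) ->
  forall x y, 0 <= x -> x <= y -> y <= T -> N y <= N x.
Proof.
move=> dN x y x0 xy yT.
have dN' (t : R) : 0 <= t -> t <= T -> derivable N t 1 /\ derive1 N t <= 0.
  by move=> t0 tT; have [D D0 dD] := dN t t0 tT; rewrite derive1E derive_val.
apply: (@ler0_derive1_nincr _ N 0 T) => //.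
- by move=> t; rewrite in_itv /= => /andP [/ltW t0 /ltW tT]; have [] := dN' t t0 tT.
- by move=> t; rewrite in_itv /= => /andP [/ltW t0 /ltW tT]; have [] := dN' t t0 tT.
- apply: derivable_within_continuous => t; rewrite in_itv /= => /andP [t0 tT].
  by have [] := dN' t t0 tT.
Qed.

(** The critical time comes from the mean value theorem, and [N 0 = N T <= N c] by monotonicity.
    When the derivative of an energy vanishes only at energy 0, this forces [N 0 = 0]. *)
Lemma periodic_nonincreasing (N : R -> R) (T : R) : 0 < T -> N T = N 0 ->
  (forall t : R, 0 <= t -> t <= T -> exists2 D : R, D <= 0 & is_derive t 1 N D) ->
  exists c, [/\ 0 < c, c < T, is_derive c 1 N 0 & N 0 <= N c].
Proof.
move=> T0 NT dN.
have dN' (t : R) : 0 <= t -> t <= T -> derivable N t 1.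
  by move=> t0 tT; have [D D0 dD] := dN t t0 tT.
have [||c cT E] := @MVT _ N (fun t => 'D_1 N t) 0 T T0.
- move=> t; rewrite in_itv /= => /andP [/ltW t0 /ltW tT].
  exact/derivableP/dN'.
- by apply: derivable_within_continuous => t; rewrite in_itv /= => /andP [t0 tT];
    exact: dN'.
move: cT; rewrite in_itv /= => /andP [c0 cT].
exists c; split=> //; last by rewrite -NT; apply: (nonincreasing_is_derive dN); lra.
have D0 : 'D_1 N c = 0.
  by move: E => /eqP; rewrite NT subrr subr0 eq_sym mulf_eq0 (gt_eqF T0) orbF => /eqP.
by rewrite -D0; apply/derivableP/dN'; lra.
Qed.

End Monotonicity.

Section Dynamics.
Variable R : realType.
Local Notation C := R[i].
Variables (U : set 'rV[R]_2) (X : 'rV[R]_2 -> 'rV[R]_2).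
Variables (a b omega : R) (phi chi : nat -> nat -> C) (Om be : C -> R) (d r : R).
Hypotheses (b_neq0 : b != 0) (omega_gt0 : 0 < omega).
Hypotheses (d_gt0 : 0 < d) (dr : 8 * d <= r).
Hypotheses (phi2 : order_ge 2 phi) (chi2 : order_ge 2 chi).
Hypotheses (phir : bounded_series r phi r) (chir : bounded_series r chi r).
Let Phi := near_map phi.
Let Psi := near_map chi.
Let zc := eigen_coord a b omega.
Let Li := eigen_inv a b omega.
Hypothesis PsiPhi : forall zeta, cnorm zeta <= 2 * d -> Psi (Phi zeta) = zeta.
Hypothesis PhiPsi : forall z, cnorm z <= 2 * d -> Phi (Psi z) = z.
Hypothesis dC_chi_small :
  forall z h, cnorm z <= 4 * d -> cnorm (dC chi z h) <= 1 / 4 * cnorm h.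
Hypothesis field_eq : forall zeta, cnorm zeta <= 2 * d ->
  zc (X (Li (Phi zeta))) =
  (Om zeta)%:C%C * ('i%C * zeta + dC phi zeta ('i%C * zeta)) +
  (be zeta)%:C%C * zeta.
Hypothesis Om_gt0 : forall zeta, cnorm zeta <= 2 * d -> 0 < Om zeta.
Hypothesis Om_radial : forall z z', cnorm z = cnorm z' -> Om z = Om z'.
Hypothesis inU : forall z, cnorm z <= 2 * d -> U (Li z).

Let r_gt0 : 0 < r. Proof. move: d_gt0 dr; lra. Qed.

Let LiK : cancel Li zc. Proof. exact: eigen_invK. Qed.
Let zcK : cancel zc Li. Proof. exact: eigen_coordK. Qed.

Lemma Phi_le zeta : cnorm zeta <= r -> cnorm (Phi zeta) <= 2 * cnorm zeta.
Proof. by move=> zr; exact: (near_map_le r_gt0). Qed.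

Lemma Psi_le z : cnorm z <= r -> cnorm (Psi z) <= 2 * cnorm z.
Proof. by move=> zr; exact: (near_map_le r_gt0). Qed.

Lemma Phi0 : Phi 0 = 0. Proof. exact: (near_map0 r_gt0). Qed.
Lemma Psi0 : Psi 0 = 0. Proof. exact: (near_map0 r_gt0). Qed.

Lemma zc0 : zc 0 = 0.
Proof. by rewrite /zc /eigen_coord /pair_with !mxE !mul0r addr0. Qed.

Lemma Li0 : Li 0 = 0. Proof. by rewrite -[in LHS]zc0 zcK. Qed.

(** Differentiating [Psi (Phi (exp(is) zeta)) = exp(is) zeta] at [s = 0] gives [DPsi w = i zeta]. *)
Lemma rotated_image zeta : cnorm zeta <= 2 * d ->
  let w := 'i%C * zeta + dC phi zeta ('i%C * zeta) in
  w + dC chi (Phi zeta) w = 'i%C * zeta.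
Proof.
have d0 := d_gt0; have dr8 := dr.
move=> zd w; pose y := rotation_curve 1 zeta.
have yn s : cnorm (y s) = cnorm zeta by exact: cnorm_rotation_curve.
have y0 : y 0 = zeta by exact: rotation_curve0.
have dy : cderive y 0 ('i%C * zeta).
  by have := cderive_rotation_curve 1 zeta 0; rewrite rotation_curve0 mul1r.
have zr : cnorm (y 0) < r by rewrite yn; lra.
have d1 := cderive_near_map phir zr dy; rewrite y0 in d1.
have Phir : cnorm (Phi (y 0)) < r.
  have := Phi_le (ltW zr); rewrite yn; lra.
have d2 := cderive_near_map chir Phir d1; rewrite y0 in d2.
apply: cderive_unique d2 _.
rewrite (_ : (fun s => _) = y) //; apply/funext => s.
by apply: PsiPhi; rewrite yn.
Qed.

Lemma cderive_coord (g : R -> 'rV[R]_2) (t : R) (v : 'rV[R]_2) : is_derive t 1 g v ->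
  cderive (fun s => zc (g s)) t (zc v).
Proof.
move=> /is_derive_rV2 dg; have d0 := dg 0; have d1 := dg 1.
split.
  have := is_deriveB (is_deriveZ b d0) (is_deriveZ a d1).
  rewrite /GRing.scale /= => H.
  rewrite (_ : (fun s => _) = (fun s => b * g s 0 0) - (fun s => a * g s 0 1)).
    by apply: is_derive_eq H _; rewrite /zc /eigen_coord /pair_with /=; ring.
  by apply/funext => s; rewrite !fctE /zc /eigen_coord /pair_with /=; ring.
have := is_deriveZ omega d1; rewrite /GRing.scale /= => H.
rewrite (_ : (fun s => _) = (fun s => omega * g s 0 1)).
  by apply: is_derive_eq H _; rewrite /zc /eigen_coord /pair_with /=; ring.
by apply/funext => s; rewrite /zc /eigen_coord /pair_with /=; ring.
Qed.

Lemma is_derive_coord_inv (y : R -> C) (t : R) (v : C) : cderive y t v ->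
  is_derive t 1 (fun s => Li (y s)) (Li v).
Proof.
move=> [dr' di]; apply/is_derive_rV2 => j.
set m := eigen_mu a b omega j.
have H := is_deriveB (is_deriveZ (2 * Re m) dr') (is_deriveZ (2 * Im m) di).
rewrite (_ : (fun s => _) = (fun s => 2 * Re m * Re (y s)) -
    (fun s => 2 * Im m * Im (y s))).
  apply: is_derive_eq H _; rewrite mxE -/m /GRing.scale /=.
  by case: (m) => m1 m2; case: (v) => v1 v2 /=; ring.
apply/funext => s; rewrite !fctE mxE -/m.
by case: (m) => m1 m2; case: (y s) => v1 v2 /=; ring.
Qed.

(** [DPsi] sends the field to [Om i zeta + be (zeta + e)] with [|e| <= |zeta| / 4]. The first term
    is orthogonal to [zeta]; the second gives [q = 2 (|zeta|^2 + Re (conj zeta * e))]. *)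
Lemma energy_derivative (g : R -> 'rV[R]_2) (t : R) : is_derive t 1 g (X (g t)) ->
  cnorm (zc (g t)) <= d ->
  let zeta := Psi (zc (g t)) in
  exists2 q, cnorm zeta ^+ 2 <= q <= 3 * cnorm zeta ^+ 2 &
    is_derive t 1 (fun s => sqn (Psi (zc (g s)))) (be zeta * q).
Proof.
have d0 := d_gt0; have dr8 := dr.
move=> dg zd zeta; set z := zc (g t) in zd zeta *.
have zr : cnorm z <= r by lra.
have zetad : cnorm zeta <= 2 * d by have := Psi_le zr; rewrite -/zeta; lra.
have Pz : Phi zeta = z by apply: PhiPsi; lra.
have dz := cderive_coord dg.
have := field_eq zetad; rewrite Pz zcK => fe; rewrite fe in dz.
set w := 'i%C * zeta + _ in fe dz.
have zlt : cnorm z < r by lra.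
have dzeta := cderive_near_map chir zlt dz.
have rot := rotated_image zetad; rewrite -/w Pz in rot.
set e := dC chi z zeta.
have E : (Om zeta)%:C%C * w + (be zeta)%:C%C * zeta +
    dC chi z ((Om zeta)%:C%C * w + (be zeta)%:C%C * zeta) =
    (Om zeta)%:C%C * ('i%C * zeta) + (be zeta)%:C%C * (zeta + e).
  by rewrite dCD !dCZ -rot /e; ring.
rewrite E in dzeta.
exists (2 * (cnorm zeta ^+ 2 + Re (cconj zeta * e))).
  have zd4 : cnorm z <= 4 * d by lra.
  have := Re_le_cnorm (cconj zeta * e); rewrite cnormM cnorm_conj.
  have := ler_wpM2l (cnorm_ge0 zeta) (dC_chi_small zeta zd4); rewrite -/e.
  have := ler_norm (- Re (cconj zeta * e)); rewrite normrN expr2.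
  have := ler_norm (Re (cconj zeta * e)).
  have := mulr_ge0 (cnorm_ge0 zeta) (cnorm_ge0 zeta).
  by move=> *; apply/andP; split; lra.
have H := is_derive_sqn dzeta; apply: is_derive_eq H _.
rewrite -/(Psi z) -/zeta -sqnE /sqn; move: (Om zeta) (be zeta) => o bb.
by case: (zeta) (e) => x y [e1 e2] /=; ring.
Qed.

Lemma sqn_lt (z : C) (e : R) : 0 < e -> (sqn z < e ^+ 2) = (cnorm z < e).
Proof.
by move=> e0; rewrite sqnE ltr_pXn2r ?nnegrE ?cnorm_ge0 ?(ltW e0).
Qed.

Lemma sqn_le (z : C) (e : R) : 0 <= e -> (sqn z <= e ^+ 2) = (cnorm z <= e).
Proof. by move=> e0; rewrite sqnE ler_pXn2r ?nnegrE ?cnorm_ge0. Qed.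

(** * Radial part of strict sign: no periodic orbit near the origin *)

Section NonvanishingRadialPart.
Variable sg : R.
Hypothesis sg1 : sg = 1 \/ sg = -1.
Hypothesis sgP : forall zeta, zeta != 0 -> cnorm zeta <= 2 * d ->
  0 < sg * be zeta.

Lemma no_periodic_orbit (O : set 'rV[R]_2) q : periodic_orbit U X O -> O q ->
  q != 0 -> cnorm (zc q) < d / 8 -> False.
Proof.
have d0 := d_gt0; have dr8 := dr.
have aux1 (x y : R) : x <= 2 * y -> y <= d / 4 -> x < d by lra.
have aux2 (x : R) : x <= d / 4 -> x <= r by lra.
have aux3 (x : R) : x <= d -> x <= 2 * d by lra.
have aux4 (x : R) : x <= d -> x <= r by lra.
have aux5 (x : R) : x <= d -> 2 * x <= 2 * d by lra.
have aux6 (x y z : R) : 0 <= x * y * z -> y * z * - x <= 0.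
  by have -> : y * z * - x = - (x * y * z); [ring|lra].
have aux7 (x y z : R) : 0 < x * y * z -> y * z * - x = 0 -> False.
  by have -> : y * z * - x = - (x * y * z); [ring|lra].
have d4 : 0 <= d / 4 by lra.
move=> [g [_ dg [T T0 per] _ ->]] [t0 _ gq] q0 qd.
have qd1 : cnorm (zc q) < d by lra.
have Psiq4 : cnorm (Psi (zc q)) <= d / 4.
  by have := @Psi_le (zc q) ltac:(lra); lra.
(* Time is directed by the sign of the radial part so that the energy [N] does not increase. *)
pose G t := g (t0 - sg * t).
have G0 : G 0 = q by rewrite /G mulr0 subr0.
have dtau (t : R) : is_derive t 1 (fun s => t0 - sg * s) (- sg).
  have H := is_deriveB (@is_derive_cst R R R t0 t 1) (is_deriveZ sg (@is_derive_id R R t 1)).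
  apply: is_derive_eq H _; by rewrite /GRing.scale /= sub0r mulr1.
pose N t := sqn (Psi (zc (G t))).
have dN (t : R) : cnorm (zc (G t)) <= d -> exists2 D : R, D <= 0 & is_derive t 1 N D /\
    (D = 0 -> Psi (zc (G t)) = 0).
  move=> Gd; have [e /andP [e1 e2] dn] := energy_derivative (dg (t0 - sg * t)) Gd.
  rewrite -/(G t) in e1 e2 dn *; set zeta := Psi (zc (G t)) in e1 e2 dn *.
  have zetad : cnorm zeta <= 2 * d.
    by apply: le_trans (Psi_le (aux4 _ Gd)) _; exact: aux5.
  exists (be zeta * e * - sg).
    have [z0|z0] := eqVneq zeta 0.
      rewrite z0 cnorm0 expr0n /= mulr0 in e1 e2.
      have -> : e = 0 by apply/eqP; rewrite eq_le e1 e2.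
      by rewrite mulr0 mul0r.
    have e0 : 0 <= e by apply: le_trans e1; rewrite exprn_ge0 ?cnorm_ge0.
    exact: aux6 (mulr_ge0 (ltW (sgP z0 zetad)) e0).
  split; first exact: (@is_derive1_comp _ (fun s => sqn (Psi (zc (g s)))) (fun s => t0 - sg * s)).
  move=> D0; have [//|z0] := eqVneq zeta 0; exfalso.
  have e0 : 0 < e.
    apply: lt_le_trans e1; rewrite exprn_gt0 // lt_neqAle cnorm_ge0 andbT eq_sym.
    by apply: contraNneq z0 => /cnorm_eq0 ->.
  exact: aux7 (mulr_gt0 (sgP z0 zetad) e0) D0.
pose h t := sqn (zc (G t)).
have hc : continuous h.
  move=> t; apply/differentiable_continuous/derivable1_diffP.
  have H := is_derive_sqn (cderive_coord (dg (t0 - sg * t))).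
  by have := @is_derive1_comp _ (fun s => sqn (zc (g s))) (fun s => t0 - sg * s) t _ _ H (dtau t).
have h0 : h 0 < d ^+ 2 by rewrite /h G0 (sqn_lt _ d0).
have N0 : N 0 <= (d / 4) ^+ 2.
  by rewrite /N G0 (sqn_le _ d4).
(* The energy estimate holds only while [|z| <= d]. Up to a first exit, [|Psi|] stays at most
   [d / 4], hence [|z| <= d / 2], and the orbit cannot be at the boundary. *)
have trapped t : 0 <= t -> cnorm (zc (G t)) < d.
  move=> tge0; rewrite -sqn_lt // ltNge; apply/negP => dt.
  have [Tx [Tx0 hTx before]] := first_exit hc h0 tge0 dt.
  have le_d s : 0 <= s -> s <= Tx -> cnorm (zc (G s)) <= d.
    rewrite le_eqVlt => s0; rewrite le_eqVlt => /predU1P [->|sTx].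
      by rewrite -sqn_le ?(ltW d0) // -/(h Tx) hTx.
    by rewrite ltW // -sqn_lt //; apply: before => //; rewrite le_eqVlt.
  have NTx : N Tx <= N 0.
    apply: (@nonincreasing_is_derive _ N Tx) => //; last exact: ltW.
    by move=> s s0 sTx; have [D D0 [dD _]] := dN s (le_d s s0 sTx); exists D.
  have : cnorm (Psi (zc (G Tx))) <= d / 4.
    by rewrite -(sqn_le _ d4); exact: le_trans NTx N0.
  have Txd := le_d Tx (ltW Tx0) (lexx Tx) => zs.
  have := @Phi_le (Psi (zc (G Tx))) (aux2 _ zs).
  rewrite (PhiPsi (aux3 _ Txd)) => le2.
  have : cnorm (zc (G Tx)) < d by exact: aux1 le2 zs.
  by rewrite -(sqn_lt _ d0) -/(h Tx) hTx ltxx.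
have NT : N T = N 0.
  rewrite /N G0 /G; case: sg1 => ->.
    by rewrite mul1r -(per (t0 - T)) subrK gq.
  by rewrite mulN1r opprK per gq.
(* At the critical time [Psi] vanishes, so [N 0 <= N c = 0] and the starting point is the origin. *)
have [|c [c0 cT dc Nc]] := periodic_nonincreasing T0 NT.
  by move=> t tge0 _; have [D D0 [dD _]] := dN t (ltW (trapped t tge0)); exists D.
have [D D0 [dD Dz]] := dN c (ltW (trapped c (ltW c0))).
have Dz0 : D = 0.
  by rewrite -(@derive_val _ _ _ _ _ _ _ dD) (@derive_val _ _ _ _ _ _ _ dc).
have N00 : N 0 <= 0.
  by apply: le_trans Nc _; rewrite /N (Dz Dz0) sqnE cnorm0 expr0n.
have NE : N 0 = cnorm (Psi (zc q)) ^+ 2 by rewrite /N G0 sqnE.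
rewrite NE in N00.
have Pz : Psi (zc q) = 0.
  apply: cnorm_eq0; apply/eqP; rewrite -sqrf_eq0 eq_le N00.
  by rewrite exprn_ge0 ?cnorm_ge0.
move: q0; rewrite -(zcK q) -(PhiPsi (aux3 _ (ltW qd1))).
by rewrite Pz Phi0 Li0 eqxx.
Qed.

End NonvanishingRadialPart.

(** * Zero radial part: explicit periodic orbits and the first integral *)

Section VanishingRadialPart.
Hypothesis be0 : forall zeta, cnorm zeta <= 2 * d -> be zeta = 0.

Definition orbit_curve zeta t := Li (Phi (rotation_curve (Om zeta) zeta t)).

Lemma zc_orbit_curve zeta t :
  zc (orbit_curve zeta t) = Phi (rotation_curve (Om zeta) zeta t).
Proof. exact: LiK. Qed.

Lemma Psi_orbit_curve zeta t : cnorm zeta <= 2 * d ->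
  Psi (zc (orbit_curve zeta t)) = rotation_curve (Om zeta) zeta t.
Proof.
by move=> zd; rewrite zc_orbit_curve PsiPhi // cnorm_rotation_curve.
Qed.

Lemma orbit_curve0 q : cnorm (zc q) <= 2 * d -> orbit_curve (Psi (zc q)) 0 = q.
Proof. by move=> qd; rewrite /orbit_curve rotation_curve0 PhiPsi // zcK. Qed.

Lemma is_derive_orbit_curve zeta (t : R) : cnorm zeta <= 2 * d ->
  is_derive t 1 (orbit_curve zeta) (X (orbit_curve zeta t)).
Proof.
have d0 := d_gt0; have dr8 := dr.
move=> zd; pose y := rotation_curve (Om zeta) zeta.
have yn : cnorm (y t) = cnorm zeta by exact: cnorm_rotation_curve.
have yr : cnorm (y t) < r by rewrite yn; lra.
have yd : cnorm (y t) <= 2 * d by rewrite yn.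
have H := is_derive_coord_inv
  (cderive_near_map phir yr (cderive_rotation_curve (Om zeta) zeta t)).
apply: is_derive_eq H _.
rewrite -[RHS]zcK; congr Li; rewrite -/(y t).
rewrite -[orbit_curve zeta t]/(Li (Phi (y t))) field_eq // be0 //.
(* The angular speed depends only on the modulus, which is constant along the rotation. *)
by rewrite (Om_radial yn) dCZ; ring.
Qed.

Lemma cnorm_zc_orbit_curve zeta t : cnorm zeta <= 2 * d ->
  cnorm (zc (orbit_curve zeta t)) <= 2 * cnorm zeta.
Proof.
have d0 := d_gt0; have dr8 := dr.
move=> zd; have := @Phi_le (rotation_curve (Om zeta) zeta t).
by rewrite zc_orbit_curve cnorm_rotation_curve => -> //; lra.
Qed.

Lemma inU_zc q : cnorm (zc q) <= 2 * d -> U q.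
Proof. by move=> qd; rewrite -(zcK q); exact: inU. Qed.

Lemma rotation_curve_periodic (w : R) zeta (t : R) : w != 0 ->
  rotation_curve w zeta (t + 2 * pi / w) = rotation_curve w zeta t.
Proof.
move=> w0; rewrite /rotation_curve.
have -> : w * (t + 2 * pi / w) = w * t + pi + pi by field.
by rewrite !cosDpi !sinDpi !opprK.
Qed.

Lemma rotation_curve_half (w : R) zeta : w != 0 ->
  rotation_curve w zeta (pi / w) = - zeta.
Proof.
move=> w0; rewrite /rotation_curve.
have -> : w * (pi / w) = pi by field.
rewrite cospi sinpi.
by case: zeta => x y; apply/eqP; rewrite eq_complex /=;
  apply/andP; split; apply/eqP; ring.
Qed.

Lemma orbit_curve_neq0 zeta t : zeta != 0 -> cnorm zeta <= 2 * d ->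
  orbit_curve zeta t != 0.
Proof.
move=> z0 zd; apply: contraNneq z0 => /(congr1 (fun q => Psi (zc q))).
rewrite Psi_orbit_curve // zc0 Psi0 => /(congr1 (@cnorm R)).
by rewrite cnorm_rotation_curve cnorm0 => /cnorm_eq0 ->.
Qed.

Lemma orbit_periodic zeta : zeta != 0 -> cnorm zeta <= d ->
  periodic_orbit U X (range (orbit_curve zeta)).
Proof.
have d0 := d_gt0; move=> z0 zd; have zd2 : cnorm zeta <= 2 * d by lra.
have w0 := Om_gt0 zd2; have wn0 : Om zeta != 0 by rewrite gt_eqF.
exists (orbit_curve zeta); split=> //.
- by move=> t; apply: inU_zc; have := cnorm_zc_orbit_curve t zd2; lra.
- by move=> t; exact: is_derive_orbit_curve.
- exists (2 * pi / Om zeta); first by rewrite divr_gt0 // mulr_gt0 // pi_gt0.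
  by move=> t; rewrite /orbit_curve rotation_curve_periodic.
(* Half a turn carries [zeta] to [- zeta], so the orbit is not constant. *)
- exists (pi / Om zeta); apply/eqP => E.
  have E1 := Psi_orbit_curve (pi / Om zeta) zd2.
  have E2 := Psi_orbit_curve 0 zd2.
  have : - zeta = zeta.
    rewrite -{1}(rotation_curve_half zeta wn0) -[RHS](rotation_curve0 (Om zeta)).
    by rewrite -E1 -E2 E.
  move=> /eqP.
  rewrite eq_sym -subr_eq0 opprK -mulr2n mulrn_eq0 /= => z00.
  by rewrite z00 in z0.
Qed.

Lemma near0_zc e : 0 < e -> \forall q \near (0 : 'rV[R]_2), cnorm (zc q) < e.
Proof.
move=> e0; have [K K0 Kle] := eigen_coord_bound a b omega.
apply/nbhs_ballP; exists (e / K) => /=; first by rewrite divr_gt0.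
move=> q; rewrite -ball_normE /= sub0r normrN ltr_pdivlMr // mulrC => qe.
exact: le_lt_trans (Kle q) qe.
Qed.

Lemma zc_eq0 q : zc q = 0 -> q = 0.
Proof. by move=> q0; rewrite -(zcK q) q0 Li0. Qed.

(** If [X q = 0], then [Om w = 0], so [w = 0], and [rotated_image] gives [i zeta = DPsi w = 0]. *)
Lemma field_neq0 q : q != 0 -> cnorm (zc q) <= d -> X q != 0.
Proof.
have d0 := d_gt0; have dr8 := dr.
move=> q0 qd; have qr : cnorm (zc q) <= r by lra.
have zd : cnorm (Psi (zc q)) <= 2 * d by have := Psi_le qr; lra.
have qd2 : cnorm (zc q) <= 2 * d by lra.
apply: contraNneq q0 => Xq.
have rot := rotated_image zd; have := field_eq zd.
rewrite be0 // PhiPsi // zcK Xq zc0 rmorph0 mul0r addr0 => /esym/eqP.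
rewrite mulf_eq0; move: rot; set w := 'i%C * Psi (zc q) + _ => rot /orP [/eqP|/eqP w0].
  by move=> /(congr1 (@Re R)) /= Om0; have := Om_gt0 zd; rewrite Om0 ltxx.
cbv zeta in rot; rewrite w0 add0r (PhiPsi qd2) in rot.
have z00 : Psi (zc q) = 0.
  apply: cnorm_eq0; rewrite -[LHS]mul1r -(@cnorm_i R) -cnormM -rot.
  apply/eqP; rewrite eq_le cnorm_ge0 andbT.
  apply: le_trans (dC_chi_small _ _) _; last by rewrite cnorm0 mulr0.
  lra.
by apply/eqP; rewrite -(zcK q) -(PhiPsi qd2) z00 Phi0 Li0.
Qed.

Lemma X0_center : X 0 = 0 -> center U X 0.
Proof.
have d0 := d_gt0; have dr8 := dr.
move=> X0; split.
  split=> //; near=> q => q0; apply: field_neq0 => //; apply: ltW.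
  by near: q; exact: near0_zc.
(* [|Psi|] is constant along orbits, and [|Psi| < d / 4] bounds [|z|] by [d / 2] along them, so both
   conditions persist. *)
exists [set q | cnorm (zc q) <= d /\ cnorm (Psi (zc q)) < d / 4]; split.
- have d8 : 0 < d / 8 by lra.
  near=> q; have qd : cnorm (zc q) < d / 8 by near: q; exact: near0_zc.
  have qr : cnorm (zc q) <= r by lra.
  by have := Psi_le qr; split => /=; lra.
- by move=> q [qd _]; apply: inU_zc; lra.
- move=> q [/= qd Pd] q0; have qd2 : cnorm (zc q) <= 2 * d by lra.
  set zeta := Psi (zc q) in Pd.
  have zeta0 : zeta != 0.
    apply: contraNneq q0 => z0; apply/eqP/zc_eq0.
    by rewrite -(PhiPsi qd2) -/zeta z0 Phi0.
  have zd : cnorm zeta <= d by lra.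
  have zd2 : cnorm zeta <= 2 * d by lra.
  exists (range (orbit_curve zeta)); split; first exact: orbit_periodic.
    by exists 0 => //; exact: orbit_curve0.
  move=> _ [t _ <-] /=; split.
    by have := cnorm_zc_orbit_curve t zd2; lra.
  by rewrite Psi_orbit_curve // cnorm_rotation_curve.
Unshelve. all: by end_near. Qed.

Lemma shrinking_orbits : exists O : nat -> set 'rV[R]_2,
  [/\ forall n, periodic_orbit U X (O n), forall n, O n `<=` U `\ 0 &
    shrinks_to O 0].
Proof.
have d0 := d_gt0; have dr8 := dr.
pose zeta n : C := (d / n.+1%:R)%:C%C.
have n0 n : 0 < d / n.+1%:R by rewrite divr_gt0.
have zn n : cnorm (zeta n) = d / n.+1%:R by rewrite cnormC gtr0_norm.
have zd n : cnorm (zeta n) <= d.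
  by rewrite zn ler_pdivrMr // ler_peMr ?(ltW d0) // ler1n.
have zd2 n : cnorm (zeta n) <= 2 * d by have := zd n; lra.
have z0 n : zeta n != 0.
  by apply/eqP => /(congr1 (@cnorm R)) /eqP; rewrite zn cnorm0 gt_eqF.
have per n := orbit_periodic (z0 n) (zd n).
exists (fun n => range (orbit_curve (zeta n))); split=> //.
  move=> n _ [t _ <-]; split => /=.
    apply: inU_zc; have := cnorm_zc_orbit_curve t (zd2 n); have := zd n; lra.
  by move=> /eqP; apply/negP; exact: orbit_curve_neq0.
move=> W /nbhs_ballP [e /= e0 eW].
have [K K0 Kle] := eigen_inv_bound a b omega.
have K2 : 0 < 2 * K * d by rewrite !mulr_gt0.
near=> n; move=> _ [t _ <-]; apply: eW.
rewrite -ball_normE /= sub0r normrN.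
apply: le_lt_trans (Kle _) _.
have h1 : cnorm (Phi (rotation_curve (Om (zeta n)) (zeta n) t)) <= 2 * cnorm (zeta n).
  by rewrite -zc_orbit_curve; exact: cnorm_zc_orbit_curve.
apply: le_lt_trans (ler_wpM2l (ltW K0) h1) _; rewrite zn.
have -> : K * (2 * (d / n.+1%:R)) = (2 * K * d) / n.+1%:R by ring.
rewrite ltr_pdivrMr // [e * _]mulrC -ltr_pdivrMr //.
near: n; exists (Num.truncn (2 * K * d / e)).+1 => // n /= nN.
by rewrite -truncn_le_nat; exact: ltnW nN.
Unshelve. all: by end_near. Qed.

Lemma toC_pair_with (x : 'rV[R]_2) : pair_with x 1 'i%C = toC x.
Proof. by rewrite -toC_affine /pair_with mulr1 mulrC. Qed.

Definition energy q : R := sqn (Psi (zc q)).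

Lemma energy_analytic q : cnorm (zc q) < d -> analytic_at energy q.
Proof.
have d0 := d_gt0; have dr8 := dr; have dr2 : 2 * d <= r by lra.
by move=> qd; exact: (analytic_sqn_near_map d0 dr2 chir qd).
Qed.

(** The derivative along [X q] is computed on the explicit orbit through [q], where the energy is
    constant. *)
Lemma energy_first_integral q : cnorm (zc q) < d -> 'D_(X q) energy q = 0.
Proof.
have d0 := d_gt0; have dr8 := dr.
move=> qd; have qd2 : cnorm (zc q) <= 2 * d by lra.
have qr : cnorm (zc q) <= r by lra.
have zd : cnorm (Psi (zc q)) <= 2 * d by have := Psi_le qr; lra.
have dE := analytic_differentiable (energy_analytic qd).
rewrite deriveE //; have dg := is_derive_orbit_curve 0 zd.
rewrite (orbit_curve0 qd2) in dg.
have dE' : differentiable energy (orbit_curve (Psi (zc q)) 0).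
  by rewrite (orbit_curve0 qd2).
have := is_derive_curve dE' dg.
have -> : energy \o orbit_curve (Psi (zc q)) = cst (cnorm (Psi (zc q)) ^+ 2).
  apply/funext => t; have E := Psi_orbit_curve t zd.
  transitivity (sqn (Psi (zc (orbit_curve (Psi (zc q)) t)))); first by [].
  by rewrite E sqnE cnorm_rotation_curve.
move=> H; have := @derive_val _ _ _ _ _ _ _ H.
by rewrite derive_cst (orbit_curve0 qd2) => <-.
Qed.

Lemma has_power_series_cst0 (p : 'rV[R]_2) :
  has_power_series (fun=> 0) p (fun _ _ => 0) (1 : R).
Proof.
move=> h _; have mono0 n i : monomial2 (fun _ _ => 0 : R) i (n - i) h = 0.
  by rewrite /monomial2 !mul0r.
split.
  rewrite (_ : series _ = fun=> 0); first exact: is_cvg_cst.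
  apply/funext => N; rewrite /series /= big1 // => n _; apply: big1 => i _.
  by rewrite mono0 normr0.
rewrite (_ : series _ = fun=> 0); first exact: cvg_cst.
apply/funext => N; rewrite /series /= big1 // => n _; apply: big1 => i _.
by rewrite mono0.
Qed.

Lemma strong_first_integral : strong_first_integral_at0 U X.
Proof.
have d0 := d_gt0; have dr8 := dr; have dr2 : 2 * d <= r by lra.
(* [V] and [W] bound both a point and its image, so [Psi] and [Phi] exchange their two conditions
   and are inverse bijections between them. *)
pose V := [set q | cnorm (zc q) < d /\ cnorm (Psi (zc q)) < d].
pose W := [set x | cnorm (toC x) < d /\ cnorm (Phi (toC x)) < d].
have V_open : open V by 
  exact: (@open_near_map_domain R chi r d b%:C%C (Complex (- a) omega) d0 dr2 chir).
have W_open : open W.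
  have -> : W = [set x | cnorm (pair_with x 1 'i%C) < d /\
      cnorm (near_map phi (pair_with x 1 'i%C)) < d].
    by apply/funext => x; rewrite /W /mkset toC_pair_with.
  exact: (@open_near_map_domain R phi r d 1 'i%C d0 dr2 phir).
have tC0 : toC (0 : 'rV[R]_2) = 0 by rewrite /toC !mxE.
have V0 : V 0 by rewrite /V /= zc0 Psi0 cnorm0.
have W0 : W 0 by rewrite /W /= tC0 Phi0 cnorm0.
have VU : V `<=` U by move=> q [/ltW qd _]; apply: inU_zc; lra.
exists V, energy; split; first by split.
  split.
  - by move=> q [qd _]; exact: energy_analytic.
  - pose zeta : C := (d / 4)%:C%C.
    have zn : cnorm zeta = d / 4 by rewrite cnormC ger0_norm // divr_ge0 // ltW.
    have d4 : d / 4 < d by lra.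
    have zr : cnorm zeta <= r by rewrite zn; lra.
    have zd : cnorm zeta <= 2 * d by rewrite zn; lra.
    have Pd : cnorm (Phi zeta) < d by have := Phi_le zr; rewrite zn; lra.
    exists 0, (Li (Phi zeta)); split; first exact: V0.
      by split; rewrite LiK ?(PsiPhi zd) ?zn.
    rewrite /energy zc0 Psi0 LiK (PsiPhi zd) !sqnE cnorm0 zn expr0n /= eq_sym.
    by rewrite sqrf_eq0 gt_eqF // divr_gt0.
  - by move=> q [qd _]; exact: energy_first_integral.
(* In the coordinate [Psi] the energy is exactly the sum of two squares, so the higher order term is
   0. *)
exists V, W, (fun q => ofC (Psi (zc q))), (fun x => Li (Phi (toC x))), (fun=> 0).
split.
- split.
  + split; [exact: V_open|exact: W_open|exact: V0|exact: W0|].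
    by rewrite zc0 Psi0; apply: eq_rV2; rewrite !mxE.
  + split=> j p [pd _].
      have := @analytic_near_map_component R chi r d b%:C%C (Complex (- a) omega)
        (if j == 0 then 1 else - 'i%C) p d0 dr2 chir pd.
      rewrite (_ : (fun x => _) = fun q => ofC (Psi (zc q)) 0 j) //.
      apply/funext => q; rewrite mxE -/(eigen_coord a b omega q) -/(zc q) -/(Psi (zc q)).
      by case: (Psi (zc q)) => x y; case: ifP => _ /=; ring.
    have pd' : cnorm (pair_with p 1 'i%C) < d by rewrite toC_pair_with.
    have := @analytic_near_map_component R phi r d 1 'i%C (2 * eigen_mu a b omega j)
      p d0 dr2 phir pd'.
    rewrite (_ : (fun x => _) = fun x => Li (Phi (toC x)) 0 j) //.
    apply/funext => q; rewrite toC_pair_with mxE -/(Phi (toC q)) -mulrA.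
    by case: (_ * Phi (toC q)) => x y /=; ring.
  + move=> q [qd Pd]; have qd2 : cnorm (zc q) <= 2 * d by lra.
    by rewrite /W /mkset ofCK (PhiPsi qd2) zcK.
  + move=> x [xd Pd]; have xd2 : cnorm (toC x) <= 2 * d by lra.
    by rewrite /V /mkset LiK (PsiPhi xd2) toCK.
- exists (fun _ _ => 0), 1; split; first exact: ltr01.
    exact: has_power_series_cst0.
  by [].
- move=> x [xd Pd]; have xd2 : cnorm (toC x) <= 2 * d by lra.
  by rewrite /energy LiK (PsiPhi xd2) addr0.
Qed.

End VanishingRadialPart.

End Dynamics.

(** Either everything holds, or both conditions fail, since each would produce a periodic orbit
    through a nonzero point of [W]. *)
Lemma center_dichotomy (R : realType) (U : set 'rV[R]_2)
    (X : 'rV[R]_2 -> 'rV[R]_2) : open U -> U 0 -> analytic_map_on U X ->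
  X 0 = 0 -> generates_rotation ('J X 0) ->
  [/\ center U X 0,
      exists O : nat -> set 'rV[R]_2,
        [/\ forall n, periodic_orbit U X (O n), forall n, O n `<=` U `\ 0 &
          shrinks_to O 0] &
      strong_first_integral_at0 U X] \/
  exists2 W : set 'rV[R]_2, nbhs (0 : 'rV[R]_2) W & forall (O : set 'rV[R]_2) q,
    periodic_orbit U X O -> O q -> W q -> q = 0.
Proof.
move=> U_open U0 X_an X0 rotX.
have X_an0 j : analytic_at (fun p => X p 0 j) 0 by exact: X_an.
have [a [b [omega [f [p [B [b0 w0 p0 f2 [fB fE]]]]]]]] := complex_field X_an0 X0 rotX.
have [phi [chi [Om [be [d' [r [[d'0 d'r rp] [phi2 chi2 phir chir] [PsiPhi PhiPsi]
  [small nf] [Om0 Omr sign]]]]]]]] := normal_conjugacy w0 p0 f2 fB.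
have [K K0 Kle] := eigen_inv_bound a b omega.
have /nbhs_ballP [e /= e0 eU] : nbhs (0 : 'rV[R]_2) U by exact: open_nbhs_nbhs.
(* The radius is shrunk again so that the image of the ball of radius [2 d] has norm at most [e / 2]
   and lies in [U]. *)
pose d := Num.min d' (e / (4 * K)).
have d0 : 0 < d by rewrite lt_min d'0 divr_gt0 // mulr_gt0.
have dd' : d <= d' by rewrite ge_min lexx.
have dK : d * (4 * K) <= e.
  by rewrite -ler_pdivlMr ?mulr_gt0 // ge_min lexx orbT.
have dr : 8 * d <= r by lra.
have le2 (x : R) : x <= 2 * d -> x <= 2 * d' by lra.
have le4 (x : R) : x <= 4 * d -> x <= 4 * d' by lra.
have r0 : 0 < r by lra.
have inU z : cnorm z <= 2 * d -> U (eigen_inv a b omega z).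
  move=> zd; apply: eU; rewrite -ball_normE /= sub0r normrN.
  apply: le_lt_trans (Kle z) _; have := ler_wpM2l (ltW K0) zd.
  have := mulr_gt0 K0 d0; lra.
have field zeta : cnorm zeta <= 2 * d ->
    eigen_coord a b omega (X (eigen_inv a b omega (near_map phi zeta))) =
    (Om zeta)%:C%C * ('i%C * zeta + dC phi zeta ('i%C * zeta)) +
    (be zeta)%:C%C * zeta.
  move=> zd; have zr : cnorm zeta <= r by lra.
  have Pr := near_map_le r0 zr phi2 phir.
  rewrite fE; last by lra.
  exact: nf (le2 _ zd).
have PsiPhi' zeta (zd : cnorm zeta <= 2 * d) := PsiPhi zeta (le2 _ zd).
have PhiPsi' z (zd : cnorm z <= 2 * d) := PhiPsi z (le2 _ zd).
have small' z h (zd : cnorm z <= 4 * d) := small z h (le4 _ zd).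
have Om0' zeta (zd : cnorm zeta <= 2 * d) := Om0 zeta (le2 _ zd).
case: sign => [be0|[sg sg1 sgP]].
  have be0' zeta (zd : cnorm zeta <= 2 * d) := be0 zeta (le2 _ zd).
  left; split.
  - exact: (X0_center b0 w0 d0 dr phi2 chi2 phir chir PsiPhi' PhiPsi' small' field
      Om0' Omr inU be0' X0).
  - exact: (shrinking_orbits b0 w0 d0 dr phi2 chi2 phir chir PsiPhi' field Om0'
      Omr inU be0').
  - exact: (strong_first_integral b0 w0 d0 dr phi2 chi2 phir chir PsiPhi' PhiPsi'
      field Omr inU be0').
right; exists [set q | cnorm (eigen_coord a b omega q) < d / 8].
  by apply: near0_zc; rewrite divr_gt0.
move=> O q perO Oq Wq; apply/eqP/negPn/negP => q0.
have sgP' zeta (z0 : zeta != 0) (zd : cnorm zeta <= 2 * d) := sgP zeta z0 (le2 _ zd).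
exact: (no_periodic_orbit b0 w0 d0 dr phi2 chi2 phir chir PsiPhi' PhiPsi' small'
  field sg1 sgP' perO Oq q0 Wq).
Qed.

Theorem theorem1 (R : realType) (U : set 'rV[R]_2)
    (X : 'rV[R]_2 -> 'rV[R]_2)
    (U_open : open U) (U_origin : U 0)
    (X_analytic : analytic_map_on U X)
    (X_origin : X 0 = 0)
    (X_rotation : generates_rotation ('J X 0)) :
  let cond_i := center U X 0 in
  let cond_ii :=
    exists C : nat -> set 'rV[R]_2,
      [/\ forall n, periodic_orbit U X (C n),
          forall n, C n `<=` U `\ 0 &
          shrinks_to C 0] in
  (cond_i <-> cond_ii) /\
  (cond_i \/ cond_ii -> strong_first_integral_at0 U X).
Proof.
move=> cond_i cond_ii.
have [[ci cii fi]|[W W0 noW]] :=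
  center_dichotomy U_open U_origin X_analytic X_origin X_rotation.
  by split.
have not_i : ~ cond_i.
  move=> [_ [V [V0 _ VP]]].
  have /nbhs_ballP [e /= e0 eVW] : nbhs (0 : 'rV[R]_2) (V `&` W) by exact: filterI.
  pose q : 'rV[R]_2 := const_mx (e / 2).
  have q0 : q != 0.
    apply/eqP => /rowP /(_ 0) /eqP; rewrite !mxE gt_eqF // divr_gt0 //.
  have [Vq Wq] : (V `&` W) q.
    apply: eVW; rewrite -ball_normE /= sub0r normrN.
    have h : `|e / 2| <= e / 2 by rewrite gtr0_norm // divr_gt0.
    have := @norm_le_coord R q (e / 2); rewrite !mxE => /(_ h h); lra.
  have [orb [perO Oq _]] := VP q Vq q0.
  by move: q0; rewrite (noW orb q perO Oq Wq) eqxx.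
have not_ii : ~ cond_ii.
  move=> [orb [perO OU shrO]].
  have [n _ /(_ n (leqnn n)) OW] := shrO W W0.
  have [g [_ _ _ _ Og]] := perO n.
  have Oq : orb n (g 0) by rewrite Og; exists 0.
  have [_ /=] := OU n _ Oq; apply.
  by apply: (noW (orb n)) => //; exact: OW.
by split; [split=> [/not_i|/not_ii]|case=> [/not_i|/not_ii]].
Qed.
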